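(* Let $0<\alpha<1/3$ and let $W$ be a standard one-dimensional Brownian motion. Then weak uniqueness (uniqueness in law) fails for the equation $$X_t=\int_0^t\operatorname{sign}(X_s)|X_s|^\alpha\,ds+\int_0^tW_s\,ds,\qquad t\ge0,$$ started from $X_0=0$; that is, there exist two weak solutions $X$ of this equation with different laws.
   Context: A weak solution is a pair $(X,W)$ of continuous processes, defined on some filtered probability space and adapted to its filtration, such that $W$ is a Brownian motion with respect to that filtration and the equation holds almost surely for all $t\ge 0$. The drift $x\mapsto\operatorname{sign}(x)|x|^\alpha$ is Hölder continuous of exponent $\alpha$. *)

(* Defs.v *)
From HB Require Import structures.
From mathcomp Require Import all_boot all_order all_algebra.
From mathcomp Require Import all_classical all_reals all_analysis.

Set Implicit Arguments.
Unset Strict Implicit.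
Unset Printing Implicit Defensive.
Import Order.TTheory GRing.Theory Num.Theory.
Import numFieldNormedType.Exports.

Local Open Scope classical_set_scope.
Local Open Scope ring_scope.

(* Processes and filtrations are indexed by [R], but only the times [0 <= t]
   are ever looked at: every condition below is restricted to them. *)

Record is_filtration (R : realType) d (T : measurableType d)
    (F : R -> set (set T)) : Prop := {
  filtration_sigma_algebra : forall t : R, 0 <= t -> sigma_algebra [set: T] (F t);
  filtration_measurable : forall t : R, 0 <= t -> F t `<=` measurable;
  filtration_mono : forall s t : R, 0 <= s -> s <= t -> F s `<=` F t }.

Definition adapted (R : realType) d (T : measurableType d)
    (F : R -> set (set T)) (X : R -> T -> R) : Prop :=
  forall t : R, 0 <= t -> forall B : set R, measurable B -> F t (X t @^-1` B).

Definition continuous_paths (R : realType) d (T : measurableType d)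
    (X : R -> T -> R) : Prop :=
  forall w, {within `[0, +oo[, continuous (X ^~ w)}.

Definition indep_of_sigma_algebra (R : realType) d (T : measurableType d)
    (P : probability T R) (G : set (set T)) (Y : T -> R) : Prop :=
  forall (A : set T) (B : set R), G A -> measurable B ->
    P (A `&` Y @^-1` B) = (P A * P (Y @^-1` B))%E.

(* The second parameter of [normal_prob] is the standard deviation. *)
Record is_brownian_motion (R : realType) d (T : measurableType d)
    (P : probability T R) (F : R -> set (set T)) (W : R -> T -> R) : Prop := {
  brownian_adapted : adapted F W;
  brownian_continuous : continuous_paths W;
  brownian_start : {ae P, forall w, W 0 w = 0};
  brownian_indep : forall s t : R, 0 <= s -> s < t ->
    indep_of_sigma_algebra P (F s) (W t \- W s);
  brownian_normal : forall s t : R, 0 <= s -> s < t ->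
    forall B : set R, measurable B ->
      P ((W t \- W s) @^-1` B) = normal_prob 0 (Num.sqrt (t - s)) B }.

(* Weak solutions of X_t = \int_0^t b(X_s) ds + \int_0^t W_s ds, X_0 = 0. *)
Record weak_solution (R : realType) (b : R -> R) := WeakSolution {
  ws_display : measure_display;
  ws_space : measurableType ws_display;
  ws_prob : probability ws_space R;
  ws_filtration : R -> set (set ws_space);
  ws_X : R -> ws_space -> R;
  ws_W : R -> ws_space -> R;
  ws_filtrationP : is_filtration ws_filtration;
  ws_X_adapted : adapted ws_filtration ws_X;
  ws_X_continuous : continuous_paths ws_X;
  ws_W_brownian : is_brownian_motion ws_prob ws_filtration ws_W;
  ws_X_start : {ae ws_prob, forall w, ws_X 0 w = 0};
  ws_equation : {ae ws_prob, forall w, forall t : R, 0 <= t ->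
    ws_X t w = \int[lebesgue_measure]_(s in `[0, t]) b (ws_X s w)
             + \int[lebesgue_measure]_(s in `[0, t]) ws_W s w} }.

Arguments ws_filtration {R b} _ _ _.
Arguments ws_X {R b} _ _ _.
Arguments ws_W {R b} _ _ _.

(* The sigma-algebra generated by the coordinates x |-> x t, 0 <= t. Its trace
   on C([0, +oo[) is the Borel sigma-algebra of locally uniform convergence, so
   laws of continuous processes may be compared on it. *)
Definition cylinders (R : realType) : set (set (R -> R)) :=
  [set C | exists t : R, exists B : set R,
    [/\ 0 <= t, measurable B & C = [set x | B (x t)]]].

Definition path_space (R : realType) := g_sigma_algebraType (@cylinders R).

Definition law (R : realType) (b : R -> R) (S : weak_solution b) :
    set (path_space R) -> \bar R :=
  pushforward (ws_prob S) (fun w => ws_X S ^~ w : path_space R).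

(* [law S] is a function on all sets, so it is only compared on measurable
   ones. *)
Definition same_law (R : realType) (b : R -> R) (S1 S2 : weak_solution b) :
    Prop :=
  forall A : set (path_space R), measurable A -> law S1 A = law S2 A.

Definition uniqueness_in_law (R : realType) (b : R -> R) : Prop :=
  forall S1 S2 : weak_solution b, same_law S1 S2.

Definition sign_power (R : realType) (alpha x : R) : R :=
  Num.sg x * `|x| `^ alpha.

(* Main.v *)
(* For a forcing path w, let X solve X' = sign(X)|X|^alpha + w with X_0 = 0. Without forcing,
   the extremal solutions are c t^kappa and -c t^kappa with kappa = 1/(1 - alpha). As
   alpha < 1/3 means kappa < 3/2, one can choose beta < 1/2 with kappa < 1 + beta; if
   |w_t| <= C t^beta near 0, the integral of w is O(t^(1 + beta)) and cannot overcome this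
   growth, so that the largest solution is positive shortly after 0, and the smallest one
   negative. The largest solution X(w) is the decreasing limit of Picard iterates started
   from a supersolution, hence an adapted functional of w, and the smallest one is -X(-w).
   A Brownian path satisfies the bound on w with probability at least 3/4 for some C; at
   the corresponding deterministic time, X(W) > 0 with probability at least 3/4, while
   -X(-W) > 0 has probability at most 1/4.

   Brownian motion is obtained by Levy's midpoint construction on R x R with a Gaussian
   times a uniform measure: this space is mapped onto two independent copies of itself by a
   measure-preserving map, which furnishes the sources of the two halves of a path. The
   same map, iterated on the right, glues independent unit pieces into a path on the
   half-line. The Gaussian tail of the midpoint corrections gives both the convergence and
   the bound C t^beta. *)

Require Import Defs.
From HB Require Import structures.
From mathcomp Require Import all_boot all_order all_algebra.
From mathcomp Require Import all_classical all_reals all_analysis.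
From mathcomp Require Import measurable_realfun ring lra.

Set Implicit Arguments.
Unset Strict Implicit.
Unset Printing Implicit Defensive.
Import Order.TTheory GRing.Theory Num.Theory.
Import numFieldNormedType.Exports.

Local Open Scope classical_set_scope.
Local Open Scope ring_scope.

(** * Measure-preserving maps and the Gaussian measure *)

(** The drift is increasing but not Lipschitz at 0, so monotonicity takes the place of contraction:
    the iterates are ordered, and a pointwise limit of adapted iterates is adapted, which settles
    measurability without selecting among the solutions of a path. Positivity cannot be read off the
    equation, which also has solutions that start negative; it is a lower bound that the first
    iterate satisfies and every iteration reproduces. Both processes are built over one Brownian
    path, and the bound on [w] is two-sided, so a single event serves [W] and [-W], and positivity
    at one fixed time separates the laws. The midpoint recursion is shaped for the bound near 0: a
    path consists of two rescaled independent paths, so that both the bound and the independence of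
    increments are proved by induction on the depth. Working with sources in place of sequences of
    Gaussians makes this self-similarity an identity between measures, and independence a
    consequence of Tonelli. *)

Section transport.
Context d1 d2 (R : realType) (T1 : measurableType d1) (T2 : measurableType d2).

(* The pushforward instance of the library leaves the measurability proof as an unresolved variable. *)
Definition image_measure (m : {measure set T1 -> \bar R}) (phi : T1 -> T2)
  (mphi : measurable_fun setT phi) : {measure set T2 -> \bar R}.
Proof. refine (pushforward m phi : {measure set _ -> \bar R}); exact: mphi. Defined.

Definition preserves (m1 : set T1 -> \bar R) (m2 : set T2 -> \bar R)
    (phi : T1 -> T2) : Prop :=
  measurable_fun setT phi /\ forall A, measurable A -> m1 (phi @^-1` A) = m2 A.

Lemma preserves_integral (m1 : {measure set T1 -> \bar R})
    (m2 : {measure set T2 -> \bar R}) (phi : T1 -> T2) (f : T2 -> \bar R) :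
  preserves m1 m2 phi -> measurable_fun setT f -> (forall y, (0 <= f y)%E) ->
  (\int[m1]_x f (phi x) = \int[m2]_y f y)%E.
Proof.
move=> [mphi mE] mf f0.
rewrite -(@eq_measure_integral _ _ _ setT m2 (image_measure m1 mphi)) //=; last first.
  by move=> A mA _; rewrite /pushforward mE.
rewrite (ge0_integral_pushforward mphi) //.
Qed.

End transport.

Section affine.
Context (R : realType).
Local Notation RR := (measurableTypeR R).
Local Notation leb := (@lebesgue_measure R).

Lemma measurable_affine (a b : R) :
  measurable_fun setT (fun x : RR => a * x + b : RR).
Proof.
have: measurable_fun setT (fun x : R => a * x + b).
  by apply: measurable_funD => //; exact: measurable_funM.
by [].
Qed.

(** The left side is a measure in [A], so by uniqueness half-open intervals suffice; a negative
    slope changes which end of the preimage is closed, hence the two cases. *)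
Lemma lebesgue_affine (a b : R) (A : set RR) : a != 0 -> measurable A ->
  (`|a|%:E * leb ((fun x : RR => a * x + b : RR)%R @^-1` A) = leb A)%E.
Proof.
move=> a0 mA.
pose m : {measure set RR -> \bar R} :=
  mscale (NngNum (normr_ge0 a)) (image_measure leb (measurable_affine a b)).
symmetry; transitivity (m A) => //; apply: (@lebesgue_measure_unique R m) => // _ [[u v] /= _ <-].
rewrite /m/= /mscale/= /pushforward.
have [a_gt0|a_lt0|/eqP] := ltgtP 0 a; last by rewrite eq_sym (negbTE a0).
  have -> : (fun x : R => a * x + b) @^-1` `]u, v]%classic =
      `](u - b) / a, (v - b) / a]%classic.
    apply/seteqP; split => x /=; rewrite !in_itv/=.
      by rewrite ltr_pdivrMr// ler_pdivlMr// ltrBlDr lerBrDr mulrC.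
    by rewrite ltr_pdivrMr// ler_pdivlMr// ltrBlDr lerBrDr mulrC.
  rewrite !lebesgue_measure_itv/= !lte_fin ltr_pM2r ?invr_gt0// ltrD2r.
  case: ifP => _; last by rewrite mule0.
  rewrite -!EFinD -EFinM; congr EFin.
  by rewrite gtr0_norm//; field.
have -> : (fun x : R => a * x + b) @^-1` `]u, v]%classic =
    `[(v - b) / a, (u - b) / a[%classic.
  apply/seteqP; split => x /=; rewrite !in_itv/=.
    by rewrite ler_ndivrMr// ltr_ndivlMr// lerBrDr ltrBlDr mulrC andbC.
  by rewrite ler_ndivrMr// ltr_ndivlMr// lerBrDr ltrBlDr mulrC andbC.
rewrite !lebesgue_measure_itv/= !lte_fin ltr_nM2r ?invr_lt0// ltrD2r.
case: ifP => _; last by rewrite mule0.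
rewrite -!EFinD -EFinM; congr EFin.
by rewrite ltr0_norm//; field.
Qed.

Lemma integral_affine (a b : R) (f : RR -> \bar R) : a != 0 ->
  measurable_fun setT f -> (forall x, (0 <= f x)%E) ->
  (\int[leb]_x f x = `|a|%:E * \int[leb]_x f (a * x + b)%R)%E.
Proof.
move=> a0 mf f0; pose k := NngNum (normr_ge0 a).
have <- := @ge0_integral_mscale _ _ _ leb setT measurableT k (fun x => f (a * x + b)).
- symmetry; apply: (@preserves_integral _ _ _ _ _ (mscale k leb) leb (fun x => a * x + b)) => //.
  split; first exact: measurable_affine.
  by move=> A mA; exact: lebesgue_affine.
- by apply: (measurableT_comp mf); exact: measurable_affine.
- by move=> x _; exact: f0.
Qed.

End affine.

(** * Integration against a density *)

Section density.
Context d (T : measurableType d) (R : realType).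
Variables (m mu : {measure set T -> \bar R}) (p : T -> R).
Hypotheses (mp : measurable_fun setT p) (p0 : forall x, 0 <= p x).
Hypothesis mE : forall A, measurable A -> (m A = \int[mu]_(x in A) (p x)%:E)%E.
Local Open Scope ereal_scope.

Import HBNNSimple.

Let integral_density_indic E : measurable E ->
  \int[m]_x (\1_E x)%:E = \int[mu]_x ((\1_E x)%:E * (p x)%:E).
Proof.
move=> mE'; rewrite integral_indic//= setIT mE// integral_mkcond.
by apply: eq_integral => x _; rewrite patchE indicE; case: ifPn => _; rewrite ?mul1e ?mul0e.
Qed.

Let integral_density_nnsfun (f : {nnsfun T >-> R}) :
  \int[m]_x (f x)%:E = \int[mu]_x ((f x)%:E * (p x)%:E).
Proof.
under [LHS]eq_integral do rewrite fimfunE -fsumEFin//.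
rewrite [LHS]ge0_integral_fsum//; last 2 first.
  - by move=> r; exact/measurable_EFinP/measurableT_comp.
  - by move=> n x _; rewrite EFinM nnfun_muleindic_ge0.
under [RHS]eq_integral.
  move=> x xD; rewrite fimfunE -fsumEFin// muleC ge0_mule_fsumr; last first.
    by move=> r; rewrite EFinM nnfun_muleindic_ge0.
  over.
rewrite [RHS]ge0_integral_fsum//; last 2 first.
  - move=> r; apply: emeasurable_funM; first exact/measurable_EFinP.
    by apply/measurable_EFinP; exact/measurableT_comp.
  - move=> n x _; rewrite EFinM mule_ge0//; last by rewrite nnfun_muleindic_ge0.
    by rewrite lee_fin.
apply: eq_fsbigr => r _.
rewrite integralZl_indic_nnsfun//= integral_density_indic//.
(* A nonnegative simple function takes no value [r < 0], so both sides vanish there; for [r >= 0]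
   the factor can be taken out of the integral. *)
have [r0|r0] := ltP r 0%R.
  rewrite preimage_nnfun0// indic0; under eq_integral do rewrite mul0e.
  rewrite integral0 mule0; under eq_integral do rewrite mulr0 mule0.
  by rewrite integral0.
rewrite -ge0_integralZl//.
- by apply: eq_integral => x _; rewrite EFinM [in RHS]muleC -muleA.
- apply: emeasurable_funM; last exact/measurable_EFinP.
  exact/measurable_EFinP.
- by move=> x _; rewrite mule_ge0// lee_fin.
Qed.

(** The usual climb from indicators through simple functions to monotone limits. It turns Gaussian
    integrals into Lebesgue integrals, where affine substitution is available. *)
Lemma integral_density (f : T -> \bar R) :
  measurable_fun setT f -> (forall x, 0 <= f x) ->
  \int[m]_x f x = \int[mu]_x (f x * (p x)%:E).
Proof.
move=> mf f0.
pose f_ := nnsfun_approx measurableT mf.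
transitivity (lim (\int[m]_x (f_ n x)%:E @[n --> \oo])).
  rewrite -monotone_convergence//=.
  - apply: eq_integral => ? /[!inE] xD; apply/esym/cvg_lim => //=.
    exact: cvg_nnsfun_approx.
  - by move=> n; exact/measurable_EFinP/measurable_funTS.
  - by move=> n ? _; rewrite lee_fin.
  - by move=> ? _ ? ? mn; rewrite lee_fin; exact/lefP/nd_nnsfun_approx.
transitivity (lim (\int[mu]_x ((f_ n x)%:E * (p x)%:E) @[n --> \oo])).
  by apply: congr_lim; apply/funext => n /=; exact: integral_density_nnsfun.
rewrite -monotone_convergence//=.
- apply: eq_integral => x /[!inE] xD; apply/cvg_lim => //.
  by apply: cvgeZr => //; exact: cvg_nnsfun_approx.
- move=> n; apply: emeasurable_funM; exact/measurable_EFinP.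
- by move=> n ? _; rewrite mule_ge0// lee_fin.
- move=> ? _ ? ? ?; rewrite lee_wpmul2r// lee_fin//; exact/lefP/nd_nnsfun_approx.
Qed.

End density.

Section gauss.
Context (R : realType).
Local Notation RR := (measurableTypeR R).
Local Notation leb := (@lebesgue_measure R).

Definition gauss : probability RR R := (@normal_prob R 0 1 : probability _ R).

Local Notation p := (@normal_pdf R 0 1).

Lemma integral_gauss (f : RR -> \bar R) :
  measurable_fun setT f -> (forall x, (0 <= f x)%E) ->
  (\int[gauss]_x f x = \int[leb]_x (f x * (p x)%:E))%E.
Proof.
move=> mf f0; apply: (integral_density (m := gauss) (mu := leb)) => //.
- exact: measurable_normal_pdf.
- exact: normal_pdf_ge0.
Qed.

Lemma std_normal_pdfE (x : R) :
  p x = (Num.sqrt (pi *+ 2))^-1 * expR (- (x ^+ 2 / 2)).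
Proof.
rewrite normal_pdfE ?oner_eq0// /normal_peak /normal_fun expr1n mul1r subr0.
by rewrite mulNr.
Qed.

(** The product of the two densities depends on [u ^+ 2 + v ^+ 2] only, which a rotation
    preserves. *)
Lemma std_normal_pdf_rotation (c s u v : R) : c ^+ 2 + s ^+ 2 = 1 ->
  p (c * u - s * v) * p (s * u + c * v) = p u * p v.
Proof.
move=> cs; rewrite !std_normal_pdfE.
rewrite -!mulrA; congr (_ * _); rewrite !(mulrCA (expR _)); congr (_ * _).
rewrite -!expRD; congr expR.
have : (c * u - s * v) ^+ 2 + (s * u + c * v) ^+ 2 = u ^+ 2 + v ^+ 2.
  transitivity ((c ^+ 2 + s ^+ 2) * (u ^+ 2 + v ^+ 2)); first by ring.
  by rewrite cs mul1r.
by move=> E; clear cs; lra.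
Qed.


Lemma measurable_affine2 (a b : R) :
  measurable_fun setT (fun z : RR * RR => (a * z.1 + b * z.2 : RR)).
Proof.
have: measurable_fun setT (fun z : RR * RR => (a * z.1 + b * z.2 : R)).
  apply: measurable_funD; exact: measurable_funM.
by [].
Qed.

Definition rotate (c s : R) (z : RR * RR) : RR * RR :=
  (c * z.1 + s * z.2, - s * z.1 + c * z.2).

Lemma measurable_rotate c s : measurable_fun setT (rotate c s).
Proof. by apply: measurable_fun_pair; exact: measurable_affine2. Qed.

End gauss.

(** * Rotation invariance of a Gaussian pair *)

Section rotation.
Context (R : realType).
Local Notation RR := (measurableTypeR R).
Local Notation p := (@normal_pdf R 0 1).
(* Abstract stand-ins for the Gaussian and Lebesgue measures: the concrete ones make
   unification unfold them. *)
Variables (g : probability RR R) (leb : {sigma_finite_measure set RR -> \bar R}).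
Hypothesis integral_g : forall f : RR -> \bar R,
  measurable_fun setT f -> (forall x, (0 <= f x)%E) ->
  (\int[g]_x f x = \int[leb]_x (f x * (p x)%:E))%E.
Hypothesis affine : forall (a b : R) (f : RR -> \bar R), a != 0 ->
  measurable_fun setT f -> (forall x, (0 <= f x)%E) ->
  (\int[leb]_x f x = `|a|%:E * \int[leb]_x f (a * x + b)%R)%E.

Let mp : measurable_fun setT (fun x : RR => (p x)%:E).
Proof. by apply/measurable_EFinP; exact: measurable_normal_pdf. Qed.

Let pge0 x : (0 <= (p x)%:E)%E. Proof. by rewrite lee_fin normal_pdf_ge0. Qed.

Let integral_g2 (f : RR * RR -> \bar R) :
  measurable_fun setT f -> (forall z, 0 <= f z)%E ->
   (\int[g]_x \int[g]_y f (x, y) =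
    \int[leb]_x \int[leb]_y (f (x, y) * (p x * p y)%:E))%E.
Proof.
move=> mf f0; rewrite integral_g; first last.
- by move=> x; apply: integral_ge0 => y _.
- exact: measurable_fun_fubini_tonelli_F.
apply: eq_integral => x _; rewrite integral_g//; last exact: measurable_fun_pair2.
rewrite -ge0_integralZr//; last 2 first.
- by apply: emeasurable_funM => //; exact: measurable_fun_pair2.
- by move=> y _; exact: mule_ge0.
by apply: eq_integral => y _; rewrite EFinM (muleC (p x)%:E) muleA.
Qed.

(* The rotation is decomposed into two one-dimensional affine substitutions, so that only
   Tonelli and the scaling of Lebesgue measure on the line are needed. *)
Lemma abstract_rotation (c s : R) (f : RR * RR -> \bar R) : 0 < s ->
  c ^+ 2 + s ^+ 2 = 1 -> measurable_fun setT f -> (forall z, 0 <= f z)%E ->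
  (\int[g]_x \int[g]_y f (rotate c s (x, y)) =
   \int[g]_x \int[g]_y f (x, y))%E.
Proof.
move=> s0 cs mf f0.
have mfr : measurable_fun setT (f \o rotate c s) := measurableT_comp mf (measurable_rotate c s).
rewrite (integral_g2 mfr (fun z => f0 _)) (integral_g2 mf f0).
have sN0 : s != 0 by rewrite gt_eqF.
(* The integrand once the first rotated coordinate [u = c * x + s * y] replaces [y]: then [y] is
   [(u - c * x) / s], and the second rotated coordinate is [(c * u - x) / s] because
   [c ^+ 2 + s ^+ 2 = 1]. *)
pose h (x u : R) := (f (u, ((c * u - x) / s)%R) * (p x * p ((u - c * x) / s))%:E)%E.
have mh : measurable_fun setT (fun z : RR * RR => h z.1 z.2).
  rewrite /h; apply: emeasurable_funM.
    apply: (measurableT_comp mf); apply: measurable_fun_pair => /=.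
      exact: measurable_snd.
    rewrite (_ : (fun _ => _) = (fun z : RR * RR => - s^-1 * z.1 + (c / s) * z.2 : RR)).
      exact: measurable_affine2.
    by apply/funext => z; field.
  apply/measurable_EFinP; apply: measurable_funM.
    by apply: measurableT_comp => //; exact: measurable_normal_pdf.
  apply: (measurableT_comp (f := p)); first exact: measurable_normal_pdf.
  rewrite (_ : (fun _ => _) = (fun z : RR * RR => - (c / s) * z.1 + s^-1 * z.2 : RR)).
    exact: measurable_affine2.
  by apply/funext => z; field.
have h0 z : (0 <= h z.1 z.2)%E by rewrite mule_ge0// lee_fin mulr_ge0// normal_pdf_ge0.
have s'0 : (0 <= (s^-1)%:E)%E by rewrite lee_fin invr_ge0 ltW.
have mh2 x : measurable_fun setT (h x).
  by apply: (measurable_fun_pair2 (f := fun z => h z.1 z.2)).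
have mh1 u : measurable_fun setT (h ^~ u).
  by apply: (measurable_fun_pair1 (f := fun z => h z.1 z.2)).
have E1 x y : ((f \o rotate c s) (x, y) * (p x * p y)%:E = h x (s * y + c * x)%R)%E.
  rewrite /h /rotate /=; congr (f (_, _) * (p x * p _)%:E)%E; first by rewrite addrC.
    have -> : c * (s * y + c * x) - x = s * (c * y) - (1 - c ^+ 2) * x by ring.
    by rewrite -cs; field.
  by field.
transitivity (\int[leb]_x \int[leb]_u ((s^-1)%:E * h x u))%E.
  apply: eq_integral => x _.
  under eq_integral do rewrite E1.
  have -> := ge0_integralZl leb measurableT (mh2 x) (fun u _ => h0 (x, u)) s'0.
  have -> := affine (c * x) sN0 (mh2 x) (fun u => h0 (x, u)).
  by rewrite gtr0_norm// muleA -EFinM mulVf// mul1e.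
have mh' : measurable_fun setT (fun z : RR * RR => (s^-1)%:E * h z.1 z.2)%E.
  exact: emeasurable_funM.
have h'0 (z : RR * RR) : (0 <= (s^-1)%:E * h z.1 z.2)%E by exact: mule_ge0.
have -> := fubini_tonelli (m1 := leb) (m2 := leb) _ mh' h'0.
apply: eq_integral => u _ /=.
have -> := ge0_integralZl leb measurableT (mh1 u) (fun x _ => h0 (x, u)) s'0.
(* With the integrals exchanged and [u] fixed, the substitution [x = c * u - s * v] makes [v] the
   second rotated coordinate. *)
have nsN0 : - s != 0 by rewrite oppr_eq0.
have -> := affine (c * u) nsN0 (mh1 u) (fun x => h0 (x, u)).
rewrite normrN gtr0_norm// muleA -EFinM mulVf// mul1e.
apply: eq_integral => v _.
rewrite /h.
have -> : (c * u - (- s * v + c * u)) / s = v by field.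
have -> : (u - c * (- s * v + c * u)) / s = s * u + c * v.
  have -> : u - c * (- s * v + c * u) = (1 - c ^+ 2) * u + s * c * v by ring.
  by rewrite -cs; field.
have -> : - s * v + c * u = c * u - s * v by ring.
by rewrite std_normal_pdf_rotation.
Qed.

End rotation.

Lemma gauss_rotation (R : realType) (c s : R)
    (f : measurableTypeR R * measurableTypeR R -> \bar R) : 0 < s ->
  c ^+ 2 + s ^+ 2 = 1 -> measurable_fun setT f -> (forall z, 0 <= f z)%E ->
  (\int[gauss R]_x \int[gauss R]_y f (rotate c s (x, y)) =
   \int[gauss R]_x \int[gauss R]_y f (x, y))%E.
Proof.
exact: (abstract_rotation (@integral_gauss R) (@integral_affine R)).
Qed.

(** * Extension of identities from generating families *)

Section half_lines.
Context (R : realType).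
Local Notation RR := (measurableTypeR R).

(** Half-lines are stable under intersection and generate the Borel sets, which determines a finite
    measure. Open ones are chosen because the condition [a < f x] commutes with increasing limits of
    [f]. *)
Lemma measure_unique_oy (m1 m2 : {measure set RR -> \bar R}) :
  (forall a : R, m1 `]a, +oo[%classic = m2 `]a, +oo[%classic) ->
  (m1 setT < +oo)%E ->
  forall A, measurable A -> m1 A = m2 A.
Proof.
move=> m12 m1oo; apply: (@measure_unique _ R RR (@RGenOInfty.G R)
    (fun n => `](- n%:R), +oo[%classic)).
- exact: RGenOInfty.measurableE.
- move=> _ _ [a ->] [b ->]; exists (Num.max a b).
  by apply/seteqP; split => x /=; rewrite !in_itv/= !andbT gt_max => /andP.
- by move=> i; exists (- i%:R).
- apply/seteqP; split => // x _; exists (Num.truncn `|x|).+1 => //=.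
  rewrite in_itv/= andbT ltrNl (le_lt_trans (ler_norm (- x)))// normrN.
  by rewrite truncnS_gt.
- by move=> _ [a ->].
- move=> k; apply: le_lt_trans m1oo; apply: le_measure; rewrite ?inE//.
Qed.

Context d (T : measurableType d) (P : probability T R).

(** For fixed [C] both sides are finite measures in [A]. Applied twice with the roles exchanged,
    this reduces the independence of two variables to pairs of half-lines. *)
Lemma independent_oy (f : T -> RR) (C : set T) : measurable_fun setT f ->
  measurable C ->
  (forall a : R, P (f @^-1` `]a, +oo[%classic `&` C) =
     P (f @^-1` `]a, +oo[%classic) * P C)%E ->
  forall A, measurable A -> (P (f @^-1` A `&` C) = P (f @^-1` A) * P C)%E.
Proof.
move=> mf mC H A mA.
have PC0 : 0 <= fine (P C) by exact: fine_ge0.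
have PCE : (fine (P C))%:E = P C by rewrite fineK// fin_num_measure.
pose m1 := image_measure (mrestr P mC) mf.
pose m2 := mscale (NngNum PC0) (image_measure P mf).
have := @measure_unique_oy m1 m2 _ _ A mA.
rewrite /m1 /m2 /= /mrestr /mscale /= /pushforward PCE muleC; apply.
  by move=> a; rewrite H muleC.
rewrite preimage_setT setTI.
by rewrite (le_lt_trans (probability_le1 P mC))// ltry.
Qed.

(** The same argument with a pi-system of events in place of half-lines; it carries independence
    from finitely many past values to the whole past sigma-algebra. *)
Lemma independent_sigma (G : set (set T)) (C : set T) :
  G `<=` measurable -> setI_closed G -> G setT -> measurable C ->
  (forall E, G E -> P (E `&` C) = P E * P C)%E ->
  forall E, <<s G >> E -> (P (E `&` C) = P E * P C)%E.
Proof.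
move=> Gm GI GT mC H E sE.
have PC0 : 0 <= fine (P C) by exact: fine_ge0.
have PCE : (fine (P C))%:E = P C by rewrite fineK// fin_num_measure.
have := @g_sigma_algebra_measure_unique _ R T G Gm (fun=> setT) (fun=> GT) _ (mrestr P mC)
  (mscale (NngNum PC0) P) GI _ _ E sE.
rewrite /= /mrestr /mscale /= PCE muleC; apply.
- by rewrite bigcup_const//; exists 0%N.
- by move=> A GA; rewrite H// muleC.
- by move=> _; rewrite setTI (le_lt_trans (probability_le1 P mC))// ltry.
Qed.

End half_lines.

(** * Splitting a uniform variable *)

Section uniform_splitting.
Context (R : realType).
Local Notation RR := (measurableTypeR R).
Local Notation leb := (@lebesgue_measure R).

Definition unif : set RR -> \bar R := mrestr leb (measurable_itv `[0, 1[ : measurable (`[0, 1[%classic : set RR)).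

HB.instance Definition _ := Measure.on unif.

Let unif_setT : unif setT = 1%E.
Proof. by rewrite /unif /mrestr setTI lebesgue_measure_itv/= lte_fin ltr01 sube0. Qed.

HB.instance Definition _ := @Measure_isProbability.Build _ _ R unif unif_setT.

(** On [[0, 1[] these are the first binary digit and the shift of the expansion, that is the
    doubling map modulo 1. *)
Definition bit (x : R) : bool := 1 / 2 <= x.
Definition dbl (x : RR) : RR := 2 * x - (bit x)%:R.

(** On each half of [[0, 1[], [dbl] is an affine bijection of slope 2 onto [[0, 1[]: the first digit
    is a fair coin, independent of the remaining ones, which are again uniform. *)
Lemma unif_half (j : bool) (E : set RR) : measurable E ->
  (unif [set x | bit x = j /\ E (dbl x)] = (1 / 2)%:E * unif E)%E.
Proof.
move=> mE; rewrite /unif /mrestr.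
have mE' : measurable (E `&` `[0, 1[%classic) by apply: measurableI => //; exact: measurable_itv.
have two0 : (2 : R) != 0 by [].
rewrite -(lebesgue_affine (- j%:R) two0 mE') normr_nat muleA -EFinM.
rewrite (_ : 1 / 2 * 2 = 1 :> R) ?mul1e; last by field.
congr (leb _); apply/seteqP; split => x /=; rewrite !in_itv/= /dbl.
  move=> [[<- Ex] /andP[x0 x1]]; split => //.
  rewrite /bit in Ex *; case: (leP (1 / 2) x) Ex => /= h Ex; apply/andP; split; lra.
move=> [Ex /andP[h1 h2]]; suff -> : bit x = j.
  split=> //; apply/andP; split.
    by case: j h1 h2 {Ex} => /= *; lra.
  by case: j h1 h2 {Ex} => /= *; lra.
rewrite /bit; case: j h1 h2 {Ex} => /= h1 h2; first by apply/idP; lra.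
by apply/negbTE; rewrite -ltNge; lra.
Qed.

Lemma measurable_bit : measurable_fun setT (bit : RR -> bool).
Proof. by apply: measurable_fun_ler. Qed.

Lemma measurable_dbl : measurable_fun setT dbl.
Proof.
apply: measurable_funB; first exact: measurable_funM.
rewrite (_ : (fun _ => _) = (fun x : RR => if bit x then 1 else 0 : R)).
  by apply: measurable_fun_ifT => //; exact: measurable_bit.
by apply/funext => x; case: (bit x).
Qed.

Lemma unif_bit_dbl (E : bool -> set RR) : (forall j, measurable (E j)) ->
  (unif [set x | E (bit x) (dbl x)] =
   (1 / 2)%:E * unif (E false) + (1 / 2)%:E * unif (E true))%E.
Proof.
move=> mE; rewrite -(unif_half false (mE false)) -(unif_half true (mE true)).
have mF j : measurable [set x : RR | bit x = j /\ E j (dbl x)].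
  apply: measurableI.
    by rewrite -[X in measurable X]setTI; apply: (measurable_bit measurableT (_ : measurable [set j])).
  by rewrite -[X in measurable X]setTI; apply: (measurable_dbl measurableT (mE j)).
rewrite -measureU//.
  congr (unif _); apply/seteqP; split => [x /=|x /= [[<-]|[<-]]] //.
  by case: (bit x) => Ex; [right|left].
by apply/seteqP; split => // x /= [[-> _] []].
Qed.

(* The number whose binary digits are every other digit of [x], cut after [n] digits. *)
Fixpoint even_part n (x : RR) : R :=
  if n is n'.+1 then ((bit x)%:R + even_part n' (dbl (dbl x))) / 2 else 0.

(** The first [n] binary digits of [x]. Its law is the one to compare [even_part n] with, as both
    are made of [n] fair digits. *)
Fixpoint truncation n (x : RR) : R :=
  if n is n'.+1 then ((bit x)%:R + truncation n' (dbl x)) / 2 else 0.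

End uniform_splitting.

Arguments even_part {R} n x.
Arguments truncation {R} n x.
Arguments dbl {R} x.
Arguments bit {R} x.

Section uniform_splitting2.
Context (R : realType).
Local Notation RR := (measurableTypeR R).
Local Notation unif := (@unif R).

Lemma even_part_ge0 n (x : R) : 0 <= even_part n x.
Proof.
by elim: n x => //= n IH x; rewrite mulr_ge0// addr_ge0// ler0n.
Qed.

Lemma even_part_le1 n (x : R) : even_part n x <= 1.
Proof.
elim: n x => //= n IH x; rewrite ler_pdivrMr// mul1r.
by rewrite (_ : 2 = 1 + 1 :> R)// lerD// lern1 leq_b1.
Qed.

Lemma even_partS n (x : R) : even_part n x <= even_part n.+1 x.
Proof.
elim: n x => [x|n IH x]; first exact: even_part_ge0.
by rewrite [leLHS]/= [leRHS]/= ler_pM2r// lerD2l IH.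
Qed.

Lemma truncationS n (x : R) : truncation n x <= truncation n.+1 x.
Proof.
elim: n x => [x|n IH x]; first by rewrite /= addr0 mulr_ge0// ler0n.
by rewrite [leLHS]/= [leRHS]/= ler_pM2r// lerD2l IH.
Qed.

Lemma dbl_itv (x : R) : 0 <= x < 1 -> 0 <= dbl x < 1.
Proof.
by rewrite /dbl /bit; case: (leP (1 / 2) x) => /= h /andP[x0 x1]; apply/andP; split; lra.
Qed.

Lemma truncationP n (x : R) : 0 <= x < 1 ->
  truncation n x <= x < truncation n x + 2 ^- n.
Proof.
elim: n x => [|n IH] x x01; first by rewrite /= expr0 invr1 add0r.
have /andP[h1 h2] := IH _ (dbl_itv x01).
have xE : x = ((bit x)%:R + dbl x) / 2 by rewrite /dbl; field.
rewrite /= exprS invfM; apply/andP; split.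
  by rewrite [leRHS]xE ler_pM2r// lerD2l.
rewrite [ltLHS]xE mulrC (mulrC _ 2^-1) -mulrDr ltr_pM2l// -addrA.
by rewrite ltrD2l.
Qed.

Lemma measurable_even_part n : measurable_fun setT (even_part n : RR -> RR).
Proof.
elim: n => [|n IH] /=; first exact: measurable_cst.
have mb : measurable_fun setT (fun x : RR => (bit x)%:R : R).
  rewrite (_ : (fun _ => _) = (fun x : RR => if bit x then 1 else 0 : R)).
    by apply: measurable_fun_ifT => //; exact: measurable_bit.
  by apply/funext => x; case: (bit x).
have md : measurable_fun setT (fun x : RR => even_part n (dbl (dbl x)) : R).
  apply: (measurableT_comp IH).
  by apply: (measurableT_comp (@measurable_dbl R)); exact: measurable_dbl.
by apply: measurable_funM => //; exact: measurable_funD.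
Qed.

Lemma measurable_truncation n : measurable_fun setT (truncation n : RR -> RR).
Proof.
elim: n => [|n IH] /=; first exact: measurable_cst.
have mb : measurable_fun setT (fun x : RR => (bit x)%:R : R).
  rewrite (_ : (fun _ => _) = (fun x : RR => if bit x then 1 else 0 : R)).
    by apply: measurable_fun_ifT => //; exact: measurable_bit.
  by apply/funext => x; case: (bit x).
have md : measurable_fun setT (fun x : RR => truncation n (dbl x) : R).
  by apply: (measurableT_comp IH); exact: measurable_dbl.
by apply: measurable_funM => //; exact: measurable_funD.
Qed.

Lemma measurable_gt_preimage d (T : measurableType d) (f : T -> RR) (a : R) :
  measurable_fun setT f -> measurable [set x | a < f x].
Proof.
move=> mf; have := mf measurableT `]a, +oo[%classic (measurable_itv _).
rewrite setTI; congr (measurable _).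
by apply/seteqP; split => x /=; rewrite in_itv/= andbT.
Qed.

Let halfE (a u v : R) : (a < (u + v) / 2) = (2 * a - u < v).
Proof. by rewrite ltr_pdivlMr// ltrBlDl mulrC. Qed.

Lemma unif_truncationS n a : (unif [set x | (a < truncation n.+1 x)%R] =
  (1 / 2)%:E * unif [set x | (2 * a < truncation n x)%R] +
  (1 / 2)%:E * unif [set x | (2 * a - 1 < truncation n x)%R])%E.
Proof.
have -> : [set x | a < truncation n.+1 x] =
  [set x | (fun (j : bool) => [set y : RR | 2 * a - j%:R < truncation n y]) (bit x) (dbl x)].
  by apply/seteqP; split => x /=; rewrite halfE.
have := @unif_bit_dbl R (fun (j : bool) => [set y : RR | 2 * a - j%:R < truncation n y]).
rewrite /= subr0; apply => j; apply: measurable_gt_preimage; exact: measurable_truncation.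
Qed.

(** Each induction step peels off two digits: the first belongs to the even part of [x], the second
    to that of [dbl x]. Both sides become the same average over the two bits, with new thresholds,
    which is why [a] and [b] are general in the induction. *)
Lemma unif_even_part n a b :
  (unif [set x | (a < even_part n x)%R /\ (b < even_part n (dbl x))%R] =
   unif [set x | (a < truncation n x)%R] * unif [set x | (b < truncation n x)%R])%E.
Proof.
elim: n a b => [|n IH] a b.
  have setb (B : bool) : [set x : RR | B] = if B then setT else set0.
    by case: B; apply/seteqP; split.
  rewrite /= !setb (_ : [set x : RR | a < 0 /\ b < 0] = if (a < 0) && (b < 0) then setT else set0).
    by case: (a < 0); case: (b < 0); rewrite /= ?probability_setT ?measure0 ?mule0 ?mul0e ?mul1e.
  by rewrite -setb; apply/seteqP; split => x /= /andP.
have mE c m : measurable [set x : RR | c < even_part m x].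
  by apply: measurable_gt_preimage; exact: measurable_even_part.
have mEd c m : measurable [set x : RR | c < even_part m (dbl x)].
  apply: (@measurable_gt_preimage _ _ (even_part m \o dbl)).
  by apply: (measurableT_comp (@measurable_even_part m)); exact: measurable_dbl.
pose E (j : bool) := [set y : RR | 2 * a - j%:R < even_part n (dbl y) /\ b < even_part n.+1 y].
pose F (j k : bool) := [set w : RR | 2 * a - j%:R < even_part n w /\ 2 * b - k%:R < even_part n (dbl w)].
have mEj j : measurable (E j) by apply: measurableI; [exact: mEd|exact: mE].
have mF j k : measurable (F j k) by apply: measurableI; [exact: mE|exact: mEd].
have E1 : [set x | a < even_part n.+1 x /\ b < even_part n.+1 (dbl x)] = [set x | E (bit x) (dbl x)].
  by apply/seteqP; split => x /=; rewrite /E/= !halfE.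
have E2 j : E j = [set y | F j (bit y) (dbl y)].
  by apply/seteqP; split => x /=; rewrite /F/E/= !halfE.
rewrite E1 unif_bit_dbl// !E2 (unif_bit_dbl (mF false)) (unif_bit_dbl (mF true)).
rewrite /F !IH !unif_truncationS !subr0.
have mT c : measurable [set x : RR | c < truncation n x].
  by apply: measurable_gt_preimage; exact: measurable_truncation.
have fin c : unif [set x | c < truncation n x] \is a fin_num by rewrite fin_num_measure.
rewrite -(fineK (fin (2 * a))) -(fineK (fin (2 * a - 1))).
rewrite -(fineK (fin (2 * b))) -(fineK (fin (2 * b - 1))).
do ?rewrite -?EFinM -?EFinD; congr EFin.
by field.
Qed.

Definition even_bits (x : RR) : RR := sup (range (even_part ^~ x)).

Lemma even_bits_cvg x : even_part ^~ x @ \oo --> even_bits x.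
Proof.
apply: nondecreasing_cvgn; first by apply/nondecreasing_seqP => n; exact: even_partS.
by exists 1 => _ [n _ <-]; exact: even_part_le1.
Qed.

Lemma measurable_even_bits : measurable_fun setT even_bits.
Proof.
apply: (@measurable_fun_cvg _ _ _ _ (fun n => even_part n : RR -> R)).
  exact: measurable_even_part.
by move=> x _; exact: even_bits_cvg.
Qed.

Lemma even_bits_gt a x : (a < even_bits x) <-> exists n, a < even_part n x.
Proof.
have nd : nondecreasing_seq (even_part ^~ x) by apply/nondecreasing_seqP => n; exact: even_partS.
split; last first.
  move=> [n an]; apply: (lt_le_trans an).
  apply: ub_le_sup; last by exists n.
  by exists 1 => _ [m _ <-]; exact: even_part_le1.
move=> h; have [N _ HN] := cvgr_gt _ (@even_bits_cvg x) _ h.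
by exists N; apply: HN => /=.
Qed.

Definition split_unif (x : RR) : RR * RR := (even_bits x, even_bits (dbl x)).

Lemma measurable_split_unif : measurable_fun setT split_unif.
Proof.
apply: measurable_fun_pair; first exact: measurable_even_bits.
by apply: (measurableT_comp measurable_even_bits); exact: measurable_dbl.
Qed.

(** Both sides are limits of [unif_even_part]: the events increase with [n], as the truncations
    increase to [even_bits] on the left and to [x] itself on the right. *)
Lemma split_unif_gt a b :
  (unif [set x | (a < even_bits x)%R /\ (b < even_bits (dbl x))%R] =
   unif `]a, +oo[%classic * unif `]b, +oo[%classic)%E.
Proof.
pose A n := [set x : RR | (a < even_part n x)%R /\ (b < even_part n (dbl x))%R].
pose U c n := [set x : RR | c < truncation n x].
have mE c m : measurable [set x : RR | c < even_part m x].
  by apply: measurable_gt_preimage; exact: measurable_even_part.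
have mEd c m : measurable [set x : RR | c < even_part m (dbl x)].
  apply: (@measurable_gt_preimage _ _ (even_part m \o dbl)).
  by apply: (measurableT_comp (@measurable_even_part m)); exact: measurable_dbl.
have mA n : measurable (A n) by apply: measurableI; [exact: mE|exact: mEd].
have mU c n : measurable (U c n).
  by apply: measurable_gt_preimage; exact: measurable_truncation.
have cA : unif \o A @ \oo --> unif (\bigcup_n A n).
  apply: nondecreasing_cvg_mu => //; first exact: bigcupT_measurable.
  apply/nondecreasing_seqP => n; apply/subsetPset => x [h1 h2].
  split; [exact: (lt_le_trans h1 (even_partS _ _))|exact: (lt_le_trans h2 (even_partS _ _))].
have cU c : unif \o U c @ \oo --> unif `]c, +oo[%classic.
  have -> : unif `]c, +oo[%classic = unif (\bigcup_n U c n).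
    congr (lebesgue_measure _).
    apply/seteqP; split => x [/=]; rewrite !in_itv/= ?andbT => cx x01; split => //.
      have d0 : 0 < x - c by rewrite subr_gt0.
      have [n nd] : exists n, 2 ^- n < x - c.
        exists (Num.truncn (x - c)^-1).+1.
        rewrite invf_plt ?posrE ?exprn_gt0// (lt_trans (truncnS_gt _))//.
        by rewrite -natrX ltr_nat ltn_expl.
      exists n => //; rewrite /U/=; have /andP[_] := truncationP n x01; lra.
    have [n _ /lt_le_trans] := cx; apply.
    by have /andP[] := truncationP n x01.
  apply: nondecreasing_cvg_mu => //; first exact: bigcupT_measurable.
  apply/nondecreasing_seqP => n; apply/subsetPset => x h.
  exact: (lt_le_trans h (truncationS _ _)).
have -> : [set x | (a < even_bits x)%R /\ (b < even_bits (dbl x))%R] = \bigcup_n A n.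
  apply/seteqP; split => x.
    move=> [/even_bits_gt[n an] /even_bits_gt[m bm]]; exists (maxn n m) => //.
    have nd (y : R) : nondecreasing_seq (even_part ^~ y) by apply/nondecreasing_seqP => k; exact: even_partS.
    by split; [apply: (lt_le_trans an)|apply: (lt_le_trans bm)]; apply: nd; rewrite ?leq_maxl ?leq_maxr.
  by move=> [n _ [an bn]]; split; apply/even_bits_gt; exists n.
have cc : unif \o A @ \oo --> (unif `]a, +oo[%classic * unif `]b, +oo[%classic)%E.
  rewrite (_ : unif \o A = (unif \o U a) \* (unif \o U b))%E; last first.
    by apply/funext => n /=; exact: unif_even_part.
  apply: cvgeM => //.
  by rewrite mule_def_fin// fin_num_measure.
exact: (cvg_unique _ cA cc).
Qed.

Lemma split_unif_preserves : preserves unif (unif \x unif)%E split_unif.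
Proof.
split; first exact: measurable_split_unif.
move=> A mA.
symmetry; apply: (product_measure_unique (m' := image_measure unif measurable_split_unif)) => // {mA}A B mA mB.
have mdbl : measurable_fun setT (fun x => even_bits (dbl x)).
  by apply: (measurableT_comp measurable_even_bits); exact: measurable_dbl.
have itvE (f : RR -> RR) c : f @^-1` `]c, +oo[%classic = [set x | c < f x].
  by apply/seteqP; split => x /=; rewrite in_itv/= andbT.
have mS (f : RR -> RR) C : measurable_fun setT f -> measurable C -> measurable (f @^-1` C).
  by move=> mf mC; rewrite -[X in measurable X]setTI; exact: mf.
(* The threshold [-1] lies below all values of [even_bits] and below [[0, 1[]; inserted for one of
   the two thresholds, it removes that condition and leaves the marginal law of the other
   coordinate. *)
have full : unif `](-1), +oo[%classic = 1%E.
  rewrite -(probability_setT unif); congr (lebesgue_measure _).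
  by apply/seteqP; split => x [_ h]; split => //=; move: h; rewrite /= !in_itv/= andbT => /andP[? _]; lra.
have m1 y : -1 < even_bits y by apply/even_bits_gt; exists 0%N; rewrite /= ltrN10.
have T1 a : unif (even_bits @^-1` `]a, +oo[%classic) = unif `]a, +oo[%classic.
  rewrite -[RHS]mule1 -full -split_unif_gt itvE; congr (unif _).
  by apply/seteqP; split => [x h|x []//]; split.
have T2 a : unif ((even_bits \o dbl) @^-1` `]a, +oo[%classic) = unif `]a, +oo[%classic.
  rewrite -[RHS]mul1e -full -split_unif_gt itvE; congr (unif _).
  by apply/seteqP; split => [x h|x []//]; split.
have L1 C : measurable C -> unif (even_bits @^-1` C) = unif C.
  apply: (measure_unique_oy (m1 := image_measure unif measurable_even_bits)) => //.
  by rewrite /= /pushforward preimage_setT probability_setT ltry.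
have L2 C : measurable C -> unif ((even_bits \o dbl) @^-1` C) = unif C.
  apply: (measure_unique_oy (m1 := image_measure unif mdbl)) => //.
  by rewrite /= /pushforward preimage_setT probability_setT ltry.
transitivity (unif (even_bits @^-1` A `&` (even_bits \o dbl) @^-1` B)) => //.
transitivity (unif (even_bits @^-1` A) * unif ((even_bits \o dbl) @^-1` B))%E; last first.
  by rewrite L1// L2.
apply: independent_oy => //; [exact: measurable_even_bits|exact: mS|move=> a].
rewrite setIC [RHS]muleC; apply: independent_oy => //.
  by apply: mS => //; exact: measurable_even_bits.
move=> b; transitivity (unif `]b, +oo[%classic * unif `]a, +oo[%classic)%E; last first.
  by congr (_ * _)%E; [rewrite -T2|rewrite -T1].
rewrite muleC -split_unif_gt !itvE; congr (unif _).
by apply/seteqP; split => x [].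
Qed.

End uniform_splitting2.

(** * A Gaussian variable from a uniform one *)

Section quantile.
Context (R : realType).
Local Notation RR := (measurableTypeR R).
Local Notation unif := (@unif R).
Local Notation gauss := (@gauss R).

Let idR : RR -> R := idfun.
HB.instance Definition _ := @isMeasurableFun.Build _ _ _ _ idR (@measurable_id _ _ setT).

Let F (x : R) : R := fine (cdf (P := gauss) (idR : {RV gauss >-> R}) x).

Let FE x : cdf (P := gauss) (idR : {RV gauss >-> R}) x = (F x)%:E.
Proof. by rewrite fineK// fin_num_measure. Qed.

Let F_nd : {homo F : x y / x <= y}.
Proof. by move=> x y xy; rewrite -lee_fin -!FE; exact: cdf_nondecreasing. Qed.

Let F_lt (u : R) : 0 < u -> exists x, F x < u.
Proof.
move=> u0; have /fine_cvgP[_ h] := @cvg_cdfNy0 _ _ _ gauss (idR : {RV gauss >-> R}).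
have [M [_ HM]] := cvgr_lt _ h _ u0.
by exists (M - 1); apply: HM; rewrite ltrBlDr ltrDl.
Qed.

Let F_gt (u : R) : u < 1 -> exists x, u < F x.
Proof.
move=> u1; have /fine_cvgP[_ h] := @cvg_cdfy1 _ _ _ gauss (idR : {RV gauss >-> R}).
have [M [_ HM]] := cvgr_gt _ h _ u1.
by exists (M + 1); apply: HM; rewrite ltrDl.
Qed.

Let F_rc (a u : R) : F a < u -> exists2 e, 0 < e & forall x, a < x < a + e -> F x < u.
Proof.
move=> au.
have := @cdf_right_continuous _ _ _ gauss (idR : {RV gauss >-> R}) a.
rewrite FE => /fine_cvgP[_ h].
have [e /= e0 He] := cvgr_lt _ h _ au.
exists e => // x /andP[ax xe]; apply: He => //=.
by rewrite /ball_ /= ltr0_norm ?subr_lt0// opprB ltrBlDl.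
Qed.

(** The generalised inverse of the Gaussian distribution function; the default value outside []0,
    1[] concerns a null set of [unif]. *)
Definition quantile (u : RR) : RR :=
  if (0 < u) && (u < 1) then inf [set x | u <= F x] else 0.

(** By right continuity [F a < u] persists slightly beyond [a], which keeps the infimum strictly
    above [a]. The event [a < quantile u] thus becomes an interval in [u], whose measure is its
    length. *)
Lemma quantile_gt (u a : R) : 0 < u < 1 -> (a < quantile u) = (F a < u).
Proof.
move=> u01; rewrite /quantile u01; have /andP[u0 u1] := u01.
have [m Fm] := F_lt u0; have [M FM] := F_gt u1.
have lbS : has_lbound [set x | u <= F x].
  exists m => x /= ux; rewrite leNgt; apply/negP => xm.
  by have := F_nd (ltW xm); rewrite leNgt (lt_le_trans Fm ux).
have neS : [set x | u <= F x] !=set0 by exists M; exact: ltW.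
apply/idP/idP => h.
  rewrite ltNge; apply/negP => ua; move: h; rewrite ltNge => /negP; apply.
  exact: ge_inf.
have [e e0 He] := F_rc h.
apply: (@lt_le_trans _ _ (a + e)); first by rewrite ltrDl.
apply: lb_le_inf => // x /= ux; rewrite leNgt; apply/negP => xe.
have [xa|ax] := leP x a.
  by have := F_nd xa; rewrite leNgt (lt_le_trans h ux).
by have := He x; rewrite ax xe ltNge ux => /(_ isT).
Qed.

Lemma measurable_quantile : measurable_fun setT quantile.
Proof.
apply: (measurability _ (RGenOInfty.measurableE R)) => _ [_ [a ->] <-].
rewrite setTI (_ : _ @^-1` _ = ([set` `]F a, 1[] `&` [set` `]0, 1[]) `|`
    (if a < 0 then ~` [set` `]0, 1[] else set0)).
  apply: measurableU; first exact: measurableI.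
  by case: ifP => _ //; exact: measurableC.
apply/seteqP; split => u /=; rewrite !in_itv/= andbT.
  have [u01|u01] := boolP ((0 < u) && (u < 1)).
    by rewrite quantile_gt// => Fu; left; have /andP[h1 h2] := u01; split; rewrite /= ?in_itv/= ?Fu ?h1 ?h2.
  by rewrite /quantile (negbTE u01) => ->; right; rewrite /= in_itv/=; exact/negP.
move=> [[/andP[Fu _] u01]|]; first by rewrite quantile_gt.
case: ifP => // a0; rewrite /= in_itv/= => /negP u01.
by rewrite /quantile (negbTE u01).
Qed.

Lemma quantile_preserves : preserves unif gauss quantile.
Proof.
split; first exact: measurable_quantile.
move=> A mA.
apply: (measure_unique_oy (m1 := image_measure unif measurable_quantile)) => //; last first.
  by rewrite /= /pushforward preimage_setT probability_setT ltry.
move=> a; rewrite /= /pushforward.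
have F0 : 0 <= F a by exact: fine_ge0.
have F1 : F a <= 1 by rewrite -lee_fin -FE; exact: cdf_le1.
transitivity (1 - F a)%:E; last first.
  have -> : `]a, +oo[%classic = ~` `]-oo, a]%classic :> set RR.
    by apply/seteqP; split => x /=; rewrite !in_itv/= andbT ltNge => /negP.
  rewrite probability_setC// EFinB; congr (_ - _)%E.
  by rewrite -FE.
have mq : measurable (quantile @^-1` `]a, +oo[%classic).
  by rewrite -[X in measurable X]setTI; apply: measurable_quantile.
have leb_F : lebesgue_measure (`]F a, 1[%classic : set R) = (1 - F a)%:E.
  rewrite lebesgue_measure_itv/= lte_fin; case: ltP => // h.
  by rewrite (_ : 1 - F a = 0)//; apply/eqP; rewrite subr_eq0 eq_le h F1.
apply/eqP; rewrite eq_le; apply/andP; split.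
  (* At [u = 0] the default value of [quantile] may exceed [a]; this point is added to the interval
     and has measure zero. *)
  apply: (@le_trans _ _ (lebesgue_measure ([set 0 : R] `|` `]F a, 1[%classic : set R))).
    apply: le_measure; rewrite ?inE.
    - by apply: measurableI => //; exact: measurable_itv.
    - exact: measurableU.
    move=> u [] /=; rewrite /preimage/= !in_itv/= andbT => qu /andP[u0 u1].
    have [->|uN0] := eqVneq u 0; first by left.
    right; rewrite u1 andbT -quantile_gt ?u1 ?andbT//.
    by rewrite lt_neqAle eq_sym uN0.
  apply: (@le_trans _ _ (lebesgue_measure ([set 0%R] : set R) +
      lebesgue_measure (`]F a, 1%R[%classic : set R))%E); first exact: measureU2.
  by rewrite lebesgue_measure_set1 leb_F add0e.
rewrite -leb_F; apply: le_measure; rewrite ?inE//.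
  by apply: measurableI => //; exact: measurable_itv.
move=> u /=; rewrite /preimage/= !in_itv/= => /andP[Fu u1].
have u0 : 0 < u by exact: le_lt_trans Fu.
by rewrite quantile_gt ?u0// Fu (ltW u0) u1.
Qed.

End quantile.

(** * The source of a Brownian path *)

Section preserves_product.
Context (R : realType).
Local Open Scope ereal_scope.

Lemma preserves_comp d1 d2 d3 (T1 : measurableType d1) (T2 : measurableType d2)
    (T3 : measurableType d3) (m1 : set T1 -> \bar R) (m2 : set T2 -> \bar R)
    (m3 : set T3 -> \bar R) (phi : T1 -> T2) (psi : T2 -> T3) :
  preserves m1 m2 phi -> preserves m2 m3 psi -> preserves m1 m3 (psi \o phi).
Proof.
move=> [mphi phiE] [mpsi psiE]; split; first exact: measurableT_comp.
move=> A mA; rewrite -psiE// -phiE//.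
by rewrite -[X in measurable X]setTI; exact: mpsi.
Qed.

Lemma preserves_id d (T : measurableType d) (m : set T -> \bar R) : preserves m m id.
Proof. by split. Qed.

Lemma preserves_of_integral d1 d2 (T1 : measurableType d1) (T2 : measurableType d2)
    (m1 : {measure set T1 -> \bar R}) (m2 : {measure set T2 -> \bar R}) (phi : T1 -> T2) :
  measurable_fun setT phi ->
  (forall f : T2 -> \bar R, measurable_fun setT f -> (forall x, 0 <= f x) ->
    \int[m1]_x f (phi x) = \int[m2]_x f x) ->
  preserves m1 m2 phi.
Proof.
move=> mphi H; split => // A mA.
have mA' : measurable (phi @^-1` A) by rewrite -[X in measurable X]setTI; exact: mphi.
have := H (fun x => (\1_A x)%:E) _ _.
rewrite (@integral_indic _ _ _ m2)// setIT => <-.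
- transitivity (\int[m1]_x (\1_(phi @^-1` A) x)%:E) => //.
  by rewrite integral_indic// setIT.
- exact/measurable_EFinP/measurable_indic.
- by move=> x; rewrite lee_fin.
Qed.

Section prodp.
Context d1 d2 (T1 : measurableType d1) (T2 : measurableType d2).

Definition prodp (m1 : probability T1 R) (m2 : probability T2 R) :
    probability (T1 * T2)%type R := (m1 \x m2 : probability (T1 * T2)%type R).

Variables (m1 : probability T1 R) (m2 : probability T2 R).

Lemma prodpX A B : measurable A -> measurable B -> prodp m1 m2 (A `*` B) = m1 A * m2 B.
Proof. exact: product_measure1E. Qed.

Lemma prodp_unique (m : {measure set (T1 * T2) -> \bar R}) :
  (forall A B, measurable A -> measurable B -> m (A `*` B) = m1 A * m2 B) ->
  forall A, measurable A -> m A = prodp m1 m2 A.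
Proof. by move=> h A mA; symmetry; apply: (product_measure_unique (m' := m)). Qed.

Lemma integral_prodp (f : T1 * T2 -> \bar R) : measurable_fun setT f ->
  (forall z, 0 <= f z) -> \int[prodp m1 m2]_z f z = \int[m1]_x \int[m2]_y f (x, y).
Proof. exact: fubini_tonelli1. Qed.

Lemma integral_swap (f : T1 * T2 -> \bar R) : measurable_fun setT f ->
  (forall z, 0 <= f z) -> \int[m1]_x \int[m2]_y f (x, y) = \int[m2]_y \int[m1]_x f (x, y).
Proof. exact: fubini_tonelli. Qed.

Lemma measurable_integral_snd (f : T1 * T2 -> \bar R) : measurable_fun setT f ->
  (forall z, 0 <= f z) -> measurable_fun setT (fun x => \int[m2]_y f (x, y)).
Proof. exact: measurable_fun_fubini_tonelli_F. Qed.

End prodp.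

Section products.
Context d1 d2 d3 d4 (T1 : measurableType d1) (T2 : measurableType d2)
  (T3 : measurableType d3) (T4 : measurableType d4).

Lemma preserves_prod (m1 : probability T1 R) (m2 : probability T2 R)
    (m3 : probability T3 R) (m4 : probability T4 R) (phi : T1 -> T3) (psi : T2 -> T4) :
  preserves m1 m3 phi -> preserves m2 m4 psi ->
  preserves (prodp m1 m2) (prodp m3 m4) (fun z => (phi z.1, psi z.2)).
Proof.
move=> pphi ppsi.
have [mphi phiE] := pphi; have [mpsi psiE] := ppsi.
have mg : measurable_fun setT (fun z : T1 * T2 => (phi z.1, psi z.2)).
  apply: measurable_fun_pair.
    by apply: (measurableT_comp mphi); exact: measurable_fst.
  by apply: (measurableT_comp mpsi); exact: measurable_snd.
split => // A mA.
apply: (prodp_unique (m := image_measure (prodp m1 m2) mg)) => // {mA}A B mA mB.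
rewrite /= /pushforward.
have -> : (fun z : T1 * T2 => (phi z.1, psi z.2)) @^-1` (A `*` B) = (phi @^-1` A) `*` (psi @^-1` B) by [].
have mA' : measurable (phi @^-1` A) by rewrite -[X in measurable X]setTI; exact: mphi.
have mB' : measurable (psi @^-1` B) by rewrite -[X in measurable X]setTI; exact: mpsi.
have -> := prodpX m1 m2 mA' mB'.
by congr (_ * _); [exact: phiE|exact: psiE].
Qed.

(** In [split], this puts the fresh Gaussian next to the increment, so that the two can be rotated;
    [exchange] then deals one Gaussian and one uniform variable to each half. *)
Definition rearrange (z : T1 * (T2 * T3)) : (T2 * T1) * T3 := ((z.2.1, z.1), z.2.2).

Definition exchange (z : (T1 * T2) * (T3 * T4)) : (T1 * T3) * (T2 * T4) :=
  ((z.1.1, z.2.1), (z.1.2, z.2.2)).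

Lemma measurable_rearrange : measurable_fun setT rearrange.
Proof.
apply: measurable_fun_pair; last first.
  by apply: measurableT_comp; [exact: measurable_snd|exact: measurable_snd].
apply: measurable_fun_pair; last exact: measurable_fst.
by apply: measurableT_comp; [exact: measurable_fst|exact: measurable_snd].
Qed.

Lemma rearrange_preserves (m1 : probability T1 R) (m2 : probability T2 R)
    (m3 : probability T3 R) :
  preserves (prodp m1 (prodp m2 m3)) (prodp (prodp m2 m1) m3) rearrange.
Proof.
apply: preserves_of_integral; first exact: measurable_rearrange.
move=> f mf f0.
have mfr := measurableT_comp mf measurable_rearrange.
have mfi := measurable_integral_snd m3 mf f0.
have fi0 z : 0 <= \int[m3]_c f (z, c) by exact: integral_ge0.
have -> := integral_prodp m1 (prodp m2 m3) mfr (fun z => f0 _).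
have -> := integral_prodp (prodp m2 m1) m3 mf f0.
have -> := integral_prodp m2 m1 mfi fi0.
have <- := integral_swap m1 m2 (measurableT_comp mfi (@measurable_swap _ _ T1 T2)) (fun z => fi0 _).
apply: eq_integral => a _.
by have -> := integral_prodp m2 m3 (measurable_fun_pair2 a mfr) (fun z => f0 _).
Qed.

Lemma measurable_exchange : measurable_fun setT exchange.
Proof.
apply: measurable_fun_pair; apply: measurable_fun_pair;
  (apply: measurableT_comp; [|by [exact: measurable_fst|exact: measurable_snd]]);
  by [exact: measurable_fst|exact: measurable_snd].
Qed.

End products.

Lemma exchange_preserves d1 d2 d3 d4 (T1 : measurableType d1) (T2 : measurableType d2)
  (T3 : measurableType d3) (T4 : measurableType d4)
    (m1 : probability T1 R) (m2 : probability T2 R)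
    (m3 : probability T3 R) (m4 : probability T4 R) :
  preserves (prodp (prodp m1 m2) (prodp m3 m4)) (prodp (prodp m1 m3) (prodp m2 m4))
    (@exchange _ _ _ _ T1 T2 T3 T4).
Proof.
apply: preserves_of_integral; first exact: measurable_exchange.
move=> f mf f0.
have mfe := measurableT_comp mf (@measurable_exchange _ _ _ _ T1 T2 T3 T4).
have mF := measurable_integral_snd (prodp m3 m4) mfe (fun z => f0 _).
have mF' := measurable_integral_snd (prodp m2 m4) mf f0.
have F0 z : 0 <= \int[prodp m3 m4]_y f (exchange (z, y)) by exact: integral_ge0.
have F'0 z : 0 <= \int[prodp m2 m4]_y f (z, y) by exact: integral_ge0.
have -> := integral_prodp (prodp m1 m2) (prodp m3 m4) mfe (fun z => f0 _).
have -> := integral_prodp (prodp m1 m3) (prodp m2 m4) mf f0.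
have -> := integral_prodp m1 m2 mF F0.
have -> := integral_prodp m1 m3 mF' F'0.
apply: eq_integral => a _.
have m4' : measurable_fun setT (fun z : (T2 * T3) * T4 => f ((a, z.1.2), (z.1.1, z.2))).
  apply: (measurableT_comp mf); apply: measurable_fun_pair.
    apply: measurable_fun_pair => //.
    by apply: measurableT_comp; [exact: measurable_snd|exact: measurable_fst].
  apply: measurable_fun_pair; last exact: measurable_snd.
  by apply: measurableT_comp; [exact: measurable_fst|exact: measurable_fst].
have mI := measurable_integral_snd m4 m4' (fun z => f0 _).
transitivity (\int[m2]_b \int[m3]_c \int[m4]_e f ((a, c), (b, e))).
  apply: eq_integral => b _.
  by have -> := integral_prodp m3 m4 (measurable_fun_pair2 (a, b) mfe) (fun z => f0 _).
have -> := integral_swap m2 m3 mI (fun z => integral_ge0 _ (fun y _ => f0 _)).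
apply: eq_integral => c _.
by have -> := integral_prodp m2 m4 (measurable_fun_pair2 (a, c) mf) (fun z => f0 _).
Qed.

End preserves_product.

(** * The splitting of a source *)

Section gaussian_splitting.
Context (R : realType).
Local Notation RR := (measurableTypeR R).
Local Notation gauss := (@gauss R).

Definition unifp : probability RR R := (@unif R : probability RR R).

Definition source : measurableType _ := (RR * RR)%type.

Definition source_prob : probability source R := prodp gauss unifp.

Let h : R := (Num.sqrt 2)^-1.

Let h2 : h ^+ 2 = 1 / 2.
Proof. by rewrite /h exprVn sqr_sqrtr// mul1r. Qed.

(** Three independent uniform variables are extracted from one: the first is turned into a Gaussian,
    the other two are the randomness left for the two halves. *)
Definition split_noise (w : RR) : RR * (RR * RR) :=
  (quantile (split_unif w).1, split_unif (split_unif w).2).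

(* For a source [(D, w)], [D] is the increment of a path over [0, 1] and [w] provides a
   Gaussian [xi] independent of [D]; the increments over the two halves, rescaled by
   [sqrt 2], are the rotated pair [(D + xi) / sqrt 2] and [(D - xi) / sqrt 2]. *)
Definition split (z : source) : source * source :=
  exchange (rotate h h (rearrange (z.1, split_noise z.2)).1,
            (rearrange (z.1, split_noise z.2)).2).

Definition lft (z : source) : source := (split z).1.
Definition rgt (z : source) : source := (split z).2.
Definition noise (z : source) : RR := (split_noise z.2).1.

Lemma lftE z : (lft z).1 = h * (noise z : R) + h * (z.1 : R) :> R.
Proof. by []. Qed.

Lemma rgtE z : (rgt z).1 = - h * (noise z : R) + h * (z.1 : R) :> R.
Proof. by []. Qed.

Lemma split_sum z : h * ((lft z).1 + (rgt z).1) = z.1 :> R.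
Proof.
rewrite lftE rgtE; transitivity (h ^+ 2 * 2 * (z.1 : R)); first by ring.
by rewrite h2; field.
Qed.

(** At the midpoint, the refined path differs from the chord by half of this quantity; so [noise]
    controls one refinement step. *)
Lemma split_diff z : h * ((lft z).1 - (rgt z).1) = noise z :> R.
Proof.
rewrite lftE rgtE; transitivity (h ^+ 2 * 2 * (noise z : R)); first by ring.
by rewrite h2; field.
Qed.

Lemma split_noise_preserves :
  preserves unifp (prodp gauss (prodp unifp unifp)) split_noise.
Proof.
apply: (preserves_comp (m2 := prodp unifp unifp) (phi := @split_unif R)
   (psi := fun w => (quantile w.1, split_unif w.2))).
  exact: split_unif_preserves.
apply: preserves_prod; first exact: quantile_preserves.
exact: split_unif_preserves.
Qed.

Lemma rotate_preserves c s : 0 < s -> c ^+ 2 + s ^+ 2 = 1 ->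
  preserves (prodp gauss gauss) (prodp gauss gauss) (@rotate R c s).
Proof.
move=> s0 cs; apply: preserves_of_integral; first exact: measurable_rotate.
move=> f mf f0.
have mfr := measurableT_comp mf (measurable_rotate c s).
have -> := integral_prodp gauss gauss mfr (fun z => f0 _).
have -> := integral_prodp gauss gauss mf f0.
exact: gauss_rotation.
Qed.

(** Preservation onto a product measure says at once that each half has the law of a source and that
    the two halves are independent; both recursions of the construction rest on it. *)
Lemma split_preserves : preserves source_prob (prodp source_prob source_prob) split.
Proof.
pose A (z : RR * RR) := (z.1, split_noise z.2).
pose B (z : (RR * RR) * (RR * RR)) := (rotate h h z.1, z.2).
have pA : preserves source_prob (prodp gauss (prodp gauss (prodp unifp unifp))) A.
  by apply: (preserves_prod (phi := id)); [exact: preserves_id|exact: split_noise_preserves].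
have pB : preserves (prodp (prodp gauss gauss) (prodp unifp unifp))
    (prodp (prodp gauss gauss) (prodp unifp unifp)) B.
  apply: (preserves_prod (psi := id)); last exact: preserves_id.
  apply: rotate_preserves; first by rewrite invr_gt0 sqrtr_gt0.
  by rewrite h2; field.
have pR := rearrange_preserves gauss gauss (prodp unifp unifp).
have pE := exchange_preserves gauss gauss unifp unifp.
exact: (preserves_comp (preserves_comp (preserves_comp pA pR) pB) pE).
Qed.

Lemma preserves_fst d1 d2 (T1 : measurableType d1) (T2 : measurableType d2)
    (m1 : probability T1 R) (m2 : probability T2 R) : preserves (prodp m1 m2) m1 fst.
Proof.
split; first exact: measurable_fst.
move=> A mA; have -> : fst @^-1` A = A `*` [set: T2].
  by apply/funext => z; apply/propext; split => [//|[]].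
by rewrite prodpX// probability_setT mule1.
Qed.

Lemma preserves_snd d1 d2 (T1 : measurableType d1) (T2 : measurableType d2)
    (m1 : probability T1 R) (m2 : probability T2 R) : preserves (prodp m1 m2) m2 snd.
Proof.
split; first exact: measurable_snd.
move=> A mA; have -> : snd @^-1` A = [set: T1] `*` A.
  by apply/funext => z; apply/propext; split => [//|[]].
by rewrite prodpX// probability_setT mul1e.
Qed.

Lemma lft_preserves : preserves source_prob source_prob lft.
Proof. exact: (preserves_comp split_preserves (preserves_fst _ _)). Qed.

Lemma rgt_preserves : preserves source_prob source_prob rgt.
Proof. exact: (preserves_comp split_preserves (preserves_snd _ _)). Qed.

Lemma noise_preserves : preserves source_prob gauss noise.
Proof.
exact: (preserves_comp (preserves_snd gauss unifp)
  (preserves_comp split_noise_preserves (preserves_fst _ _))).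
Qed.

End gaussian_splitting.

Arguments lft {R} z : simpl never.
Arguments rgt {R} z : simpl never.
Arguments noise {R} z : simpl never.
Arguments split {R} z : simpl never.

(** * Independent increments *)

Section independent_increments.
Context (R : realType).
Local Notation RR := (measurableTypeR R).
Local Notation gauss := (@gauss R).

Definition unit_fun (g : R -> R) : Prop :=
  measurable_fun setT g /\ forall x, 0 <= g x <= 1.

(** Independence from finitely many past values and the Gaussian law of the increment, in one
    identity. Rescaling, shifting and pulling back only change the test functions. The times are
    restricted to [I] because an interpolated path has such increments between grid times only. *)
Definition indep_incr d (T : measurableType d) (m : probability T R)
    (I : set R) (Q : R -> T -> R) : Prop :=
  (forall t, I t -> measurable_fun setT (Q t)) /\
  forall s t n (u : nat -> R) (f : nat -> R -> R) g, I s -> I t -> s < t ->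
    (forall i, (i < n)%N -> I (u i) /\ u i <= s) ->
    (forall i, unit_fun (f i)) -> unit_fun g ->
    (\int[m]_z (\prod_(i < n) f i (Q (u i) z) * g (Q t z - Q s z))%:E =
     \int[m]_z (\prod_(i < n) f i (Q (u i) z))%:E *
     \int[gauss]_x (g (Num.sqrt (t - s) * x))%:E)%E.

Lemma unit_fun_shift g c : unit_fun g -> unit_fun (fun x => g (c + x)).
Proof.
move=> [mg g01]; split => //; apply: (measurableT_comp mg).
exact: measurable_funD.
Qed.

Lemma unit_fun_scale g c : unit_fun g -> unit_fun (fun x => g (c * x)).
Proof.
move=> [mg g01]; split => //; apply: (measurableT_comp mg).
exact: measurable_funM.
Qed.

Lemma unit_fun_prod T n (f : nat -> R -> R) (Q : nat -> T -> R) z :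
  (forall i, unit_fun (f i)) -> 0 <= \prod_(i < n) f i (Q i z) <= 1.
Proof.
move=> uf; elim: n => [|n /andP[h0 h1]]; first by rewrite big_ord0 ler01 lexx.
have [_ /(_ (Q n z))/andP[g0 g1]] := uf n.
by rewrite big_ord_recr/= mulr_ge0// mulr_ile1.
Qed.

Lemma measurable_unit_prod d (T : measurableType d) n (f : nat -> R -> R)
    (Q : nat -> T -> R) :
  (forall i, unit_fun (f i)) -> (forall i, (i < n)%N -> measurable_fun setT (Q i)) ->
  measurable_fun setT (fun z => \prod_(i < n) f i (Q i z)).
Proof.
move=> uf; elim: n => [|n IH] mQ.
  under eq_fun do rewrite big_ord0.
  exact: measurable_cst.
under eq_fun do rewrite big_ord_recr/=.
apply: measurable_funM.
  by apply: IH => i ni; apply: mQ; rewrite (ltn_trans ni).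
by have [mf _] := uf n; apply: (measurableT_comp mf); exact: mQ.
Qed.

Lemma indep_incr_pullback d d' (T : measurableType d) (T' : measurableType d')
    (m : probability T R) (m' : probability T' R) (phi : T -> T') I Q :
  preserves m m' phi -> indep_incr m' I Q ->
  indep_incr m I (fun t z => Q t (phi z)).
Proof.
move=> pphi [mQ HQ]; have [mphi _] := pphi; split.
  by move=> t It; exact: (measurableT_comp (mQ t It) mphi).
move=> s t n u f g Is It st uI uf ug.
have mf' : measurable_fun setT (fun z => \prod_(i < n) f i (Q (u i) z)).
  by apply: (measurable_unit_prod (Q := fun i => Q (u i))) => // i /uI[/mQ].
have f0 z : 0 <= \prod_(i < n) f i (Q (u i) z).
  by have /andP[] := unit_fun_prod n (fun i => Q (u i)) z uf.
have [mg g01] := ug.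
have mfg : measurable_fun setT (fun z => \prod_(i < n) f i (Q (u i) z) * g (Q t z - Q s z)).
  apply: measurable_funM => //; apply: (measurableT_comp mg).
  by apply: measurable_funB; exact: mQ.
have mEF d0 (S : measurableType d0) (h : S -> R) :
    measurable_fun setT h -> measurable_fun setT (fun z => (h z)%:E).
  by move=> mh; exact/measurable_EFinP.
have E1 := preserves_integral pphi (mEF _ _ _ mfg).
have E2 := preserves_integral pphi (mEF _ _ _ mf').
rewrite E1; last first.
  by move=> z; rewrite lee_fin mulr_ge0//; have /andP[] := g01 (Q t z - Q s z).
by rewrite E2//; exact: (HQ s t n u f g).
Qed.

(** Brownian scaling: [h ^+ 2 * k = 1] makes [h] cancel [Num.sqrt k], so the increment over [[s, t]]
    keeps the variance [t - s]. *)
Lemma indep_incr_scale d (T : measurableType d) (m : probability T R) I Q (k h : R) :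
  0 < k -> 0 <= h -> h ^+ 2 * k = 1 -> indep_incr m I Q ->
  indep_incr m [set t | I (k * t)] (fun t z => h * Q (k * t) z).
Proof.
move=> k0 h0 hk [mQ HQ]; split.
  by move=> t It; apply: measurable_funM => //; exact: mQ.
move=> s t n u f g Is It st uI uf ug.
have := HQ (k * s) (k * t) n (fun i => k * u i) (fun i x => f i (h * x)) (fun x => g (h * x)) Is It.
rewrite ltr_pM2l// => /(_ st); rewrite -mulrBr sqrtrM ?ltW//.
have hk1 : h * Num.sqrt k = 1.
  have: (h * Num.sqrt k) ^+ 2 = 1 by rewrite exprMn sqr_sqrtr// ltW.
  by move/eqP; rewrite sqrf_eq1 => /orP[/eqP//|/eqP hN]; have := mulr_ge0 h0 (sqrtr_ge0 k); rewrite hN ler0N1.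
under [X in (_ -> _ -> _ -> _ = _ * X)%E -> _]eq_integral do rewrite mulrA mulrA hk1 mul1r.
under [X in (_ -> _ -> _ -> X = _)%E -> _]eq_integral do rewrite mulrBr.
apply.
- by move=> i /uI[? ?]; split => //; rewrite ler_pM2l.
- by move=> i; exact: unit_fun_scale.
- exact: unit_fun_scale.
Qed.

(* Both Gaussian variables are components of a rotated standard Gaussian pair. *)
Lemma gauss_convolution (a b : R) (g : R -> R) : 0 < a -> 0 < b -> unit_fun g ->
  (\int[gauss]_x \int[gauss]_y (g (Num.sqrt a * x + Num.sqrt b * y))%:E =
   \int[gauss]_x (g (Num.sqrt (a + b) * x))%:E)%E.
Proof.
move=> a0 b0 [mg g01].
have ab0 : 0 < a + b by exact: addr_gt0.
pose r := Num.sqrt (a + b).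
have r0 : 0 < r by rewrite sqrtr_gt0.
pose f (z : RR * RR) := (g (r * z.1))%:E.
have mf : measurable_fun setT f.
  apply/measurable_EFinP; apply: (measurableT_comp mg).
  by apply: measurable_funM => //; exact: measurable_fst.
have f0 z : (0 <= f z)%E by rewrite lee_fin; have /andP[] := g01 (r * z.1).
have := @gauss_rotation R (Num.sqrt a / r) (Num.sqrt b / r) f.
rewrite divr_gt0 ?sqrtr_gt0// => /(_ isT) H.
transitivity (\int[gauss]_x \int[gauss]_y f (rotate (Num.sqrt a / r) (Num.sqrt b / r) (x, y)))%E.
  apply: eq_integral => x _; apply: eq_integral => y _; rewrite /f /rotate /=.
  by congr (g _)%:E; field; rewrite gt_eqF.
rewrite H//; last first.
  rewrite !exprMn exprVn !sqr_sqrtr ?ltW// -mulrDl divff// gt_eqF//.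
apply: eq_integral => x _.
by rewrite /f /= integral_cst//= probability_setT mule1.
Qed.

End independent_increments.

(** * Concatenation of two independent processes *)

Section concatenation.
Context (R : realType) d1 d2 (T1 : measurableType d1) (T2 : measurableType d2).
Local Notation gauss := (@gauss R).
Variables (m1 : probability T1 R) (m2 : probability T2 R).
Variables (I1 I2 : set R) (Q1 : R -> T1 -> R) (Q2 : R -> T2 -> R) (a : R).
Hypotheses (I1a : I1 a) (I20 : I2 0) (Q20 : forall z, Q2 0 z = 0).
Hypotheses (HQ1 : indep_incr m1 I1 Q1) (HQ2 : indep_incr m2 I2 Q2).

(** Clamping both times avoids a case distinction: before [a] the second term is [Q2 0 = 0], after
    [a] the first one is frozen at [Q1 a]. *)
Definition concat (t : R) (z : T1 * T2) : R :=
  Q1 (Num.min t a) z.1 + Q2 (Num.max (t - a) 0) z.2.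

Definition concat_times : set R :=
  [set t | I1 (Num.min t a) /\ I2 (Num.max (t - a) 0)].

Let mQ1 t : I1 t -> measurable_fun setT (Q1 t). Proof. by case: HQ1 => + _; exact. Qed.
Let mQ2 t : I2 t -> measurable_fun setT (Q2 t). Proof. by case: HQ2 => + _; exact. Qed.

Let mconcat t : concat_times t -> measurable_fun setT (concat t).
Proof.
move=> [It1 It2]; apply: measurable_funD.
  by apply: (measurableT_comp (mQ1 It1)); exact: measurable_fst.
by apply: (measurableT_comp (mQ2 It2)); exact: measurable_snd.
Qed.

Lemma measurable_EFin_comp d (T : measurableType d) (f : T -> R) :
  measurable_fun setT f -> measurable_fun setT (fun z => (f z)%:E).
Proof. by move=> mf; exact/measurable_EFinP. Qed.

Section fixed_data.
Variables (s t : R) (n : nat) (u : nat -> R) (f : nat -> R -> R) (g : R -> R).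
Hypotheses (Is : concat_times s) (It : concat_times t) (st : s < t).
Hypothesis uI : forall i, (i < n)%N -> concat_times (u i) /\ u i <= s.
Hypotheses (uf : forall i, unit_fun (f i)) (ug : unit_fun g).

Let past (z : T1 * T2) : R := \prod_(i < n) f i (concat (u i) z).
Let incr (z : T1 * T2) : R := g (concat t z - concat s z).

Let mpast : measurable_fun setT (fun z => (past z)%:E).
Proof.
apply: measurable_EFin_comp.
by apply: (measurable_unit_prod (Q := fun i => concat (u i))) => // i /uI[/mconcat].
Qed.

Let past0 z : (0 <= (past z)%:E)%E.
Proof. by rewrite lee_fin; have /andP[] := unit_fun_prod n (fun i => concat (u i)) z uf. Qed.

Let mprod : measurable_fun setT (fun z => (past z * incr z)%:E).
Proof.
apply: measurable_EFin_comp; apply: measurable_funM.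
  by apply/measurable_EFinP; exact: mpast.
have [mg _] := ug; apply: (measurableT_comp mg).
by apply: measurable_funB; exact: mconcat.
Qed.

Let prod0 z : (0 <= (past z * incr z)%:E)%E.
Proof.
by rewrite lee_fin mulr_ge0//; [rewrite -lee_fin|have [_ /(_ (concat t z - concat s z))/andP[]] := ug].
Qed.

Local Notation goal := (\int[prodp m1 m2]_z (past z * incr z)%:E =
  \int[prodp m1 m2]_z (past z)%:E * \int[gauss]_x (g (Num.sqrt (t - s) * x))%:E)%E.

Let G_ge0 : (0 <= \int[gauss]_x (g (Num.sqrt (t - s) * x))%:E)%E.
Proof.
by apply: integral_ge0 => x _; rewrite lee_fin; have [_ /(_ (Num.sqrt (t - s) * x))/andP[]] := ug.
Qed.

(** For a fixed first path, its frozen value cancels in the increment and merely shifts the test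
    functions of the past, so the property of [Q2] applies under the integral over the first
    path. *)
Let concat_late : a <= s -> goal.
Proof.
move=> las; have lat : a <= t by rewrite (le_trans las)// ltW.
have -> := integral_prodp m1 m2 mprod prod0.
have -> := integral_prodp m1 m2 mpast past0.
have mI := measurable_integral_snd m2 mpast past0.
have <- := ge0_integralZr m1 measurableT mI (fun x _ => integral_ge0 _ (fun y _ => past0 _)) G_ge0.
apply: eq_integral => x _.
have [_ H] := HQ2.
have := H (s - a) (t - a) n (fun i => Num.max (u i - a) 0)
  (fun i y => f i (Q1 (Num.min (u i) a) x + y)) g.
have sa : s - a = Num.max (s - a) 0 by rewrite max_l// subr_ge0.
have ta : t - a = Num.max (t - a) 0 by rewrite max_l// subr_ge0.
have -> : t - a - (s - a) = t - s by ring.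
have Hs : I2 (s - a) by rewrite sa; case: Is.
have Ht : I2 (t - a) by rewrite ta; case: It.
move=> /(_ Hs Ht); rewrite ltrD2r => /(_ st) <- //.
- apply: eq_integral => y _; congr (_ * g _)%:E.
  by rewrite /concat -sa -ta !min_r//=; ring.
- move=> i /uI[[_ ?] us]; split=> //.
  by rewrite ge_max lerD2r us subr_ge0.
- by move=> i; exact: unit_fun_shift.
Qed.

Let int_fst (h : T1 -> R) : measurable_fun setT h -> (forall x, 0 <= h x) ->
  (\int[prodp m1 m2]_z (h z.1)%:E = \int[m1]_x (h x)%:E)%E.
Proof.
move=> mh h0.
exact: (preserves_integral (preserves_fst m1 m2) (measurable_EFin_comp mh)).
Qed.

Let pastQ1 : s <= a -> forall z, past z = \prod_(i < n) f i (Q1 (u i) z.1).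
Proof.
move=> sa z; apply: eq_bigr => i _; have [_ us] := uI (ltn_ord i).
rewrite /concat (max_r (x := u i - a)) ?subr_le0 ?(le_trans us)// Q20 addr0 min_l//.
exact: le_trans sa.
Qed.

Let uI1 : s <= a -> forall i, (i < n)%N -> I1 (u i) /\ u i <= s.
Proof.
move=> sa i /uI[[p _] us]; split => //; move: p; rewrite min_l//.
exact: le_trans sa.
Qed.

Let concat_early : t <= a -> goal.
Proof.
move=> ta; have sa : s <= a by rewrite (le_trans (ltW st)).
have mp1 : measurable_fun setT (fun x => \prod_(i < n) f i (Q1 (u i) x)).
  by apply: (measurable_unit_prod (Q := fun i => Q1 (u i))) => // i /(uI1 sa)[/mQ1].
have p10 x : 0 <= \prod_(i < n) f i (Q1 (u i) x).
  by have /andP[] := unit_fun_prod n (fun i => Q1 (u i)) x uf.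
have Hs : I1 s by case: Is; rewrite min_l.
have Ht : I1 t by case: It; rewrite min_l.
have [mg g01] := ug.
have mgi : measurable_fun setT (fun x => g (Q1 t x - Q1 s x)).
  by apply: (measurableT_comp mg); apply: measurable_funB; exact: mQ1.
under eq_integral do rewrite (pastQ1 sa).
under [X in (_ = X * _)%E]eq_integral do rewrite (pastQ1 sa).
have -> := int_fst mp1 p10.
have iE z : incr z = g (Q1 t z.1 - Q1 s z.1).
  rewrite /incr /concat !min_l// !max_r ?subr_le0// Q20.
  by congr g; ring.
under eq_integral do rewrite iE.
have -> := int_fst (h := fun x => \prod_(i < n) f i (Q1 (u i) x) * g (Q1 t x - Q1 s x)) _ _.
- by have [_ H] := HQ1; exact: (H s t n u f g Hs Ht st (uI1 sa) uf ug).
- exact: measurable_funM.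
- by move=> x; rewrite mulr_ge0//; have /andP[] := g01 (Q1 t x - Q1 s x).
Qed.

(** Integrating over the second path first replaces [g] by its Gaussian average [G]. This is again a
    unit function, to which the property of [Q1] on [[s, a]] applies, and [gauss_convolution] adds
    up the two variances. *)
Let concat_across : s < a -> a < t -> goal.
Proof.
move=> sa a_t; have sa' := ltW sa; have at' := ltW a_t.
have mp1 : measurable_fun setT (fun x => \prod_(i < n) f i (Q1 (u i) x)).
  by apply: (measurable_unit_prod (Q := fun i => Q1 (u i))) => // i /(uI1 sa')[/mQ1].
have p10 x : 0 <= \prod_(i < n) f i (Q1 (u i) x).
  by have /andP[] := unit_fun_prod n (fun i => Q1 (u i)) x uf.
have Hs : I1 s by case: Is; rewrite min_l.
have Ht : I2 (t - a) by case: It => _; rewrite max_l// subr_ge0.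
have ta0 : 0 < t - a by rewrite subr_gt0.
have as0 : 0 < a - s by rewrite subr_gt0.
have [mg g01] := ug.
pose G y := (\int[gauss]_x (g (y + Num.sqrt (t - a) * x))%:E)%E.
have mG2 : measurable_fun setT (fun z : R * measurableTypeR R => (g (z.1 + Num.sqrt (t - a) * z.2))%:E).
  apply: measurable_EFin_comp; apply: (measurableT_comp mg).
  apply: measurable_funD => //; apply: measurable_funM => //; exact: measurable_snd.
have g0 y : (0 <= (g y)%:E)%E by rewrite lee_fin; have /andP[] := g01 y.
have mG : measurable_fun setT G.
  exact: (measurable_integral_snd gauss mG2 (fun z => g0 _)).
have G01 y : (0 <= G y <= 1)%E.
  rewrite integral_ge0//= /G.
  have <- : (\int[gauss]_x 1 = 1)%E by rewrite integral_cst//= probability_setT mul1e.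
  apply: ge0_le_integral => //.
  - by apply: measurable_EFin_comp; apply: (unit_fun_scale (g := fun x => g (y + x)) _ _).1; exact: unit_fun_shift.
  - by move=> x _; rewrite lee_fin; have /andP[] := g01 (y + Num.sqrt (t - a) * x).
have GE y : G y = (fine (G y))%:E.
  have /andP[h0 h1] := G01 y; rewrite fineK// ge0_fin_numE//.
  by rewrite (le_lt_trans h1)// ltry.
have uG : unit_fun (fine \o G).
  split; first exact: measurableT_comp.
  move=> y; have /andP[h0 h1] := G01 y.
  by rewrite -!lee_fin /= -GE h0 h1.
under [X in (_ = X * _)%E]eq_integral do rewrite (pastQ1 sa').
have -> := int_fst mp1 p10.
have -> := integral_prodp m1 m2 mprod prod0.
transitivity (\int[m1]_x (\prod_(i < n) f i (Q1 (u i) x) * (fine \o G) (Q1 a x - Q1 s x))%:E)%E.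
  apply: eq_integral => x _.
  rewrite EFinM /= -GE.
  have pE y : past (x, y) = \prod_(i < n) f i (Q1 (u i) x) by exact: (pastQ1 sa').
  under eq_integral do rewrite pE EFinM.
  have mi : measurable_fun setT (fun y => (incr (x, y))%:E).
    apply: measurable_EFin_comp; apply: (measurableT_comp mg).
    by apply: measurable_funB; apply: measurable_fun_pair2; exact: mconcat.
  have -> := ge0_integralZl m2 measurableT mi (fun y _ => g0 _) (_ : (0 <= (\prod_(i < n) f i (Q1 (u i) x))%:E)%E); last by rewrite lee_fin.
  congr (_ * _)%E.
  have [_ H] := HQ2.
  have := H 0 (t - a) 0%N (fun _ => 0) f (fun y => g (Q1 a x - Q1 s x + y)) I20 Ht ta0 (fun i => _) uf (unit_fun_shift _ ug).
  rewrite subr0 => H'.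
  transitivity (\int[m2]_y (\prod_(i < 0) f i (Q2 0 y) * g (Q1 a x - Q1 s x + (Q2 (t - a) y - Q2 0 y)))%:E)%E.
    apply: eq_integral => y _; rewrite big_ord0 mul1r /incr /concat /= !Q20.
    rewrite min_r// min_l// max_l ?ltW// max_r ?subr_le0// Q20.
    by congr (g _)%:E; ring.
  rewrite H'//.
  under eq_integral do rewrite big_ord0.
  by rewrite integral_cst//= probability_setT mul1e mul1e.
have [_ H] := HQ1.
rewrite (H s a n u f (fine \o G) Hs I1a sa (uI1 sa') uf uG); congr (_ * _)%E.
have -> : t - s = (a - s) + (t - a) by ring.
rewrite -(gauss_convolution as0 ta0 ug).
by apply: eq_integral => x _; rewrite /= -GE.
Qed.

Lemma concat_product : goal.
Proof.
have [as_|sa] := leP a s; first exact: concat_late.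
have [ta|a_t] := leP t a; first exact: concat_early.
exact: concat_across.
Qed.

End fixed_data.

Lemma indep_incr_concat : indep_incr (prodp m1 m2) concat_times concat.
Proof. by split; [exact: mconcat|exact: concat_product]. Qed.

End concatenation.

(** * The midpoint construction *)

Section tree_process.
Context (R : realType).
Local Notation gauss := (@gauss R).
Local Notation mu := (@source_prob R).

Definition hsqrt : R := (Num.sqrt 2)^-1.

Lemma hsqrt2 : hsqrt ^+ 2 = 1 / 2.
Proof. by rewrite /hsqrt exprVn sqr_sqrtr// mul1r. Qed.

Lemma hsqrt_gt0 : 0 < hsqrt. Proof. by rewrite invr_gt0 sqrtr_gt0. Qed.

Lemma indep_incr_sub d (T : measurableType d) (m : probability T R) (I J : set R) Q :
  J `<=` I -> indep_incr m I Q -> indep_incr m J Q.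
Proof.
move=> JI [mQ HQ]; split; first by move=> t /JI; exact: mQ.
move=> s t n u f g /JI Is /JI It st uJ uf ug.
by apply: (HQ s t n u f g) => // i /uJ[/JI].
Qed.

(* The affine interpolation at the dyadic times of level [n] of a Brownian path on [0, 1]:
   by Brownian scaling [lft z] and [rgt z] are the sources of its two halves. *)
Fixpoint tree n (t : R) (z : source R) : R :=
  if n is n'.+1 then
    hsqrt * tree n' (2 * Num.min t (1 / 2)) (lft z) +
    hsqrt * tree n' (2 * Num.max (t - 1 / 2) 0) (rgt z)
  else t * (z.1 : R).

Lemma treeS n t z : tree n.+1 t z =
  hsqrt * tree n (2 * Num.min t (1 / 2)) (lft z) +
  hsqrt * tree n (2 * Num.max (t - 1 / 2) 0) (rgt z).
Proof. by []. Qed.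

Definition grid m N : set R := [set t | exists2 k, (k <= N * 2 ^ m)%N & t = k%:R / 2 ^+ m].

Lemma tree0 n z : tree n 0 z = 0.
Proof.
elim: n z => [|n IH] z /=; first by rewrite mul0r.
by rewrite min_l// max_r ?sub0r ?oppr_le0// !mulr0 !IH !mulr0 addr0.
Qed.

Lemma tree1 n z : tree n 1 z = z.1.
Proof.
elim: n z => [|n IH] z /=; first by rewrite mul1r.
rewrite min_r; last by lra.
rewrite max_l; last by lra.
have -> : 2 * (1 / 2) = 1 :> R by field.
have -> : 2 * (1 - 1 / 2) = 1 :> R by field.
by rewrite !IH -mulrDr split_sum.
Qed.

Lemma gridP_min m N k j : (k <= (N + j) * 2 ^ m)%N ->
  grid m N (Num.min (k%:R / 2 ^+ m) N%:R).
Proof.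
move=> kN; have [h|h] := leqP k (N * 2 ^ m).
  exists k => //; rewrite min_l// ler_pdivrMr ?exprn_gt0//.
  by rewrite -natrX -natrM ler_nat.
exists (N * 2 ^ m)%N => //; rewrite min_r.
  by rewrite natrM natrX mulfK// expf_neq0.
by rewrite ler_pdivlMr ?exprn_gt0// -natrX -natrM ler_nat ltnW.
Qed.

Lemma gridP_max m N k j : (k <= (N + j) * 2 ^ m)%N ->
  grid m j (Num.max (k%:R / 2 ^+ m - N%:R) 0).
Proof.
move=> kN; have e0 : (2 : R) ^+ m != 0 by rewrite expf_neq0.
exists (k - N * 2 ^ m)%N; first by rewrite leq_subLR -mulnDl.
have [h|h] := leqP k (N * 2 ^ m).
  rewrite max_r; last by rewrite subr_le0 ler_pdivrMr ?exprn_gt0// -natrX -natrM ler_nat.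
  by move/eqP: h => ->; rewrite mul0r.
rewrite max_l; last by rewrite subr_ge0 ler_pdivlMr ?exprn_gt0// -natrX -natrM ler_nat ltnW.
by rewrite natrB ?(ltnW h)// natrM natrX mulrBl mulfK.
Qed.

(** At level 0 the only grid increment is [z.1], over all of [[0, 1]], and the past consists of
    zeros. The next level is the pullback along [split] of two rescaled trees concatenated at
    [1 / 2]. *)
Lemma indep_incr_tree n : indep_incr mu (grid n 1) (tree n).
Proof.
elim: n => [|n IH].
  have pf := preserves_fst gauss (unifp R).
  split.
    move=> t _; apply: measurable_funM => //; exact: measurable_fst.
  move=> s t n u f g [k k1 ->] [l l1 ->]; rewrite !expr0 !divr1 ltr_nat => kl uI uf ug.
  have k0 : k = 0%N by case: k kl k1 {uI} => // k; case: l l1 => // -[].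
  have l1' : l = 1%N by move: kl l1; rewrite k0; case: l => // -[].
  subst k l.
  have pE z : \prod_(i < n) f i (tree 0 (u i) z) = \prod_(i < n) f i 0.
    apply: eq_bigr => i _; have [[k _ ->]] := uI i (ltn_ord i).
    by rewrite expr0 divr1 lern0 => /eqP ->; rewrite tree0.
  under eq_integral do rewrite pE.
  under [X in (_ = X * _)%E]eq_integral do rewrite pE.
  have c0 : 0 <= \prod_(i < n) f i 0.
    by apply: prodr_ge0 => i _; have [_ /(_ 0)/andP[]] := uf i.
  rewrite integral_cst//= probability_setT mule1.
  have [mg g01] := ug.
  have mg' : measurable_fun setT (fun x : measurableTypeR R => (g x)%:E).
    exact/measurable_EFinP.
  have g0 x : (0 <= (g x)%:E)%E by rewrite lee_fin; have /andP[] := g01 x.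
  rewrite subr0 sqrtr1; under [X in (_ = _ * X)%E]eq_integral do rewrite mul1r.
  have <- := preserves_integral pf mg' g0.
  have c0' : (0 <= (\prod_(i < n) f i 0)%:E)%E by rewrite lee_fin.
  have <- := ge0_integralZl mu measurableT (measurableT_comp mg' pf.1) (fun x _ => g0 _) c0'.
  by apply: eq_integral => z _; rewrite mul1r mul0r subr0 EFinM.
have h2 : hsqrt ^+ 2 * 2 = 1 by rewrite hsqrt2; field.
have IHs := indep_incr_scale (ltr0Sn _ 1) (ltW hsqrt_gt0) h2 IH.
have C := @indep_incr_concat R _ _ _ _ mu mu _ _ _ _ (1 / 2) _ _ _ IHs IHs.
have {C} := indep_incr_pullback (split_preserves R) (C _ _ _).
have g1 : grid n 1 1 by exists (2 ^ n)%N; rewrite ?mul1n// natrX divff// expf_neq0.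
have g0 : grid n 1 0 by exists 0%N; rewrite // mul0r.
move=> /(_ _ _ _)H; apply: indep_incr_sub (H _ _ _).
- move=> _ [k kN ->]; rewrite mul1n expnS in kN.
  have e : 2 * (k%:R / 2 ^+ n.+1) = k%:R / 2 ^+ n :> R.
    by rewrite exprS invfM mulrCA mulVKf.
  split; rewrite /=.
    rewrite minr_pMr// e (_ : 2 * (1 / 2) = 1%:R :> R); last by field.
    exact: (@gridP_min n 1 k 1).
  rewrite maxr_pMr// mulrBr e mulr0 (_ : 2 * (1 / 2) = 1%:R :> R); last by field.
  exact: (@gridP_max n 1 k 1).
- by rewrite /= (_ : 2 * (1 / 2) = 1 :> R)//; field.
- by rewrite /= mulr0.
- by move=> z; rewrite mulr0 tree0 mulr0.
Qed.

Fixpoint glued m N (t : R) (z : source R) : R :=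
  if N is N'.+1 then tree m (Num.min t 1) (lft z) + glued m N' (Num.max (t - 1) 0) (rgt z)
  else 0.

Lemma glued0 m N z : glued m N 0 z = 0.
Proof.
elim: N z => [//|N IH] z /=.
by rewrite min_l// max_r ?sub0r ?oppr_le0// tree0 IH addr0.
Qed.

Lemma indep_incr_glued m N : indep_incr mu (grid m N) (glued m N).
Proof.
elim: N => [|N IH].
  split; first by move=> t _; exact: measurable_cst.
  move=> s t n u f g [k]; rewrite mul0n leqn0 => /eqP -> ->.
  by move=> [k']; rewrite mul0n leqn0 => /eqP -> ->; rewrite ltxx.
have C := @indep_incr_concat R _ _ _ _ mu mu _ _ _ _ 1 _ _ _ (indep_incr_tree m) IH.
have {}C H1 H2 H3 := indep_incr_pullback (split_preserves R) (C H1 H2 H3).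
apply: indep_incr_sub (C _ _ _).
- move=> _ [k kN ->]; split; first exact: (@gridP_min m 1 k N).
  exact: (@gridP_max m 1 k N).
- by exists (2 ^ m)%N; rewrite ?mul1n// natrX divff// expf_neq0.
- by exists 0%N; rewrite // mul0r.
- exact: glued0.
Qed.

End tree_process.

(** * Gaussian tails and the size of the corrections *)

Section gaussian_tail.
Context (R : realType).
Local Notation gauss := (@gauss R).
Local Notation leb := (@lebesgue_measure R).

(** Half of the exponent is sacrificed: where [a < |x|], the density is at most
    [2 * expR (- (a ^+ 2 / 4))] times the one of variance 2, whose total mass is 1. The factor 2
    rounds up [Num.sqrt 2]. *)
Lemma gauss_tail (a : R) : 0 <= a ->
  (gauss [set x | (a < `|x|)%R] <= (2 * expR (- (a ^+ 2 / 4)))%:E)%E.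
Proof.
move=> a0.
have s2 : (Num.sqrt 2 : R) ^+ 2 = 2 by rewrite sqr_sqrtr.
have s20 : 0 < (Num.sqrt 2 : R) by rewrite sqrtr_gt0.
have mA : measurable ([set x | a < `|x|] : set (measurableTypeR R)).
  by apply: (@measurable_gt_preimage _ _ _ (fun x : measurableTypeR R => `|x|)); exact: measurableT_comp.
pose q := @normal_pdf R 0 (Num.sqrt 2).
have pq x : normal_pdf 0 1 x = Num.sqrt 2 * expR (- (x ^+ 2 / 4)) * q x.
  rewrite std_normal_pdfE /q normal_pdfE ?gt_eqF// /normal_peak /normal_fun s2 subr0.
  have -> : Num.sqrt ((2 : R) * pi *+ 2) = Num.sqrt (pi *+ 2) * Num.sqrt 2.
    by rewrite -sqrtrM; [congr Num.sqrt; ring|exact/mulrn_wge0/pi_ge0].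
  have p0 : 0 < Num.sqrt (pi *+ 2 : R) by rewrite sqrtr_gt0 mulrn_wgt0// pi_gt0.
  have -> : - (x ^+ 2 / 2) = - (x ^+ 2 / 4) + - x ^+ 2 / (2 *+ 2) :> R by field.
  by rewrite expRD; field; rewrite !gt_eqF.
rewrite /gauss/= /normal_prob.
apply: (@le_trans _ _ (\int[leb]_(x in [set x | (a < `|x|)%R]) ((2 * expR (- (a ^+ 2 / 4)))%:E * (q x)%:E))%E).
  apply: ge0_le_integral => //.
  - by move=> x _; rewrite lee_fin normal_pdf_ge0.
  - by apply/measurable_EFinP; apply: measurable_funTS; exact: measurable_normal_pdf.
  - by apply/measurable_EFinP; apply: measurable_funTS; apply: measurable_funM => //; exact: measurable_normal_pdf.
  - move=> x /= ax; rewrite -EFinM lee_fin pq ler_wpM2r ?normal_pdf_ge0//.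
    apply: ler_pM; rewrite ?sqrtr_ge0 ?expR_ge0//.
      by rewrite -ler_sqr ?nnegrE ?sqrtr_ge0// s2; lra.
    rewrite ler_expR lerN2 ler_pM2r// -[x ^+ 2]real_normK ?num_real//.
    by rewrite ler_sqr ?nnegrE// ltW.
have E0 : (0 <= (2 * expR (- (a ^+ 2 / 4)))%:E)%E by rewrite lee_fin mulr_ge0// expR_ge0.
have mq : measurable_fun ([set x | (a < `|x|)%R] : set (measurableTypeR R)) (fun x : measurableTypeR R => (q x)%:E).
  by apply/measurable_EFinP; apply: measurable_funTS; exact: measurable_normal_pdf.
have q0 x : (0 <= (q x)%:E)%E by rewrite lee_fin normal_pdf_ge0.
have -> := ge0_integralZl leb mA mq (fun x _ => q0 x) E0.
rewrite -[leRHS]mule1 lee_wpmul2l//.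
rewrite -[leRHS](integral_normal_pdf 0 (Num.sqrt 2)).
by apply: ge0_subset_integral => //; apply/measurable_EFinP; exact: measurable_normal_pdf.
Qed.

End gaussian_tail.

Section path_bounds.
Context (R : realType) (beta : R).
Hypotheses (beta_gt0 : 0 < beta) (beta_lt : beta < 1 / 2).
Local Notation mu := (@source_prob R).

Fixpoint max_noise n (z : source R) : R :=
  if n is n'.+1 then Num.max (max_noise n' (lft z)) (max_noise n' (rgt z)) else `|noise z : R|.

Lemma max_noise_ge0 n z : 0 <= max_noise n z.
Proof. by elim: n z => [z|n IH z] /=; rewrite ?normr_ge0// le_max IH. Qed.

Lemma measurable_max_noise n : measurable_fun setT (max_noise n).
Proof.
elim: n => [|n IH] /=.
  by apply: measurableT_comp => //; case: (noise_preserves R).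
apply: measurable_maxr.
  by apply: (measurableT_comp IH); case: (lft_preserves R).
by apply: (measurableT_comp IH); case: (rgt_preserves R).
Qed.

Let mgt n a : measurable [set z | a < max_noise n z].
Proof. by apply: (@measurable_gt_preimage _ _ _ (max_noise n)); exact: measurable_max_noise. Qed.

(** A union bound over the [2 ^ n] nodes at depth [n], each of which carries a standard Gaussian
    noise. *)
Lemma max_noise_tail n a : 0 <= a ->
  (mu [set z | (a < max_noise n z)%R] <= (2 ^+ n * (2 * expR (- (a ^+ 2 / 4))))%:E)%E.
Proof.
move=> a0; elim: n => [|n IH].
  rewrite expr0 mul1r; apply: le_trans (gauss_tail a0).
  have [mn nE] := noise_preserves R.
  rewrite -nE//.
  by apply: (@measurable_gt_preimage _ _ _ (fun x : measurableTypeR R => `|x|)); exact: measurableT_comp.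
have [ml lE] := lft_preserves R; have [mr rE] := rgt_preserves R.
have -> : [set z | a < max_noise n.+1 z] =
    lft @^-1` [set z | a < max_noise n z] `|` rgt @^-1` [set z | a < max_noise n z].
  by apply/seteqP; split => z /=; rewrite lt_max => /orP.
have m1 : measurable (lft @^-1` [set z | a < max_noise n z]).
  by rewrite -[X in measurable X]setTI; exact: ml.
have m2 : measurable (rgt @^-1` [set z | a < max_noise n z]).
  by rewrite -[X in measurable X]setTI; exact: mr.
apply: (le_trans (measureU2 mu m1 m2)).
have l1 := lE _ (mgt n a); have r1 := rE _ (mgt n a).
apply: (@le_trans _ _ (mu [set z | (a < max_noise n z)%R] + mu [set z | (a < max_noise n z)%R])%E).
  by apply: leeD; [rewrite -l1|rewrite -r1].
apply: (le_trans (leeD IH IH)).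
by rewrite -EFinD lee_fin (exprS 2 n) le_eqVlt; apply/orP; left; apply/eqP; ring.
Qed.

(* Refining at level [n] moves the path by at most [(hsqrt * theta) ^ n * max_noise n] times
   [t ^ beta]. Since [hsqrt * theta = rho ^ 2] with [rho < 1], one factor [rho ^ n] pays for
   the growth of [max_noise n] and the other one makes the series converge. *)
Definition theta : R := 2 `^ beta.
Definition rho : R := Num.sqrt (hsqrt R * theta).

Lemma theta_gt0 : 0 < theta. Proof. exact: powR_gt0. Qed.

Lemma rho_gt0 : 0 < rho.
Proof. by rewrite sqrtr_gt0 mulr_gt0 ?hsqrt_gt0 ?theta_gt0. Qed.

Lemma rho2 : rho ^+ 2 = hsqrt R * theta.
Proof. by rewrite sqr_sqrtr// mulr_ge0// ltW// ?hsqrt_gt0 ?theta_gt0. Qed.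

(** Since [rho ^+ 4] equals [2 ^ (2 * beta - 1)], this is exactly the condition [beta < 1 / 2]. *)
Lemma rho_lt1 : rho < 1.
Proof.
suff : rho ^+ 2 ^+ 2 < 1.
  by rewrite -exprM => h; rewrite -(expr_lt1 (n := 2 * 2)) ?ltW ?rho_gt0.
rewrite rho2 exprMn hsqrt2 mul1r ltr_pdivrMl// mulr1.
rewrite /theta -powR_mulrn ?powR_ge0// -powRrM /powR pnatr_eq0/=.
rewrite -[ltRHS](@lnK _ 2) ?posrE// ltr_expR gtr_pMl ?ln_gt0 ?ltr1n//.
by move: beta_lt; lra.
Qed.

(** By self-similarity, the error on either half is [hsqrt] times a coarser error at a doubled time,
    and doubling costs a factor [theta] in [t ^ beta]; each level thus contributes
    [hsqrt * theta = rho ^+ 2]. The weight [t ^ beta] yields the bound at small times, beyond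
    uniform convergence. *)
Lemma tree_increment n t z : 0 <= t <= 1 ->
  `|tree n.+1 t z - tree n t z| <= rho ^+ 2 ^+ n * max_noise n z * t `^ beta.
Proof.
have b1 : beta <= 1 by move: beta_lt; lra.
have tb t' : 0 <= t' <= 1 -> t' <= t' `^ beta.
  move=> /andP[t0 t1]; have [->|tN0] := eqVneq t' 0; first exact: powR_ge0.
  by apply: ger1_powR => //; rewrite lt_neqAle eq_sym tN0 t0.
elim: n t z => [|n IH] t z t01; have /andP[t0 t1] := t01.
  rewrite expr0 mul1r.
  have dz : (z.1 : R) = hsqrt R * ((lft z).1 + (rgt z).1) by rewrite split_sum.
  have nz : (noise z : R) = hsqrt R * ((lft z).1 - (rgt z).1) by rewrite split_diff.
  have tree_0 t' z' : tree 0 t' z' = t' * (z'.1 : R) by [].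
  have -> : max_noise 0 z = `|noise z : R| by [].
  rewrite treeS !tree_0 dz.
  have [th|th] := leP t (1 / 2).
    rewrite max_r; last by lra.
    rewrite mulr0 mul0r mulr0 addr0.
    rewrite (_ : _ - _ = t * (noise z : R)); last by rewrite nz; ring.
    rewrite normrM mulrC (ger0_norm t0) ler_wpM2l ?normr_ge0//.
    exact: tb.
  rewrite max_l; last by lra.
  rewrite (_ : _ - _ = (1 - t) * (noise z : R)); last by rewrite nz; field.
  rewrite normrM mulrC (@ger0_norm _ (1 - t)); last by lra.
  rewrite ler_wpM2l ?normr_ge0//.
  by apply: (le_trans _ (tb _ t01)); lra.
have E : tree n.+2 t z - tree n.+1 t z =
   hsqrt R * (tree n.+1 (2 * Num.min t (1 / 2)) (lft z) - tree n (2 * Num.min t (1 / 2)) (lft z)) +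
   hsqrt R * (tree n.+1 (2 * Num.max (t - 1 / 2) 0) (rgt z) - tree n (2 * Num.max (t - 1 / 2) 0) (rgt z)).
  by rewrite (treeS n.+1) (treeS n t); ring.
have P0 : 0 <= rho ^+ 2 ^+ n by rewrite exprn_ge0// exprn_ge0// ltW// rho_gt0.
have PS : rho ^+ 2 ^+ n.+1 = hsqrt R * theta * rho ^+ 2 ^+ n by rewrite (exprS (rho ^+ 2) n) {1}rho2.
have h0 : 0 <= hsqrt R by rewrite ltW// hsqrt_gt0.
rewrite E.
have [th|th] := leP t (1 / 2).
  rewrite max_r; last by lra.
  rewrite mulr0 !tree0 subrr mulr0 addr0 normrM (ger0_norm h0).
  have t2 : 0 <= 2 * t <= 1 by apply/andP; split; lra.
  apply: (le_trans (ler_wpM2l h0 (IH _ (lft z) t2))).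
  rewrite powRM// -/theta PS.
  have -> : hsqrt R * (rho ^+ 2 ^+ n * max_noise n (lft z) * (theta * t `^ beta)) =
     hsqrt R * theta * rho ^+ 2 ^+ n * t `^ beta * max_noise n (lft z).
    by move: (rho ^+ 2 ^+ n) => P; ring.
  rewrite [leRHS]mulrAC ler_wpM2l//=; last by rewrite le_max lexx.
  by rewrite mulr_ge0 ?powR_ge0// mulr_ge0// mulr_ge0// ltW// theta_gt0.
(* On the right half the left piece is complete, and refinement does not move its endpoint: only the
   right piece contributes, at the time [2 * (t - 1 / 2) <= 2 * t]. *)
rewrite (_ : 2 * (1 / 2) = 1 :> R); last by field.
rewrite !tree1 subrr mulr0 add0r normrM (ger0_norm h0) max_l; last by lra.
have t2 : 0 <= 2 * (t - 1 / 2) <= 1 by apply/andP; split; lra.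
apply: (le_trans (ler_wpM2l h0 (IH _ (rgt z) t2))).
have le1 : (2 * (t - 1 / 2)) `^ beta <= theta * t `^ beta.
  rewrite /theta -powRM//; apply: ge0_ler_powR; rewrite ?nnegrE; [exact: ltW|lra|lra|lra].
apply: (@le_trans _ _ (hsqrt R * (rho ^+ 2 ^+ n * max_noise n (rgt z) * (theta * t `^ beta)))).
  by rewrite ler_wpM2l// ler_wpM2l// mulr_ge0// max_noise_ge0.
rewrite PS.
have -> : hsqrt R * (rho ^+ 2 ^+ n * max_noise n (rgt z) * (theta * t `^ beta)) =
   hsqrt R * theta * rho ^+ 2 ^+ n * t `^ beta * max_noise n (rgt z).
  by move: (rho ^+ 2 ^+ n) => P; ring.
rewrite [leRHS]mulrAC ler_wpM2l//=; last by rewrite le_max lexx orbT.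
by rewrite mulr_ge0 ?powR_ge0// mulr_ge0// mulr_ge0// ltW// theta_gt0.
Qed.

End path_bounds.

Lemma cvgn_of_tail_bound (R : realType) (a E : nat -> R) : E @ \oo --> 0 ->
  (forall n j, `|a (n + j)%N - a n| <= E n) ->
  cvgn a /\ forall n, `|limn a - a n| <= E n.
Proof.
move=> E0 aE.
have ca : cvgn a.
  apply: R_complete; apply/cauchyP => e e0.
  have [n _ nE] := cvgr_lt _ E0 _ e0.
  exists (a n); exists n => //= m /= nm; rewrite /ball /=.
  rewrite distrC -(subnKC nm) (le_lt_trans (aE _ _))//.
  by apply: nE => /=.
split => // n.
have : (fun m => `|a m - a n|) @ \oo --> `|limn a - a n|.
  by apply: cvg_norm; apply: cvgB => //; exact: cvg_cst.
move=> h; apply: (cvgr_to_le h); exists n => //= m /= nm.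
by rewrite -(subnKC nm).
Qed.

Section real_continuity.
Context (R : realType).

Lemma continuous_maxr (f g : R -> R) : continuous f -> continuous g ->
  continuous (fun x => Num.max (f x) (g x)).
Proof. by move=> cf cg x; apply: (@continuous_max R R f g); [exact: cf|exact: cg]. Qed.

Lemma continuous_minr (f g : R -> R) : continuous f -> continuous g ->
  continuous (fun x => Num.min (f x) (g x)).
Proof. by move=> cf cg x; apply: (@continuous_min R R f g); [exact: cf|exact: cg]. Qed.

Lemma continuous_cst (c : R) : continuous (fun _ : R => c : R).
Proof. by move=> x; exact: cvg_cst. Qed.

Lemma continuous_idr : continuous (fun x : R => x).
Proof. by move=> x; exact: cvg_id. Qed.

Lemma continuousDr (f g : R -> R) : continuous f -> continuous g ->
  continuous (fun x => f x + g x).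
Proof. by move=> cf cg x; apply: cvgD; [exact: cf|exact: cg]. Qed.

Lemma continuousMr (f g : R -> R) : continuous f -> continuous g ->
  continuous (fun x => f x * g x).
Proof. by move=> cf cg x; apply: cvgM; [exact: cf|exact: cg]. Qed.

Lemma continuous_compr (f g : R -> R) : continuous f -> continuous g ->
  continuous (fun x => f (g x)).
Proof. by move=> cf cg x; apply: (cvg_comp g f); [exact: cg|exact: cf]. Qed.

End real_continuity.

Arguments continuous_maxr {R f g} _ _.
Arguments continuous_minr {R f g} _ _.
Arguments continuousDr {R f g} _ _.
Arguments continuousMr {R f g} _ _.
Arguments continuous_compr {R f g} _ _.
Arguments continuous_cst {R} c.
Arguments continuous_idr {R}.

(** * The limit path on the unit interval *)

Section path_limit.
Context (R : realType) (beta : R).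
Hypotheses (beta_gt0 : 0 < beta) (beta_lt : beta < 1 / 2).
Local Notation mu := (@source_prob R).
Local Notation rho := (rho beta).

Definition good (K : R) : set (source R) :=
  [set z | `|z.1 : R| <= K /\ forall n, max_noise n z <= K * rho ^- n].

Let rho0 : 0 < rho := rho_gt0 beta.
Let rho1 : rho < 1 := rho_lt1 beta_lt.

(** The sum of the geometric series of ratio [rho]. *)
Definition tail : R := (1 - rho)^-1.

Lemma tail_gt0 : 0 < tail. Proof. by rewrite invr_gt0 subr_gt0. Qed.

Lemma measurable_good K : measurable (good K).
Proof.
have -> : good K = ~` [set z | K < `|z.1 : R|] `&`
    \bigcap_n ~` [set z | K * rho ^- n < max_noise n z].
  apply/seteqP; split => z /= [h1 h2]; split.
  - by apply/negP; rewrite -leNgt.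
  - by move=> n _ /=; apply/negP; rewrite -leNgt.
  - by move/negP : h1; rewrite -leNgt.
  - by move=> n; have /negP := h2 n Logic.I; rewrite -leNgt.
apply: measurableI.
  apply: measurableC; apply: (@measurable_gt_preimage _ _ _ (fun z : source R => `|z.1 : R|)).
  by apply: measurableT_comp => //; exact: measurable_fst.
apply: bigcapT_measurable => n; apply: measurableC.
by apply: (@measurable_gt_preimage _ _ _ (max_noise n)); exact: measurable_max_noise.
Qed.

Lemma tree_tail K z t n j : good K z -> 0 <= t <= 1 ->
  `|tree (n + j) t z - tree n t z| <= K * t `^ beta * tail * rho ^+ n.
Proof.
move=> [z1 zM] t01.
have K0 : 0 <= K by exact: le_trans z1.
have Kt : 0 <= K * t `^ beta by rewrite mulr_ge0// powR_ge0.
have step m : `|tree m.+1 t z - tree m t z| <= K * t `^ beta * rho ^+ m.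
  apply: (le_trans (tree_increment beta_gt0 beta_lt m z t01)).
  rewrite [leRHS]mulrAC ler_wpM2r ?powR_ge0//.
  apply: (@le_trans _ _ (rho ^+ 2 ^+ m * (K * rho ^- m))).
    by rewrite ler_wpM2l// exprn_ge0// exprn_ge0// ltW.
  by rewrite mulrCA exprAC (expr2 (rho ^+ m)) mulfK// expf_neq0// gt_eqF.
suff : `|tree (n + j) t z - tree n t z| <= K * t `^ beta * (tail * rho ^+ n - tail * rho ^+ (n + j)).
  move=> /le_trans; apply; rewrite -[leRHS]mulrA ler_wpM2l// lerBlDr lerDl.
  by rewrite mulr_ge0 ?(ltW tail_gt0)// exprn_ge0// ltW.
elim: j => [|j IH]; first by rewrite addn0 !subrr normr0 mulr0.
rewrite addnS.
rewrite (_ : _ - _ = (tree (n + j).+1 t z - tree (n + j) t z) + (tree (n + j) t z - tree n t z)); last by ring.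
apply: (le_trans (ler_normD _ _)); apply: (le_trans (lerD (step _) IH)).
rewrite -mulrDr ler_wpM2l// le_eqVlt; apply/orP; left; apply/eqP.
rewrite exprS /tail; field.
by rewrite subr_eq0 gt_eqF.
Qed.

Definition clamp (t : R) : R := Num.min (Num.max t 0) 1.

Lemma clamp_itv t : 0 <= clamp t <= 1.
Proof. by rewrite /clamp ge_min lexx orbT andbT le_min ler01 andbT le_max lexx orbT. Qed.

Lemma clamp_id t : 0 <= t <= 1 -> clamp t = t.
Proof. by move=> /andP[t0 t1]; rewrite /clamp max_l// min_l. Qed.

Lemma continuous_clamp : continuous clamp.
Proof.
apply: continuous_minr; last exact: continuous_cst.
by apply: continuous_maxr; [exact: continuous_idr|exact: continuous_cst].
Qed.

Lemma continuous_tree n z : continuous (fun t : R => tree n t z).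
Proof.
elim: n z => [|n IH] z.
  by apply: continuousMr; [exact: continuous_idr|exact: continuous_cst].
have c1 : continuous (fun t : R => 2 * Num.min t (1 / 2)).
  exact: (continuousMr (continuous_cst 2) (continuous_minr continuous_idr (continuous_cst (1 / 2)))).
have c2 : continuous (fun t : R => 2 * Num.max (t - 1 / 2) 0).
  exact: (continuousMr (continuous_cst 2) (continuous_maxr
    (continuousDr continuous_idr (continuous_cst (- (1 / 2)))) (continuous_cst 0))).
apply: continuousDr.
  exact: (continuousMr (continuous_cst _) (continuous_compr (IH (lft z)) c1)).
exact: (continuousMr (continuous_cst _) (continuous_compr (IH (rgt z)) c2)).
Qed.

Definition good_set : set (source R) := \bigcup_(k : nat) good k%:R.

(** The indicator of [good_set] makes the sequence converge for every source, so that the limit is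
    measurable and, as [continuous_paths] demands, continuous in time without exceptional
    sources. *)
Definition unit_path (t : R) (z : source R) : R :=
  limn (fun n => \1_good_set z * tree n (clamp t) z).

Lemma geometric_cvg0 (c x : R) : 0 <= x < 1 -> (fun n => c * x ^+ n) @ \oo --> 0.
Proof.
by move=> /andP[x0 x1]; apply: cvg_geometric; rewrite ger0_norm.
Qed.

Lemma unit_path_tail K z t : good K z -> good_set z ->
  (fun n => \1_good_set z * tree n (clamp t) z) @ \oo --> unit_path t z /\
  forall n, `|unit_path t z - tree n (clamp t) z| <= K * clamp t `^ beta * tail * rho ^+ n.
Proof.
move=> gK gz; rewrite /unit_path; set a := fun n => _.
have aE n : a n = tree n (clamp t) z by rewrite /a indicE mem_set// mul1r.
have [] := @cvgn_of_tail_bound R a (fun n => K * clamp t `^ beta * tail * rho ^+ n).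
- by apply: geometric_cvg0; rewrite (ltW rho0) rho1.
- by move=> n j; rewrite !aE; apply: tree_tail => //; exact: clamp_itv.
- by move=> ca h; split => // n; rewrite -aE.
Qed.

Lemma unit_path_cvg t z :
  (fun n => \1_good_set z * tree n (clamp t) z) @ \oo --> unit_path t z.
Proof.
have [gz|gz] := pselect (good_set z).
  by have [k _ gk] := gz; have [] := unit_path_tail t gk gz.
rewrite /unit_path; set a := fun n => _.
have -> : a = (fun _ => 0) by apply/funext => n; rewrite /a indicE memNset// mul0r.
by rewrite lim_cst//; exact: cvg_cst.
Qed.

Lemma unit_path_bad t z : ~ good_set z -> unit_path t z = 0.
Proof.
move=> gz; rewrite /unit_path; set a := fun n => _.
have -> : a = (fun _ => 0) by apply/funext => n; rewrite /a indicE memNset// mul0r.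
by rewrite lim_cst.
Qed.

Lemma measurable_good_set : measurable good_set.
Proof. by apply: bigcupT_measurable => k; exact: measurable_good. Qed.

Lemma measurable_tree n t : measurable_fun setT (tree n t : source R -> R).
Proof.
elim: n t => [|n IH] t.
  by apply: measurable_funM => //; exact: measurable_fst.
apply: measurable_funD; apply: measurable_funM => //.
  by apply: (measurableT_comp (IH _)); case: (lft_preserves R).
by apply: (measurableT_comp (IH _)); case: (rgt_preserves R).
Qed.

Lemma measurable_unit_path t : measurable_fun setT (unit_path t).
Proof.
apply: (@measurable_fun_cvg _ _ _ _ (fun n z => \1_good_set z * tree n (clamp t) z)).
  move=> n; apply: measurable_funM; last exact: measurable_tree.
  by apply: measurable_indic; exact: measurable_good_set.
by move=> z _; exact: unit_path_cvg.
Qed.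

(** The tail bound at [n = 0] compares the path with the chord [t * z.1], itself at most
    [K * t ^ beta] on [[0, 1]]. *)
Lemma unit_path_bound K z t : good K z -> good_set z -> 0 <= t <= 1 ->
  `|unit_path t z| <= K * (1 + tail) * t `^ beta.
Proof.
move=> gK gz t01; have [_ /(_ 0%N)] := unit_path_tail t gK gz.
rewrite clamp_id// expr0 mulr1 => h.
rewrite -[unit_path t z](subrK (tree 0 t z)) (le_trans (ler_normD _ _))//.
have -> : K * (1 + tail) * t `^ beta = K * t `^ beta * tail + K * t `^ beta by ring.
rewrite lerD//= normrM mulrC; have [z1 _] := gK; have /andP[t0 t1] := t01.
apply: ler_pM => //; rewrite ger0_norm//.
have [->|tN0] := eqVneq t 0; first exact: powR_ge0.
by apply: ger1_powR; [rewrite lt_neqAle eq_sym tN0 t0|move: beta_lt; lra].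
Qed.

Lemma continuous_unit_path z : continuous (fun t => unit_path t z).
Proof.
have [gz|gz] := pselect (good_set z); last first.
  rewrite (_ : (fun _ => _) = fun _ => 0); first exact: continuous_cst.
  by apply/funext => t; rewrite unit_path_bad.
have [k _ gk] := gz; move=> t; apply/cvgrPdist_le => e e0.
have e3 : 0 < e / 3 by rewrite divr_gt0.
have : (fun n => k%:R * tail * rho ^+ n) @ \oo --> 0.
  by apply: geometric_cvg0; rewrite (ltW rho0) rho1.
move=> /cvgr0Pnorm_le /(_ _ e3)[n _ /(_ n (leqnn n)) hn].
have bnd s : `|unit_path s z - tree n (clamp s) z| <= e / 3.
  have [_ h] := unit_path_tail s gk gz; apply: (le_trans (h n)).
  apply: le_trans hn; rewrite ger0_norm; last first.
    by rewrite mulr_ge0 ?exprn_ge0 ?(ltW rho0)// mulr_ge0 ?ler0n ?(ltW tail_gt0).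
  rewrite ler_wpM2r ?exprn_ge0 ?(ltW rho0)// ler_wpM2r ?(ltW tail_gt0)//.
  rewrite ler_piMr ?ler0n//.
  have /andP[c0 c1] := clamp_itv s.
  have -> : 1 = 1 `^ beta :> R by rewrite powR1.
  by apply: ge0_ler_powR => //; rewrite ?nnegrE// ltW.
have ct : continuous (fun s => tree n (clamp s) z).
  by apply: (continuous_compr (f := fun t : R => tree n t z)); [exact: continuous_tree|exact: continuous_clamp].
have /cvgrPdist_le /(_ _ e3) := ct t.
apply: filterS => s hs.
rewrite (_ : _ - _ = (unit_path t z - tree n (clamp t) z) +
   (tree n (clamp t) z - tree n (clamp s) z) + (tree n (clamp s) z - unit_path s z)); last by ring.
apply: (le_trans (ler_normD _ _)); rewrite (_ : e = e / 3 + e / 3 + e / 3); last by field.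
rewrite lerD//; last by rewrite distrC.
by apply: (le_trans (ler_normD _ _)); rewrite lerD.
Qed.

(** Uniform convergence permits times that move with [n]. They will be dyadic approximations on the
    grid of level [n], where the increments are under control. *)
Lemma unit_path_moving z (t : R) (s : nat -> R) : good_set z ->
  (forall n, 0 <= s n <= 1) -> s @ \oo --> t ->
  (fun n => tree n (s n) z) @ \oo --> unit_path t z.
Proof.
move=> gz s01 st; have [k _ gk] := gz.
have h1 : (fun n => unit_path (s n) z) @ \oo --> unit_path t z.
  exact: (cvg_comp _ _ st (@continuous_unit_path z t)).
have h2 : (fun n => tree n (s n) z - unit_path (s n) z) @ \oo --> 0.
  apply/cvgr0Pnorm_le => e e0.
  have : (fun n => k%:R * tail * rho ^+ n) @ \oo --> 0.
    by apply: geometric_cvg0; rewrite (ltW rho0) rho1.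
  move=> /cvgr0Pnorm_le /(_ _ e0); apply: filterS => n; apply: le_trans.
  rewrite distrC -{2}(clamp_id (s01 n)).
  have [_ h] := unit_path_tail (s n) gk gz; apply: (le_trans (h n)).
  rewrite ger0_norm; last first.
    by rewrite mulr_ge0 ?exprn_ge0 ?(ltW rho0)// mulr_ge0 ?ler0n ?(ltW tail_gt0).
  rewrite ler_wpM2r ?exprn_ge0 ?(ltW rho0)// ler_wpM2r ?(ltW tail_gt0)//.
  rewrite ler_piMr ?ler0n// clamp_id//.
  have -> : 1 = 1 `^ beta :> R by rewrite powR1.
  by have /andP[? ?] := s01 n; apply: ge0_ler_powR => //; rewrite ?nnegrE// ltW.
rewrite -[unit_path t z]add0r (_ : (fun n => tree n (s n) z) =
  (fun n => (tree n (s n) z - unit_path (s n) z) + unit_path (s n) z)); first exact: cvgD h2 h1.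
by apply/funext => n; rewrite subrK.
Qed.

Lemma unit_path0 z : unit_path 0 z = 0.
Proof.
rewrite /unit_path (_ : (fun _ => _) = fun _ => 0); first by rewrite lim_cst.
by apply/funext => n; rewrite clamp_id ?lexx ?ler01// tree0 mulr0.
Qed.

End path_limit.

(** * The probability of a good source *)

Section good_probability.
Context (R : realType) (beta : R).
Hypotheses (beta_gt0 : 0 < beta) (beta_lt : beta < 1 / 2).
Local Notation mu := (@source_prob R).
Local Notation rho := (rho beta).
Local Notation good := (@good R beta).
Local Notation good_set := (@good_set R beta).

Let rho0 : 0 < rho := rho_gt0 beta.
Let rho1 : rho < 1 := rho_lt1 beta_lt.

Lemma bernoulli_ineq (d : R) n : 0 <= d -> 1 + n%:R * d <= (1 + d) ^+ n.
Proof.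
move=> d0; elim: n => [|n IH]; first by rewrite mul0r addr0 expr0.
rewrite exprS -natr1; apply: (@le_trans _ _ ((1 + d) * (1 + n%:R * d))).
  rewrite -subr_ge0 (_ : _ - _ = n%:R * d ^+ 2); last by ring.
  by rewrite mulr_ge0// exprn_ge0.
by rewrite ler_wpM2l// addr_ge0.
Qed.

Let gap : R := rho ^- 2 - 1.

Let gap0 : 0 < gap.
Proof. by rewrite subr_gt0 invf_gt1 ?exprn_gt0// expr_lt1// ltW. Qed.

(** By Bernoulli [(rho ^- n) ^+ 2] is at least [1 + n * gap], so with [ln 4 <= 3] the tail at depth
    [n] gains a factor [4 ^- n]. Against the [2 ^ n] nodes this leaves a geometric series of sum
    [4 * E]; the increment over [[0, 1]] adds [2 * E]. *)
Lemma good_prob_bound (K : R) : 0 <= K -> 3 <= K ^+ 2 * gap / 4 ->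
  (mu (~` good K) <= (6 * expR (- (K ^+ 2 / 4)))%:E)%E.
Proof.
move=> K0 K3; set E := expR _.
have E0 : 0 <= E by exact: expR_ge0.
have mM n : measurable [set z | K * rho ^- n < max_noise n z].
  by apply: (@measurable_gt_preimage _ _ _ (max_noise n)); exact: measurable_max_noise.
have mD : measurable [set z : source R | K < `|z.1 : R|].
  apply: (@measurable_gt_preimage _ _ _ (fun z : source R => `|z.1 : R|)).
  by apply: measurableT_comp => //; exact: measurable_fst.
have sub : ~` good K `<=` [set z : source R | K < `|z.1 : R|] `|`
    \bigcup_n [set z | K * rho ^- n < max_noise n z].
  move=> z /= ng; have [h|h] := leP `|z.1 : R| K; last by left.
  right; apply: contrapT => h'; apply: ng; split => // n.
  by rewrite leNgt; apply/negP => h2; apply: h'; exists n.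
have mU : measurable (\bigcup_n [set z | K * rho ^- n < max_noise n z]) by exact: bigcupT_measurable.
apply: (@le_trans _ _ (mu ([set z : source R | K < `|z.1 : R|]%R `|`
    \bigcup_n [set z | K * rho ^- n < max_noise n z]%R))).
  apply: le_measure; rewrite ?inE//; last exact: measurableU.
  by apply: measurableC; exact: measurable_good.
apply: (le_trans (measureU2 mu mD mU)).
have -> : 6 * E = 2 * E + 4 * E by ring.
rewrite EFinD; apply: leeD.
  have [pf pE] := preserves_fst (gauss R) (unifp R).
  apply: le_trans (gauss_tail K0); rewrite -pE//.
  by apply: (@measurable_gt_preimage _ _ _ (fun x : measurableTypeR R => `|x|)); exact: measurableT_comp.
apply: (le_trans (generalized_Boole_inequality mu mM mU)).
have E40 : 0 <= 4 * E by rewrite mulr_ge0.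
apply: le_trans (epsilon_trick0 xpredT E40).
apply: lee_nneseries => // n _.
have Kr0 : 0 <= K * rho ^- n by rewrite mulr_ge0// invr_ge0 exprn_ge0// ltW.
apply: (le_trans (max_noise_tail n Kr0)).
rewrite lee_fin.
have e1 : expR (- ((K * rho ^- n) ^+ 2 / 4)) <= E * (4^-1) ^+ n.
  have -> : (4 : R)^-1 ^+ n = expR (- (n%:R * ln 4)).
    by rewrite expRN mulrC expRM_natr lnK ?posrE// exprVn.
  rewrite -expRD ler_expR -opprD lerN2.
  have h4 : ln 4 <= 3 :> R.
    by rewrite (le_trans (@le_ln1Dx R 3 _))//; lra.
  have hb := bernoulli_ineq n (ltW gap0).
  have -> : (K * rho ^- n) ^+ 2 = K ^+ 2 * (1 + gap) ^+ n.
    by rewrite exprMn /gap addrC subrK -!exprVn exprAC.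
  apply: (@le_trans _ _ (K ^+ 2 * (1 + n%:R * gap) / 4)).
    have h5 : n%:R * ln 4 <= n%:R * (K ^+ 2 * gap / 4) by rewrite ler_wpM2l// (le_trans h4).
    by apply: (le_trans (lerD (lexx _) h5)); rewrite le_eqVlt; apply/orP; left; apply/eqP; field.
  by rewrite ler_pM2r// ler_wpM2l// sqr_ge0.
apply: (@le_trans _ _ (2 ^+ n * (2 * (E * 4^-1 ^+ n)))).
  by rewrite ler_wpM2l ?exprn_ge0// ler_wpM2l.
rewrite le_eqVlt; apply/orP; left; apply/eqP.
rewrite natrX (exprS 2 n) (_ : 4 = 2 * 2 :> R)//; last by ring.
rewrite exprVn exprMn; field.
by rewrite expf_neq0.
Qed.

Lemma good_prob (eps : R) : 0 < eps -> exists k : nat, (mu (~` good k%:R) <= eps%:E)%E.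
Proof.
(* The three terms ensure [3 <= K ^+ 2 * gap / 4], then [6 * expR (- (K ^+ 2 / 4)) <= eps] by means
   of [1 + x <= expR x], and [k <= k ^+ 2]. *)
move=> eps0; pose k := (Num.truncn (12 / gap + 24 / eps + 1)).+1.
have kE : 12 / gap + 24 / eps + 1 < k%:R by exact: truncnS_gt.
have p1 : 0 < 12 / gap by rewrite divr_gt0.
have p2 : 0 < 24 / eps by rewrite divr_gt0.
have k1 : 1 <= k%:R :> R by lra.
have kk : k%:R <= k%:R ^+ 2 :> R by rewrite expr2 ler_peMl// (le_trans ler01).
exists k; apply: le_trans (good_prob_bound _ _) _ => //.
  rewrite ler_pdivlMr// -ler_pdivrMr//; apply: le_trans kk; lra.
rewrite lee_fin expRN ler_pdivrMr ?expR_gt0// mulrC -ler_pdivrMr//.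
apply: le_trans (expR_ge1Dx _).
have : 24 / eps <= k%:R ^+ 2 by apply: le_trans kk; lra.
have -> : 24 / eps = 4 * (6 / eps) by field; rewrite gt_eqF.
lra.
Qed.

Lemma good_set_full : mu (~` good_set) = 0%E.
Proof.
apply/eqP; rewrite eq_le measure_ge0 andbT; apply/lee_addgt0Pr => e e0.
have [k hk] := good_prob e0; rewrite add0e; apply: le_trans hk.
apply: le_measure; rewrite ?inE.
- by apply: measurableC; exact: measurable_good_set.
- by apply: measurableC; exact: measurable_good.
- by apply: subsetC => z gz; exists k.
Qed.

End good_probability.

(** * Unit paths glued together and the law of their increments *)

Section limit_process.
Context (R : realType) (beta : R).
Hypotheses (beta_gt0 : 0 < beta) (beta_lt : beta < 1 / 2).
Local Notation mu := (@source_prob R).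
Local Notation gauss := (@gauss R).
Local Notation good_set := (@good_set R beta).
Local Notation unit_path := (@unit_path R beta).

Fixpoint glued_path N (t : R) (z : source R) : R :=
  if N is N'.+1 then unit_path (Num.min t 1) (lft z) + glued_path N' (Num.max (t - 1) 0) (rgt z)
  else 0.

Fixpoint good_all N : set (source R) :=
  if N is N'.+1 then (lft @^-1` good_set) `&` (rgt @^-1` good_all N') else setT.

Lemma preserves_measurable d1 d2 (T1 : measurableType d1) (T2 : measurableType d2)
    (m1 : set T1 -> \bar R) (m2 : set T2 -> \bar R) phi A :
  preserves m1 m2 phi -> measurable A -> measurable (phi @^-1` A).
Proof. by move=> [mphi _] mA; rewrite -[X in measurable X]setTI; exact: mphi. Qed.

Lemma good_all_full N : measurable (good_all N) /\ mu (~` good_all N) = 0%E.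
Proof.
elim: N => [|N [mN N0]] /=; first by rewrite setCT measure0.
have mg := measurable_good_set beta.
have ml := preserves_measurable (lft_preserves R) mg.
have mr := preserves_measurable (rgt_preserves R) mN.
split; first exact: measurableI.
rewrite setCI; apply/eqP; rewrite eq_le measure_ge0 andbT.
have mlC := measurableC ml; have mrC := measurableC mr.
apply: (le_trans (measureU2 mu mlC mrC)).
have l0 : mu (~` (lft @^-1` good_set)) = 0%E.
  rewrite preimage_setC; have [_ lE] := lft_preserves R.
  by have -> := lE _ (measurableC mg); exact: good_set_full.
have r0 : mu (~` (rgt @^-1` good_all N)) = 0%E.
  rewrite preimage_setC; have [_ rE] := rgt_preserves R.
  by have -> := rE _ (measurableC mN).
by rewrite [X in (X + _)%E]l0 [X in (_ + X)%E]r0 adde0.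
Qed.

Lemma good_all_ae N : {ae mu, forall z, good_all N z}.
Proof.
have [mN N0] := good_all_full N.
exists (~` good_all N); split=> //; exact: measurableC.
Qed.

Lemma glued_moving N z (t : R) (s : nat -> R) : good_all N z ->
  (forall n, 0 <= s n) -> s @ \oo --> t ->
  (fun n => glued n N (s n) z) @ \oo --> glued_path N t z.
Proof.
elim: N z t s => [|N IH] z t s; first by move=> _ _ _; exact: cvg_cst.
move=> /= [gl gr] s0 st; apply: cvgD.
  apply: (unit_path_moving beta_gt0 beta_lt) => //.
    by move=> n; rewrite le_min s0 ler01 /= ge_min lexx orbT.
  exact: (cvg_comp _ _ st (continuous_minr continuous_idr (continuous_cst 1) t)).
apply: (IH _ _ (fun n => Num.max (s n - 1) 0)) => //.
  by move=> n; rewrite le_max lexx orbT.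
exact: (cvg_comp _ _ st (continuous_maxr
  (continuousDr continuous_idr (continuous_cst (- 1))) (continuous_cst 0) t)).
Qed.

Lemma measurable_glued m N t : measurable_fun setT (glued m N t : source R -> R).
Proof.
elim: N t => [|N IH] t; first exact: measurable_cst.
apply: measurable_funD.
  by apply: (measurableT_comp (measurable_tree _ _)); case: (lft_preserves R).
by apply: (measurableT_comp (IH _)); case: (rgt_preserves R).
Qed.

Lemma measurable_glued_path N t : measurable_fun setT (glued_path N t).
Proof.
elim: N t => [|N IH] t; first exact: measurable_cst.
apply: measurable_funD.
  by apply: (measurableT_comp (measurable_unit_path beta_gt0 beta_lt _)); case: (lft_preserves R).
by apply: (measurableT_comp (IH _)); case: (rgt_preserves R).
Qed.

Lemma continuous_glued_path N z : continuous (fun t => glued_path N t z).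
Proof.
elim: N z => [|N IH] z; first exact: continuous_cst.
have c1 : continuous (fun t : R => Num.min t 1) := continuous_minr continuous_idr (continuous_cst 1).
have c2 : continuous (fun t : R => Num.max (t - 1) 0) :=
  continuous_maxr (continuousDr continuous_idr (continuous_cst (- 1))) (continuous_cst 0).
exact: (continuousDr (continuous_compr (continuous_unit_path beta_gt0 beta_lt (z := lft z)) c1)
   (continuous_compr (IH (rgt z)) c2)).
Qed.

Lemma glued_path0 N z : glued_path N 0 z = 0.
Proof.
elim: N z => [//|N IH] z /=.
by rewrite min_l// max_r ?sub0r ?oppr_le0// unit_path0 IH addr0.
Qed.

Lemma glued_path_stable N M t z : t <= N%:R -> (N <= M)%N -> 0 <= t -> 
  glued_path M t z = glued_path N t z.
Proof.
elim: N M t z => [|N IH] M t z tN NM t0.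
  have -> : t = 0 by apply/eqP; rewrite eq_le tN t0.
  by rewrite !glued_path0.
case: M NM => // M NM /=; congr (_ + _); apply: IH => //.
  by rewrite ge_max ler0n andbT lerBlDr natr1.
by rewrite le_max lexx orbT.
Qed.

Lemma bounded_integral_cvg d (T : measurableType d) (P : probability T R)
    (F : nat -> T -> R) (G : T -> R) :
  (forall m, measurable_fun setT (F m)) -> measurable_fun setT G ->
  (forall m z, 0 <= F m z <= 1) ->
  {ae P, forall z, F^~ z @ \oo --> G z} ->
  (fun m => \int[P]_z (F m z)%:E)%E @ \oo --> (\int[P]_z (G z)%:E)%E.
Proof.
move=> mF mG F01 cvFG.
have [] // := @dominated_convergence _ T R P setT measurableT
  (fun m z => (F m z)%:E) (fun z => (G z)%:E) (cst 1%E).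
- by move=> m; exact/measurable_EFinP.
- exact/measurable_EFinP.
- apply: filterS cvFG => z cz _.
  by apply/fine_cvgP; split => //; exact: nearW.
- exact: (@finite_measure_integrable_cst _ _ _ P setT 1).
- apply: aeW => z m _ /=.
  by have /andP[h0 h1] := F01 m z; rewrite lee_fin ger0_norm.
Qed.

Definition dyadic_floor m (x : R) : R := (Num.truncn (2 ^+ m * x))%:R / 2 ^+ m.

Lemma dyadic_floor_ge0 m x : 0 <= dyadic_floor m x.
Proof. by rewrite divr_ge0// exprn_ge0. Qed.

Lemma dyadic_floor_le m x : 0 <= x -> dyadic_floor m x <= x < dyadic_floor m x + 2 ^- m.
Proof.
move=> x0; have p0 : 0 < 2 ^+ m :> R by rewrite exprn_gt0.
have := truncn_itv (mulr_ge0 (ltW p0) x0) => /andP[h1 h2].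
apply/andP; split; first by rewrite ler_pdivrMr// (mulrC x).
by rewrite -[X in _ < _ + X]mul1r -mulrDl ltr_pdivlMr// (mulrC x) natr1.
Qed.

Lemma dyadic_floor_mono m x y : 0 <= x -> x <= y -> dyadic_floor m x <= dyadic_floor m y.
Proof.
move=> x0 xy; rewrite ler_pM2r ?invr_gt0 ?exprn_gt0// ler_nat.
by apply: le_truncn; rewrite ler_wpM2l// exprn_ge0.
Qed.

Lemma dyadic_floor_grid m N x : x <= N%:R -> grid m N (dyadic_floor m x).
Proof.
move=> xN; exists (Num.truncn (2 ^+ m * x)) => //.
rewrite -(@natrK R (N * 2 ^ m)%N); apply: le_truncn.
by rewrite natrM natrX mulrC ler_wpM2r// exprn_ge0.
Qed.

Lemma dyadic_floor_cvg x : 0 <= x -> (fun m => dyadic_floor m x) @ \oo --> x.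
Proof.
move=> x0; apply: (@squeeze_cvgr _ _ _ _ (fun m => x - 2 ^- m) (cst x)).
- apply: nearW => m; have /andP[h1 h2] := dyadic_floor_le m x0.
  by rewrite h1 andbT lerBlDr ltW.
- rewrite -[X in _ --> X]subr0; apply: cvgB; first exact: cvg_cst.
  rewrite (_ : (fun m => 2 ^- m) = (fun m => 1 * (2^-1 : R) ^+ m)).
    apply: geometric_cvg0; lra.
  by apply/funext => m; rewrite mul1r exprVn.
- exact: cvg_cst.
Qed.

(** The limit of [indep_incr_glued] with every time replaced by its dyadic floor, which lies on the
    grid; floors keep the weak order of times, and continuous test functions let dominated
    convergence apply. *)
Lemma glued_path_indep N s t n (u : nat -> R) (f : nat -> R -> R) g :
  0 <= s -> s < t -> t <= N%:R -> (forall i, (i < n)%N -> 0 <= u i <= s) ->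
  (forall i, unit_fun (f i)) -> (forall i, continuous (f i)) ->
  unit_fun g -> continuous g ->
  (\int[mu]_z (\prod_(i < n) f i (glued_path N (u i) z) *
       g (glued_path N t z - glued_path N s z))%:E =
   \int[mu]_z (\prod_(i < n) f i (glued_path N (u i) z))%:E *
   \int[gauss]_x (g (Num.sqrt (t - s) * x))%:E)%E.
Proof.
move=> s0 st tN us uf cf ug cg.
have t0 : 0 <= t by rewrite (le_trans s0)// ltW.
have sN : s <= N%:R by rewrite (le_trans (ltW st)).
pose fl := dyadic_floor.
pose A m z := \prod_(i < n) f i (glued m N (fl m (u i)) z).
pose A' z := \prod_(i < n) f i (glued_path N (u i) z).
pose B m z := g (glued m N (fl m t) z - glued m N (fl m s) z).
pose B' z := g (glued_path N t z - glued_path N s z).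
have mA m : measurable_fun setT (A m).
  apply: (measurable_unit_prod (Q := fun i => glued m N (fl m (u i)))) => // i _.
  exact: measurable_glued.
have mA' : measurable_fun setT A'.
  apply: (measurable_unit_prod (Q := fun i => glued_path N (u i))) => // i _.
  exact: measurable_glued_path.
have [mg g01] := ug.
have mB m : measurable_fun setT (B m).
  by apply: (measurableT_comp mg); apply: measurable_funB; exact: measurable_glued.
have mB' : measurable_fun setT B'.
  by apply: (measurableT_comp mg); apply: measurable_funB; exact: measurable_glued_path.
have A01 m z : 0 <= A m z <= 1 by exact: (unit_fun_prod n (fun i => glued m N (fl m (u i))) z uf).
have cvA z : good_all N z -> A^~ z @ \oo --> A' z.
  move=> gz; rewrite /A /A'.
  elim: n us {A A' mA mA' A01} => [|n IH] us.
    by under eq_fun do rewrite big_ord0; rewrite big_ord0; exact: cvg_cst.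
  under eq_fun do rewrite big_ord_recr/=.
  rewrite big_ord_recr/=; apply: cvgM.
    by apply: IH => i ni; apply: us; rewrite (ltn_trans ni).
  have /andP[u0 _] := us n (ltnSn n).
  have h := glued_moving gz (fun m => dyadic_floor_ge0 m (u n)) (dyadic_floor_cvg u0).
  exact: (cvg_comp _ _ h (cf n _)).
have cvB z : good_all N z -> B^~ z @ \oo --> B' z.
  move=> gz; rewrite /B /B'.
  have ht := glued_moving gz (fun m => dyadic_floor_ge0 m t) (dyadic_floor_cvg t0).
  have hs := glued_moving gz (fun m => dyadic_floor_ge0 m s) (dyadic_floor_cvg s0).
  exact: (cvg_comp _ _ (cvgB ht hs) (cg _)).
have l1 : (fun m => \int[mu]_z (A m z * B m z)%:E)%E @ \oo --> (\int[mu]_z (A' z * B' z)%:E)%E.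
  apply: bounded_integral_cvg.
  - by move=> m; exact: measurable_funM.
  - exact: measurable_funM.
  - move=> m z; have /andP[a0 a1] := A01 m z; have /andP[b0 b1] := g01 (glued m N (fl m t) z - glued m N (fl m s) z).
    by rewrite mulr_ge0//= mulr_ile1.
  - by apply: filterS (good_all_ae N) => z gz; apply: cvgM; [exact: cvA|exact: cvB].
have l2 : (fun m => \int[mu]_z (A m z)%:E)%E @ \oo --> (\int[mu]_z (A' z)%:E)%E.
  apply: bounded_integral_cvg => //.
  by apply: filterS (good_all_ae N) => z gz; exact: cvA.
have cvs : (fun m => Num.sqrt (fl m t - fl m s)) @ \oo --> Num.sqrt (t - s).
  apply: (@continuous_cvg _ _ _ _ _ (fun m => fl m t - fl m s) _ _); first exact: sqrt_continuous.
  exact: (cvgB (dyadic_floor_cvg t0) (dyadic_floor_cvg s0)).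
have l3 : (fun m => \int[gauss]_x (g (Num.sqrt (fl m t - fl m s) * x))%:E)%E @ \oo -->
    (\int[gauss]_x (g (Num.sqrt (t - s) * x))%:E)%E.
  apply: (@bounded_integral_cvg _ (measurableTypeR R) gauss
    (fun m x => g (Num.sqrt (fl m t - fl m s) * x)) (fun x => g (Num.sqrt (t - s) * x))).
  - by move=> m; case: (unit_fun_scale (Num.sqrt (fl m t - fl m s)) ug).
  - by case: (unit_fun_scale (Num.sqrt (t - s)) ug).
  - by move=> m x; exact: g01.
  - apply: aeW => x.
    have h : (fun m => Num.sqrt (fl m t - fl m s) * (x : R)) @ \oo --> Num.sqrt (t - s) * (x : R).
      by apply: cvgM => //; exact: cvg_cst.
    exact: (cvg_comp _ _ h (cg _)).
have fin (d : measure_display) (T : measurableType d) (P : probability T R) (F : T -> R) :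
   measurable_fun setT F -> (forall z, 0 <= F z <= 1) -> (\int[P]_z (F z)%:E)%E \is a fin_num.
  move=> mF F01; rewrite ge0_fin_numE; last by apply: integral_ge0 => z _; rewrite lee_fin; have /andP[] := F01 z.
  apply: (@le_lt_trans _ _ (\int[P]_z 1)%E); last by rewrite integral_cst//= probability_setT mul1e ltry.
  apply: ge0_le_integral => //.
  - by move=> z _; rewrite lee_fin; have /andP[] := F01 z.
  - exact/measurable_EFinP.
  - by move=> z _; rewrite lee_fin; have /andP[] := F01 z.
have l4 : (fun m => \int[mu]_z (A m z)%:E * \int[gauss]_x (g (Num.sqrt (fl m t - fl m s) * x))%:E)%E @ \oo -->
   (\int[mu]_z (A' z)%:E * \int[gauss]_x (g (Num.sqrt (t - s) * x))%:E)%E.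
  apply: cvgeM => //; apply: mule_def_fin.
    by apply: fin => // z; exact: (unit_fun_prod n (fun i => glued_path N (u i)) z uf).
  by apply: fin => //; case: (unit_fun_scale (Num.sqrt (t - s)) ug).
apply: (cvg_unique _ l1); first exact: ereal_hausdorff.
refine (cvg_trans _ l4); apply: near_eq_cvg.
(* The identity at level [m] needs distinct floors of [s] and [t], which is the case for large [m]
   only. *)
have ev : \forall m \near \oo, fl m s < fl m t.
  have h : (fun m => fl m t - fl m s) @ \oo --> t - s.
    exact: (cvgB (dyadic_floor_cvg t0) (dyadic_floor_cvg s0)).
  have ts0 : 0 < t - s by rewrite subr_gt0.
  by apply: filterS (cvgr_gt _ h _ ts0) => m; rewrite subr_gt0.
apply: filterS ev => m ltm.
have [_ H] := indep_incr_glued R m N.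
symmetry; apply: (H (fl m s) (fl m t) n (fun i => fl m (u i)) f g) => //.
- exact: dyadic_floor_grid.
- exact: dyadic_floor_grid.
- move=> i /us/andP[u0 uis]; split; last exact: dyadic_floor_mono.
  by apply: dyadic_floor_grid; exact: le_trans sN.
Qed.

End limit_process.

(** * Brownian motion and its filtration *)

Section brownian_motion.
Context (R : realType) (beta : R).
Hypotheses (beta_gt0 : 0 < beta) (beta_lt : beta < 1 / 2).
Local Notation mu := (@source_prob R).
Local Notation gauss := (@gauss R).

Lemma glued_path_eq N M t (z : source R) : 0 <= t -> t <= N%:R -> t <= M%:R ->
  glued_path beta N t z = glued_path beta M t z.
Proof.
move=> t0 tN tM; have [NM|/ltnW MN] := leqP N M.
  by rewrite (glued_path_stable _ _ tN NM).
by rewrite (glued_path_stable _ _ tM MN).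
Qed.

(** The number of unit pieces exceeds [t], and any larger number gives the same value. The [max]
    extends the path by 0 to negative times, which makes it continuous on the whole line. *)
Definition brownian (t : R) (z : source R) : R :=
  glued_path beta (Num.truncn t).+1 (Num.max t 0) z.

Lemma brownianE N t z : t <= N%:R -> brownian t z = glued_path beta N (Num.max t 0) z.
Proof.
move=> tN; apply: glued_path_eq.
- by rewrite le_max lexx orbT.
- by rewrite ge_max ler0n andbT ltW// truncnS_gt.
- by rewrite ge_max ler0n andbT.
Qed.

Lemma brownian0 t z : t <= 0 -> brownian t z = 0.
Proof. by move=> t0; rewrite (brownianE (N := 0)). Qed.

Lemma continuous_brownian z : continuous (fun t => brownian t z).
Proof.
move=> t; pose N := (Num.truncn (t + 1)).+1.
have tN : t + 1 < N%:R by exact: truncnS_gt.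
have c : continuous (fun s : R => glued_path beta N (Num.max s 0) z).
  exact: (continuous_compr (continuous_glued_path beta_gt0 beta_lt (N := N) (z := z))
    (continuous_maxr continuous_idr (continuous_cst 0))).
have ct : (fun s : R => glued_path beta N (Num.max s 0) z) s @[s --> t] --> brownian t z.
  by rewrite (brownianE (N := N)); [exact: c|rewrite ltW// (lt_trans _ tN)// ltrDl].
refine (cvg_trans _ ct); apply: near_eq_cvg.
have : \forall s \near t, s < t + 1 by apply: lt_nbhsl; rewrite ltrDl.
by apply: filterS => s st; rewrite (brownianE (N := N))// ltW// (lt_trans st).
Qed.

Lemma measurable_brownian t : measurable_fun setT (brownian t).
Proof. exact: measurable_glued_path. Qed.

(** A continuous approximation of the indicator of []a, +oo[], rising linearly on an interval of
    length [k^-1] to the right of [a]. *)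
Definition bump (a : R) (k : nat) (x : R) : R := clamp (k%:R * (x - a)).

Lemma continuous_bump a k : continuous (bump a k).
Proof.
apply: (continuous_compr (@continuous_clamp R)).
exact: (continuousMr (continuous_cst k%:R) (continuousDr continuous_idr (continuous_cst (- a)))).
Qed.

Lemma unit_fun_bump a k : unit_fun (bump a k).
Proof.
split; first by apply: continuous_measurable_fun; exact: continuous_bump.
by move=> x; exact: clamp_itv.
Qed.

Lemma bump_cvg a x : (fun k => bump a k x) @ \oo --> ((a < x)%R%:R : R).
Proof.
have [ax|xa] := ltP a x; last first.
  rewrite (_ : (fun _ => _) = fun _ => 0); first exact: cvg_cst.
  apply/funext => k; rewrite /bump /clamp max_r.
    by rewrite min_l.
  by rewrite mulr_ge0_le0// subr_le0.
have d0 : 0 < x - a by rewrite subr_gt0.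
have c1 : (fun _ : nat => 1 : R) @ \oo --> (1 : R) by exact: cvg_cst.
refine (cvg_trans _ c1); apply: near_eq_cvg.
exists (Num.truncn (x - a)^-1).+1 => //= k /= hk.
have h : 1 <= k%:R * (x - a).
  by rewrite -ler_pdivrMr// mul1r ltW// (lt_le_trans (truncnS_gt _))// ler_nat.
by rewrite /bump /clamp max_l ?(le_trans ler01)// min_r.
Qed.

Definition past n (u a : nat -> R) : set (source R) :=
  [set z | forall i, (i < n)%N -> a i < brownian (u i) z].

Lemma pastE n (u a : nat -> R) z : (\prod_(i < n) (a i < brownian (u i) z)%R%:R)%R = \1_(past n u a) z :> R.
Proof.
have [h|h] := pselect (past n u a z).
  by rewrite indicE mem_set// big1// => i _; rewrite h.
rewrite indicE memNset//; apply/eqP; rewrite prodf_seq_eq0.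
apply/hasP; apply: contrapT => h'; apply: h => i ni; apply: contrapT => /negP h2.
apply: h'; exists (Ordinal ni); first by rewrite mem_index_enum.
by rewrite /= (negbTE h2).
Qed.

Lemma measurable_gt_brownian t b : measurable [set z | b < brownian t z].
Proof. by apply: (@measurable_gt_preimage _ _ _ (brownian t)); exact: measurable_brownian. Qed.

Lemma measurable_past n u a : measurable (past n u a).
Proof.
have -> : past n u a = \bigcap_i (if (i < n)%N then [set z | a i < brownian (u i) z] else setT).
  apply/seteqP; split => z /= h i; first by move=> _; case: ifP => // ni; exact: h.
  by move=> ni; have := h i Logic.I; rewrite ni.
by apply: bigcapT_measurable => i; case: ifP => // _; exact: measurable_gt_brownian.
Qed.

Lemma measurable_increment s t b : measurable [set z | b < brownian t z - brownian s z].
Proof.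
apply: (@measurable_gt_preimage _ _ _ (fun z => brownian t z - brownian s z)).
by apply: measurable_funB; exact: measurable_brownian.
Qed.

(** Bumps tend to indicators, so dominated convergence turns the continuous test functions of
    [glued_path_indep] into events. *)
Lemma past_increment s t n u a b : 0 <= s -> s < t ->
  (forall i, (i < n)%N -> 0 <= u i <= s) ->
  (mu (past n u a `&` [set z | (b < brownian t z - brownian s z)%R]) =
   mu (past n u a) * gauss [set x | (b < Num.sqrt (t - s) * x)%R])%E.
Proof.
move=> s0 st us.
pose N := (Num.truncn t).+1.
have tN : t <= N%:R by rewrite ltW// truncnS_gt.
have t0 : 0 <= t by rewrite (le_trans s0)// ltW.
have BE v : 0 <= v -> v <= t -> forall z, glued_path beta N v z = brownian v z.
  by move=> v0 vt z; rewrite (brownianE (N := N)) ?max_l// (le_trans vt).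
pose A k z := \prod_(i < n) bump (a i) k (brownian (u i) z).
pose B k z := bump b k (brownian t z - brownian s z).
have H k : (\int[mu]_z (A k z * B k z)%:E =
    \int[mu]_z (A k z)%:E * \int[gauss]_x (bump b k (Num.sqrt (t - s) * x))%:E)%E.
  have AE z : A k z = \prod_(i < n) bump (a i) k (glued_path beta N (u i) z).
    apply: eq_bigr => i _; have /andP[u0 uis] := us i (ltn_ord i).
    by rewrite BE// (le_trans uis)// ltW.
  have BE' z : B k z = bump b k (glued_path beta N t z - glued_path beta N s z).
    by rewrite !BE// ltW.
  under eq_integral do rewrite AE BE'.
  under [X in (_ = X * _)%E]eq_integral do rewrite AE.
  apply: (glued_path_indep beta_gt0 beta_lt (f := fun i => bump (a i) k)) => //.
  - by move=> i; exact: unit_fun_bump.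
  - by move=> i; exact: continuous_bump.
  - exact: unit_fun_bump.
  - exact: continuous_bump.
have mA k : measurable_fun setT (A k).
  apply: (measurable_unit_prod (f := fun i => bump (a i) k) (Q := fun i => brownian (u i))).
    by move=> i; exact: unit_fun_bump.
  by move=> i _; exact: measurable_brownian.
have A01 k z : 0 <= A k z <= 1.
  by apply: (unit_fun_prod n (f := fun i => bump (a i) k) (fun i => brownian (u i))) => i; exact: unit_fun_bump.
have mB k : measurable_fun setT (B k).
  have [mb _] := unit_fun_bump b k; apply: (measurableT_comp mb).
  by apply: measurable_funB; exact: measurable_brownian.
have B01 k z : 0 <= B k z <= 1 by have [_] := unit_fun_bump b k; exact.
have cvA z : A^~ z @ \oo --> (\1_(past n u a) z : R).
  rewrite -pastE /A.
  have gen m : (fun k => \prod_(i < m) bump (a i) k (brownian (u i) z)) @ \oo -->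
      (\prod_(i < m) (a i < brownian (u i) z)%R%:R : R)%R.
    elim: m => [|m IH].
      by under eq_fun do rewrite big_ord0; rewrite big_ord0; exact: cvg_cst.
    under eq_fun do rewrite big_ord_recr/=.
    by rewrite big_ord_recr/=; apply: cvgM => //; exact: bump_cvg.
  exact: gen.
pose I := [set z | b < brownian t z - brownian s z].
have cvB z : B^~ z @ \oo --> (\1_I z : R).
  rewrite indicE (_ : (z \in I) = (b < brownian t z - brownian s z)); first exact: bump_cvg.
  by apply/idP/idP => [/set_mem|h]; [|exact: mem_set].
have mI : measurable I by exact: measurable_increment.
have mP : measurable (past n u a) by exact: measurable_past.
pose J : set (measurableTypeR R) := [set x | b < Num.sqrt (t - s) * x].
have mJ : measurable J.
  apply: (@measurable_gt_preimage _ _ _ (fun x : measurableTypeR R => Num.sqrt (t - s) * x)).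
  by apply: measurable_funM.
have iE d (T : measurableType d) (P : probability T R) (C : set T) : measurable C ->
   (\int[P]_z (\1_C z)%:E = P C)%E.
  by move=> mC; rewrite integral_indic// setIT.
have l1 : (fun k => \int[mu]_z (A k z * B k z)%:E)%E @ \oo --> mu (past n u a `&` I).
  rewrite -iE; last exact: measurableI.
  apply: bounded_integral_cvg.
  - by move=> k; exact: measurable_funM.
  - by apply: measurable_indic; exact: measurableI.
  - move=> k z; have /andP[a0 a1] := A01 k z; have /andP[b0 b1] := B01 k z.
    by rewrite mulr_ge0//= mulr_ile1.
  - by apply: aeW => z; rewrite indicI; apply: cvgM.
have l2 : (fun k => \int[mu]_z (A k z)%:E)%E @ \oo --> mu (past n u a).
  rewrite -iE//; apply: bounded_integral_cvg => //.
  exact: aeW.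
have l3 : (fun k => \int[gauss]_x (bump b k (Num.sqrt (t - s) * x))%:E)%E @ \oo --> gauss J.
  rewrite -iE//.
  apply: (@bounded_integral_cvg _ _ (measurableTypeR R) gauss
    (fun k x => bump b k (Num.sqrt (t - s) * x)) (\1_J)).
  - by move=> k; case: (unit_fun_scale (Num.sqrt (t - s)) (unit_fun_bump b k)).
  - exact: measurable_indic.
  - by move=> k x; have [_] := unit_fun_bump b k; exact.
  - apply: aeW => x.
    rewrite indicE (_ : (x \in J) = (b < Num.sqrt (t - s) * x)); first exact: bump_cvg.
    by apply/idP/idP => [/set_mem|h]; [|exact: mem_set].
have l4 : (fun k => \int[mu]_z (A k z)%:E * \int[gauss]_x (bump b k (Num.sqrt (t - s) * x))%:E)%E
    @ \oo --> (mu (past n u a) * gauss J)%E.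
  by apply: cvgeM => //; apply: mule_def_fin; rewrite fin_num_measure.
have l1' : (fun k => \int[mu]_z (A k z)%:E * \int[gauss]_x (bump b k (Num.sqrt (t - s) * x))%:E)%E
    @ \oo --> mu (past n u a `&` I).
  by rewrite (_ : (fun k => _) = (fun k => \int[mu]_z (A k z * B k z)%:E)%E)//; apply/funext => k; rewrite H.
exact: (cvg_unique _ l1' l4).
Qed.

End brownian_motion.

Section brownian_filtration.
Context (R : realType) (beta : R).
Hypotheses (beta_gt0 : 0 < beta) (beta_lt : beta < 1 / 2).
Local Notation mu := (@source_prob R).
Local Notation gauss := (@gauss R).
Local Notation brownian := (@brownian R beta).
Local Notation past := (@past R beta).

Definition past_sets (s : R) : set (set (source R)) :=
  [set E | exists n (u a : nat -> R),
     (forall i, (i < n)%N -> 0 <= u i <= s) /\ E = past n u a].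

Definition past_filtration (s : R) : set (set (source R)) := <<s past_sets s >>.

Lemma past_sets_measurable s : past_sets s `<=` measurable.
Proof. by move=> _ [n [u [a [_ ->]]]]; exact: measurable_past. Qed.

Lemma past_sets_setI s : setI_closed (past_sets s).
Proof.
move=> _ _ [n [u [a [us ->]]]] [m [v [b [vs ->]]]].
exists (n + m)%N, (fun i => if (i < n)%N then u i else v (i - n)%N),
  (fun i => if (i < n)%N then a i else b (i - n)%N); split.
  move=> i inm; case: ltnP => h; first exact: us.
  by apply: vs; rewrite ltn_subLR.
apply/seteqP; split => z.
  move=> [h1 h2] i inm; case: ltnP => h; first exact: h1.
  by apply: h2; rewrite ltn_subLR.
move=> h; split => i ilt.
  by have := h i (ltn_addr _ ilt); rewrite ilt.
have := h (n + i)%N; rewrite ltn_add2l => /(_ ilt).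
by rewrite ltnNge leq_addr /= addKn.
Qed.

Lemma past_sets_setT s : past_sets s setT.
Proof.
exists 0%N, (fun=> 0), (fun=> 0); split => //.
by apply/seteqP; split.
Qed.

Lemma past_filtrationP : is_filtration past_filtration.
Proof.
split.
- move=> t _; exact: (@smallest_sigma_algebra (source R) setT (past_sets t)).
- move=> t _; apply: smallest_sub; first exact: sigma_algebra_measurable.
  exact: past_sets_measurable.
- move=> s t _ st; apply: sub_sigma_algebra2.
  move=> _ [n [u [a [us ->]]]]; exists n, u, a; split => // i ilt.
  by have /andP[h0 h1] := us i ilt; rewrite h0 (le_trans h1).
Qed.

Lemma brownian_adapted_past : adapted past_filtration brownian.
Proof.
move=> t t0 B mB.
have mX : measurable_fun setT (brownian t : g_sigma_algebraType (past_sets t) -> R).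
  apply: (measurability _ (RGenOInfty.measurableE R)) => _ [_ [a ->] <-].
  rewrite setTI; apply: sub_sigma_algebra.
  exists 1%N, (fun=> t), (fun=> a); split.
    by move=> i _; rewrite t0 lexx.
  apply/seteqP; split => z /=; rewrite in_itv/= andbT.
    by move=> h i _.
  by move=> /(_ 0%N isT).
by have := mX measurableT B mB; rewrite setTI.
Qed.

(** A rescaling of the density; it links the standard Gaussian of the construction to the law
    prescribed for Brownian increments. *)
Lemma normal_probE (sigma : R) (B : set (measurableTypeR R)) : 0 < sigma -> measurable B ->
  normal_prob 0 sigma B = gauss ((fun x : measurableTypeR R => sigma * x : measurableTypeR R) @^-1` B).
Proof.
move=> s0 mB.
have msx : measurable_fun setT (fun x : measurableTypeR R => sigma * x : measurableTypeR R).
  by have := measurable_affine sigma 0; under eq_fun do rewrite addr0.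
have mB' : measurable ((fun x : measurableTypeR R => sigma * x : measurableTypeR R) @^-1` B).
  by rewrite -[X in measurable X]setTI; exact: msx.
have mf : measurable_fun setT (fun x : measurableTypeR R => (\1_B x * normal_pdf 0 sigma x)%:E).
  apply/measurable_EFinP; apply: measurable_funM; first exact: measurable_indic.
  exact: measurable_normal_pdf.
have f0 (x : measurableTypeR R) : (0 <= (\1_B x * normal_pdf 0 sigma x)%:E)%E.
  by rewrite lee_fin mulr_ge0// normal_pdf_ge0.
transitivity (\int[lebesgue_measure]_x (\1_B x * normal_pdf 0 sigma x)%:E)%E.
  rewrite /normal_prob integral_mkcond; apply: eq_integral => x _.
  by rewrite patchE indicE; case: ifP => _; rewrite ?mul1r ?mul0r.
have sN0 : sigma != 0 by rewrite gt_eqF.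
have -> := integral_affine 0 sN0 mf f0.
have mg : measurable_fun setT (fun x : measurableTypeR R => (\1_B (sigma * x + 0) * normal_pdf 0 sigma (sigma * x + 0))%:E).
  by apply: (measurableT_comp mf); exact: measurable_affine.
have s0' : (0 <= `|sigma|%:E)%E by rewrite lee_fin.
have <- := ge0_integralZl lebesgue_measure measurableT mg (fun x _ => f0 _) s0'.
transitivity (\int[lebesgue_measure]_(x in (fun x : measurableTypeR R => sigma * x : measurableTypeR R)%R @^-1` B) (normal_pdf 0 1 x)%:E)%E => //.
rewrite [RHS]integral_mkcond; apply: eq_integral => x _.
rewrite -EFinM patchE addr0 indicE.
have -> : (x \in (fun x : measurableTypeR R => sigma * x : measurableTypeR R) @^-1` B) = (sigma * x \in B).
  by apply/idP/idP => /set_mem h; apply/mem_set.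
case: ifP => _; last by rewrite mul0r mulr0.
congr EFin; rewrite mul1r std_normal_pdfE normal_pdfE// /normal_peak /normal_fun subr0.
have -> : - (sigma * x) ^+ 2 / (sigma ^+ 2 *+ 2) = - (x ^+ 2 / 2) by field.
rewrite mulrA; congr (_ * _); rewrite -mulrnAr sqrtrM ?sqr_ge0// sqrtr_sqr invfM mulrA.
by rewrite divff ?mul1r// normr_eq0.
Qed.

Lemma increment_law s t (B : set (measurableTypeR R)) : 0 <= s -> s < t -> measurable B ->
  mu ((brownian t \- brownian s) @^-1` B) = normal_prob 0 (Num.sqrt (t - s)) B.
Proof.
move=> s0 st mB.
have r0 : 0 < Num.sqrt (t - s) by rewrite sqrtr_gt0 subr_gt0.
have md : measurable_fun setT ((brownian t \- brownian s) : source R -> measurableTypeR R).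
  have h : measurable_fun setT ((brownian t \- brownian s) : source R -> R).
    by apply: measurable_funB; exact: measurable_brownian.
  exact: h.
have := @measure_unique_oy R (image_measure mu md)
  (normal_prob 0 (Num.sqrt (t - s)) : {measure set (measurableTypeR R) -> \bar R}) _ _ B mB.
apply; last first.
  by rewrite /= /pushforward preimage_setT probability_setT ltry.
move=> b.
have us0 : forall i, (i < 0)%N -> 0 <= (fun _ : nat => 0 : R) i <= s by [].
have H := past_increment beta_gt0 beta_lt (fun=> 0) b s0 st us0.
(* With an empty list of past conditions, [past_increment] is the law of the increment alone. *)
have pT : past 0 (fun=> 0) (fun=> 0) = setT by apply/seteqP; split.
rewrite pT setTI probability_setT mul1e in H.
transitivity (mu [set z | (b < brownian t z - brownian s z)%R]).
  congr (mu _); apply/seteqP; split => z /=; rewrite in_itv/= andbT//.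
rewrite [LHS]H; symmetry.
transitivity (gauss ((fun x : measurableTypeR R => Num.sqrt (t - s) * x : measurableTypeR R) @^-1` `]b, +oo[%classic)).
  by apply: normal_probE => //; exact: measurable_itv.
by congr (gauss _); apply/seteqP; split => x /=; rewrite in_itv/= andbT.
Qed.

Lemma brownian_motionP : is_brownian_motion mu past_filtration brownian.
Proof.
split.
- exact: brownian_adapted_past.
- by move=> z; apply: continuous_subspaceT => t; exact: continuous_brownian.
- by apply: aeW => z; rewrite brownian0.
- move=> s t s0 st A B FA mB.
  have md : measurable_fun setT ((brownian t \- brownian s) : source R -> measurableTypeR R).
    have h : measurable_fun setT ((brownian t \- brownian s) : source R -> R).
      by apply: measurable_funB; exact: measurable_brownian.
    exact: h.
  have mC : measurable ((brownian t \- brownian s) @^-1` B).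
    by rewrite -[X in measurable X]setTI; exact: md.
  (* Two extensions: from finite families of past values to the past sigma-algebra, then from
     half-lines to the Borel set [B]. *)
  apply: (independent_sigma (@past_sets_measurable s) (@past_sets_setI s) (past_sets_setT s) mC) => //.
  move=> _ [n [u [a [us ->]]]].
  rewrite setIC [RHS]muleC; apply: independent_oy => //; first exact: measurable_past.
  move=> b; rewrite setIC [RHS]muleC.
  have H := past_increment beta_gt0 beta_lt (u := u) a b s0 st us.
  have us0 : forall i, (i < 0)%N -> 0 <= (fun _ : nat => 0 : R) i <= s by [].
  have H0 := past_increment beta_gt0 beta_lt (fun=> 0) b s0 st us0.
  have pT : past 0 (fun=> 0) (fun=> 0) = setT by apply/seteqP; split.
  have E : (brownian t \- brownian s) @^-1` `]b, +oo[%classic = [set z | (b < brownian t z - brownian s z)%R].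
    by apply/seteqP; split => z /=; rewrite in_itv/= andbT.
  rewrite E H; congr (_ * _)%E.
  by move: H0; rewrite pT setTI probability_setT mul1e => H0; rewrite [RHS]H0.
- by move=> s t s0 st B mB; exact: increment_law.
Qed.

End brownian_filtration.

(** * The equation driven by a continuous path *)

Section primitive.
Context (R : realType).
Local Notation leb := (@lebesgue_measure R).

Definition prim (f : R -> R) (t : R) : R := \int[leb]_(s in `[0, t]) f s.

(** The class in which the limit of the Picard iterates is known to lie before its continuity is;
    continuity then follows from the equation. *)
Definition tame (f : R -> R) : Prop :=
  measurable_fun setT f /\ forall T, exists B, forall s, 0 <= s <= T -> `|f s| <= B.

Lemma tame_continuous f : continuous f -> tame f.
Proof.
move=> cf; split; first exact: continuous_measurable_fun.
move=> T; have [T0|T0] := leP 0 T; last first.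
  by exists 0 => s /andP[s0 sT]; have := lt_le_trans T0 (le_trans s0 sT); rewrite ltxx.
have [|c _ hc] := @EVT_max R (fun x => `|f x|) 0 T T0.
  by apply: continuous_subspaceT => x; apply: cvg_norm; exact: cf.
by exists `|f c| => s s0T; apply: hc; rewrite in_itv.
Qed.

Lemma tame_integrable f (T : R) : tame f -> leb.-integrable `[0, T] (EFin \o f).
Proof.
move=> [mf bf]; apply: measurable_bounded_integrable.
- exact: measurable_itv.
- rewrite [X in (X < _)%E](_ : _ = lebesgue_measure (`[0, T]%classic : set R))// lebesgue_measure_itv/=.
  by case: ifP; rewrite ?ltry// -EFinD ltry.
- exact: measurable_funTS.
- have [B hB] := bf T; exists B; split; first exact: num_real.
  move=> M BM s /=; rewrite in_itv/= => s0T.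
  exact: le_trans (hB s s0T) (ltW BM).
Qed.

Let integrable_sub f (s t : R) : tame f -> 0 <= s ->
  leb.-integrable `]s, t] (EFin \o f).
Proof.
move=> tf s0; apply: (integrableS _ _ _ (tame_integrable t tf)) => //.
by apply: subset_itvr; rewrite bnd_simp.
Qed.

Lemma prim_le0 f t : t <= 0 -> prim f t = 0.
Proof.
rewrite /prim le_eqVlt => /orP[/eqP ->|t0]; first by rewrite set_itv1 Rintegral_set1.
by rewrite set_itv_ge ?Rintegral_set0// bnd_simp -ltNge.
Qed.

Lemma primB f s t : tame f -> 0 <= s -> s <= t ->
  prim f t - prim f s = \int[leb]_(x in `]s, t]) f x.
Proof.
by move=> tf s0 st; apply: Rintegral_itvB; [exact: tame_integrable|rewrite bnd_simp|rewrite bnd_simp].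
Qed.

Let len (s t : R) : s <= t -> fine (leb `]s, t]%classic) = t - s.
Proof.
move=> st; rewrite lebesgue_measure_itv/= lte_fin; case: ltP => //= ts.
by have -> : s = t; [apply/eqP; rewrite eq_le st|rewrite subrr].
Qed.

Lemma primB_ge f s t m : tame f -> 0 <= s -> s <= t ->
  (forall x, s <= x <= t -> m <= f x) -> m * (t - s) <= prim f t - prim f s.
Proof.
move=> tf s0 st fm; rewrite primB// -(len st) -Rintegral_cst//.
apply: le_Rintegral => //.
- by apply: (integrable_sub (f := fun=> m)) => //; apply: tame_continuous; exact: continuous_cst.
- exact: integrable_sub.
- by move=> x /=; rewrite in_itv/= => /andP[h1 h2]; apply: fm; rewrite ltW.
Qed.

Lemma primB_le f s t m : tame f -> 0 <= s -> s <= t ->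
  (forall x, s <= x <= t -> f x <= m) -> prim f t - prim f s <= m * (t - s).
Proof.
move=> tf s0 st fm; rewrite primB// -(len st) -Rintegral_cst//.
apply: le_Rintegral => //.
- exact: integrable_sub.
- by apply: (integrable_sub (f := fun=> m)) => //; apply: tame_continuous; exact: continuous_cst.
- by move=> x /=; rewrite in_itv/= => /andP[h1 h2]; apply: fm; rewrite ltW.
Qed.

Lemma le_prim f g t : tame f -> tame g -> (forall s, 0 <= s <= t -> f s <= g s) ->
  prim f t <= prim g t.
Proof.
move=> tf tg fg; apply: le_Rintegral => //.
- exact: tame_integrable.
- exact: tame_integrable.
Qed.

Lemma primN f t : tame f -> prim (fun s => - f s) t = - prim f t.
Proof.
move=> tf; rewrite /prim; under eq_Rintegral do rewrite -mulN1r.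
by rewrite RintegralZl ?mulN1r//; exact: tame_integrable.
Qed.

Lemma prim_cvg (f : nat -> R -> R) (g : R -> R) t B : (forall n, tame (f n)) -> tame g ->
  (forall n s, 0 <= s <= t -> `|f n s| <= B) ->
  (forall s, 0 <= s <= t -> f ^~ s @ \oo --> g s) ->
  (fun n => prim (f n) t) @ \oo --> prim g t.
Proof.
move=> tf tg fB fg.
have [] := @dominated_convergence _ _ R leb `[0, t]%classic (measurable_itv _)
  (fun n s => (f n s)%:E) (fun s => (g s)%:E) (cst B%:E).
- move=> n; apply/measurable_EFinP; apply: measurable_funTS; exact: (tf n).1.
- by apply/measurable_EFinP; apply: measurable_funTS; exact: tg.1.
- apply: aeW => s /=; rewrite in_itv/= => st.
  by apply/fine_cvgP; split; [exact: nearW|exact: fg].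
- by apply: (tame_integrable t (f := fun=> B)); apply: tame_continuous; exact: continuous_cst.
- by apply: aeW => s n /=; rewrite in_itv/= => st; rewrite lee_fin fB.
move=> _ _.
have fin : (\int[leb]_(x in `[0%R, t]) (g x)%:E)%E \is a fin_num.
  by apply: integrable_fin_num => //; exact: tame_integrable.
rewrite -(fineK fin) => /fine_cvgP[_ h]; exact: h.
Qed.

Lemma continuous_prim f : tame f -> continuous (prim f).
Proof.
move=> tf t.
have [B hB] := tf.2 (Num.max t 0 + 1).
have B0 : 0 <= B.
  apply: le_trans (hB 0 _); first exact: normr_ge0.
  by rewrite lexx addr_ge0// le_max lexx orbT.
have primE s : prim f s = prim f (Num.max s 0).
  have [s0|s0] := leP s 0; last by [].
  by rewrite !prim_le0.
have lip x y : 0 <= x -> x <= y -> y <= Num.max t 0 + 1 -> `|prim f y - prim f x| <= B * (y - x).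
  move=> x0 xy yT; rewrite ler_norml -mulNr; apply/andP; split.
    apply: primB_ge => // z /andP[xz zy].
    by have := hB z; rewrite (le_trans x0)// (le_trans zy)// ler_norml => /(_ isT)/andP[].
  apply: primB_le => // z /andP[xz zy].
  by have := hB z; rewrite (le_trans x0)// (le_trans zy)// ler_norml => /(_ isT)/andP[].
apply/cvgrPdist_le => e e0.
have B10 : 0 < B + 1 by rewrite ltr_wpDl.
have : \forall s \near t, `|Num.max t 0 - Num.max s 0| <= Num.min 1 (e / (B + 1)).
  have h := continuous_maxr continuous_idr (continuous_cst 0) t.
  move/cvgrPdist_le : h; apply.
  by rewrite lt_min ltr01 divr_gt0.
apply: filterS => s; rewrite le_min => /andP[h1 h2].
rewrite (primE t) (primE s).
have t'0 : 0 <= Num.max t 0 by rewrite le_max lexx orbT.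
have s'0 : 0 <= Num.max s 0 by rewrite le_max lexx orbT.
have sT : Num.max s 0 <= Num.max t 0 + 1.
  by move: h1; rewrite distrC ler_norml => /andP[_]; rewrite lerBlDl.
apply: (@le_trans _ _ (B * `|Num.max t 0 - Num.max s 0|)); last first.
  apply: (@le_trans _ _ ((B + 1) * (e / (B + 1)))).
    by apply: ler_pM => //; rewrite lerDl.
  by rewrite mulrC divfK// gt_eqF.
have [st|/ltW ts] := leP (Num.max s 0) (Num.max t 0).
  by rewrite [X in _ <= B * X]ger0_norm ?subr_ge0// lip// lerDl.
by rewrite distrC [X in _ <= B * X]distrC [X in _ <= B * X]ger0_norm ?subr_ge0// lip.
Qed.

End primitive.

(** * Powers and the drift *)

Section powers.
Context (R : realType).

(** The cut at 0 makes positive powers continuous and nondecreasing on the whole line; [sign_power]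
    inherits both properties as [pos_power alpha x - pos_power alpha (- x)]. *)
Definition pos_power (p x : R) : R := Num.max x 0 `^ p.

Lemma pos_power_ge0 p x : 0 <= pos_power p x. Proof. exact: powR_ge0. Qed.

Lemma pos_powerE p x : 0 <= x -> pos_power p x = x `^ p.
Proof. by move=> x0; rewrite /pos_power max_l. Qed.

Lemma pos_power_le0 p x : p != 0 -> x <= 0 -> pos_power p x = 0.
Proof. by move=> p0 x0; rewrite /pos_power max_r// powR0. Qed.

Lemma le_pos_power p x y : 0 <= p -> x <= y -> pos_power p x <= pos_power p y.
Proof.
move=> p0 xy; have h (z : R) : Num.max z 0 \is Num.nneg by rewrite nnegrE le_max lexx orbT.
apply: ge0_ler_powR => //; by rewrite ge_max !le_max xy lexx orbT.
Qed.

Lemma continuous_pos_power p : 0 < p -> continuous (pos_power p).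
Proof.
move=> p0 x; have [x0|x0] := ltP 0 x.
  have c : {for x, continuous (fun y : R => expR (p * ln y))}.
    apply: (@cvg_comp _ _ _ (fun y : R => p * ln y) expR); last exact: continuous_expR.
    by apply: cvgM; [exact: cvg_cst|exact: continuous_ln].
  have e : pos_power p x = expR (p * ln x).
    by rewrite pos_powerE ?ltW// /powR gt_eqF.
  have c' : (fun y : R => expR (p * ln y)) y @[y --> x] --> pos_power p x by rewrite e.
  refine (cvg_trans _ c'); apply: near_eq_cvg.
  have : \forall y \near x, 0 < y by exact: lt_nbhsr.
  by apply: filterS => y y0; rewrite pos_powerE ?ltW// /powR gt_eqF.
apply/cvgrPdist_le => e e0.
rewrite pos_power_le0 ?gt_eqF//.
have d0 : 0 < e `^ p^-1 by exact: powR_gt0.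
have : \forall y \near x, y < x + e `^ p^-1 by apply: lt_nbhsl; rewrite ltrDl.
apply: filterS => y hy; rewrite sub0r normrN ger0_norm ?pos_power_ge0//.
have -> : e = pos_power p (e `^ p^-1).
  by rewrite pos_powerE ?powR_ge0// -powRrM mulVf ?gt_eqF// powRr1// ltW.
apply: le_pos_power; first exact: ltW.
by rewrite ltW// (lt_le_trans hy)// gerDr.
Qed.

Lemma sign_powerE (alpha x : R) : 0 < alpha ->
  sign_power alpha x = pos_power alpha x - pos_power alpha (- x).
Proof.
move=> a0; rewrite /sign_power; have aN0 : alpha != 0 by rewrite gt_eqF.
have [x0|x0|<-] := ltgtP 0 x.
- by rewrite gtr0_sg// mul1r gtr0_norm// pos_powerE ?ltW// (pos_power_le0 aN0) ?subr0// oppr_le0 ltW.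
- rewrite ltr0_sg// mulN1r ltr0_norm// (pos_power_le0 aN0 (ltW x0)) pos_powerE ?oppr_ge0 ?ltW//.
  by rewrite sub0r.
- by rewrite sgr0 mul0r oppr0 subrr.
Qed.

Lemma sign_power_ge0 (alpha x : R) : 0 < alpha -> 0 <= x -> sign_power alpha x = x `^ alpha.
Proof.
move=> a0 x0; have aN0 : alpha != 0 by rewrite gt_eqF.
by rewrite sign_powerE// pos_powerE// (pos_power_le0 aN0) ?subr0// oppr_le0.
Qed.

Lemma sign_powerN (alpha x : R) : sign_power alpha (- x) = - sign_power alpha x.
Proof. by rewrite /sign_power sgrN normrN mulNr. Qed.

Lemma le_sign_power (alpha x y : R) : 0 < alpha -> x <= y ->
  sign_power alpha x <= sign_power alpha y.
Proof.
move=> a0 xy; rewrite !sign_powerE//.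
by apply: lerB; apply: le_pos_power (ltW a0) _; rewrite ?lerN2.
Qed.

Lemma continuous_sign_power (alpha : R) : 0 < alpha -> continuous (sign_power alpha).
Proof.
move=> a0.
have -> : sign_power alpha = fun x => pos_power alpha x + - pos_power alpha (-1 * x).
  by apply/funext => x; rewrite sign_powerE// mulN1r.
have c := continuous_pos_power a0.
apply: (continuousDr c) => x; apply: cvgN.
exact: (continuous_compr c (continuousMr (continuous_cst (-1)) continuous_idr) x).
Qed.

End powers.

(** * The monotone Picard scheme *)

Section picard.
Context (R : realType) (alpha : R).
Hypotheses (alpha_gt0 : 0 < alpha) (alpha_lt1 : alpha < 1).
Local Notation b := (sign_power alpha).
Variable (w : R -> R).
Hypothesis cw : continuous w.

Definition kappa : R := (1 - alpha)^-1.

Let kappa0 : 0 < kappa. Proof. by rewrite invr_gt0 subr_gt0. Qed.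

(* A supersolution of the equation, for either sign of [w]: the iterates of [picard] start
   from it and decrease to the largest solution. *)
Definition envelope (t : R) : R :=
  2 * prim (fun s => `|w s|) t + pos_power kappa (2 * t).

Fixpoint picard n : R -> R :=
  if n is n'.+1 then fun t => prim (fun s => b (picard n' s)) t + prim w t else envelope.

Let cabs : continuous (fun s => `|w s|).
Proof. by move=> s; apply: cvg_norm; exact: cw. Qed.

Let tw : tame w. Proof. exact: tame_continuous. Qed.
Let tabs : tame (fun s => `|w s|). Proof. exact: tame_continuous. Qed.
Let cb : continuous b. Proof. exact: continuous_sign_power. Qed.

Lemma continuous_envelope : continuous envelope.
Proof.
exact: (continuousDr (continuousMr (continuous_cst 2) (continuous_prim tabs))
  (continuous_compr (continuous_pos_power kappa0) (continuousMr (continuous_cst 2) continuous_idr))).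
Qed.

Lemma continuous_picard n : continuous (picard n).
Proof.
elim: n => [|n IH]; first exact: continuous_envelope.
have c := tame_continuous (continuous_compr cb IH).
exact: (continuousDr (continuous_prim c) (continuous_prim tw)).
Qed.

Let tame_b (x : R -> R) : continuous x -> tame (fun s => b (x s)).
Proof. by move=> cx; exact: (tame_continuous (continuous_compr cb cx)). Qed.

Let prim_abs_mono s t : 0 <= s -> s <= t -> prim (fun s => `|w s|) s <= prim (fun s => `|w s|) t.
Proof.
move=> s0 st; rewrite -subr_ge0; apply: le_trans (primB_ge (m := 0) tabs s0 st _).
  by rewrite mul0r.
by move=> x _.
Qed.

Let prim_abs_ge0 t : 0 <= t -> 0 <= prim (fun s => `|w s|) t.
Proof. by move=> t0; have := prim_abs_mono (lexx 0) t0; rewrite prim_le0. Qed.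

Lemma envelope_mono s t : 0 <= s -> s <= t -> envelope s <= envelope t.
Proof.
move=> s0 st; apply: lerD; first by rewrite ler_pM2l// prim_abs_mono.
by apply: le_pos_power (ltW kappa0) _; rewrite ler_pM2l.
Qed.

Lemma envelope_ge0 t : 0 <= t -> 0 <= envelope t.
Proof. by move=> t0; rewrite addr_ge0 ?pos_power_ge0// mulr_ge0// prim_abs_ge0. Qed.

(** Half of the envelope absorbs the integral of [|w|]. The other half absorbs the drift: the power
    term gives [2 * t <= envelope t ^ (1 - alpha)], and since the envelope is nondecreasing, its
    drift up to [t] integrates to at most [t * b (envelope t)]. *)
Lemma envelope_super t : 0 <= t -> t * b (envelope t) + prim (fun s => `|w s|) t <= envelope t.
Proof.
move=> t0; have e0 := envelope_ge0 t0.
have A2 : prim (fun s => `|w s|) t <= envelope t / 2.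
  by rewrite /envelope ler_pdivlMr// mulrC lerDl pos_power_ge0.
suff : t * b (envelope t) <= envelope t / 2 by lra.
rewrite sign_power_ge0//.
have [e00|e00] := eqVneq (envelope t) 0.
  by rewrite e00 powR0 ?gt_eqF// mulr0 mul0r.
have e_gt0 : 0 < envelope t by rewrite lt_neqAle eq_sym e00.
have h : 2 * t <= envelope t `^ (1 - alpha).
  have k1 : kappa * (1 - alpha) = 1 by rewrite mulVf// subr_eq0 gt_eqF.
  have t20 : 0 <= 2 * t by rewrite mulr_ge0.
  have -> : 2 * t = ((2 * t) `^ kappa) `^ (1 - alpha) by rewrite -powRrM k1 powRr1.
  have a1 : 0 <= 1 - alpha by rewrite subr_ge0 ltW.
  apply: ge0_ler_powR => //; rewrite ?nnegrE ?powR_ge0//.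
  by rewrite -pos_powerE// /envelope lerDr mulr_ge0// prim_abs_ge0.
have E : envelope t = envelope t `^ (1 - alpha) * envelope t `^ alpha.
  by rewrite -powRD ?subrK ?powRr1// e00 implybT.
rewrite [X in _ <= X / 2]E -mulrAC ler_wpM2r ?powR_ge0//; lra.
Qed.

Lemma prim_ge (f : R -> R) t m : tame f -> 0 <= t -> (forall s, 0 <= s <= t -> m <= f s) ->
  t * m <= prim f t.
Proof.
move=> tf t0 fm; have := primB_ge tf (lexx 0) t0 fm.
by rewrite (prim_le0 f (lexx 0)) !subr0 mulrC.
Qed.

Lemma prim_le (f : R -> R) t m : tame f -> 0 <= t -> (forall s, 0 <= s <= t -> f s <= m) ->
  prim f t <= t * m.
Proof.
move=> tf t0 fm; have := primB_le tf (lexx 0) t0 fm.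
by rewrite (prim_le0 f (lexx 0)) !subr0 mulrC.
Qed.

Lemma picard_le0 n t : t <= 0 -> picard n t = 0.
Proof.
case: n => [|n] t0 /=; last by rewrite !prim_le0// addr0.
rewrite /envelope prim_le0// pos_power_le0 ?gt_eqF ?mulr0 ?addr0//.
by rewrite pmulr_rle0.
Qed.

(** The supersolution property starts the induction, and the monotone drift propagates the order. *)
Lemma picard_step n t : 0 <= t -> picard n.+1 t <= picard n t.
Proof.
elim: n t => [|n IH] t t0 /=.
  apply: le_trans (envelope_super t0); apply: lerD.
    apply: (prim_le (tame_b continuous_envelope) t0) => s /andP[s0 st].
    exact: le_sign_power alpha_gt0 (envelope_mono s0 st).
  by apply: le_prim => // s _; exact: ler_norm.
rewrite lerD2r; apply: le_prim.
- exact: (tame_b (continuous_picard (n := n.+1))).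
- exact: (tame_b (continuous_picard (n := n))).
- by move=> s /andP[s0 _]; apply: le_sign_power => //; exact: IH.
Qed.

(** As the drift is odd, [- envelope] is a subsolution, and the iteration stays above it. *)
Lemma picard_ge n t : 0 <= t -> - envelope t <= picard n t.
Proof.
elim: n t => [|n IH] t t0 /=.
  by have := envelope_ge0 t0; lra.
rewrite lerNl opprD; apply: le_trans (envelope_super t0); apply: lerD.
  rewrite lerNl -mulrN -sign_powerN; apply: prim_ge => //.
    exact: (tame_b (continuous_picard (n := n))).
  move=> s /andP[s0 st]; apply: le_sign_power => //.
  by apply: le_trans (IH s s0); rewrite lerN2 envelope_mono.
rewrite lerNl -primN//; apply: le_prim => //; first by apply: tame_continuous => s; apply: cvgN; exact: cabs.
by move=> s _; rewrite lerNl ler_normr lexx orbT.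
Qed.

Lemma picard_le n t : 0 <= t -> picard n t <= envelope t.
Proof.
by move=> t0; elim: n => [//|n IH]; exact: le_trans (picard_step n t0) IH.
Qed.

Definition solution (t : R) : R := limn (picard^~ t).

Lemma picard_cvg t : picard^~ t @ \oo --> solution t.
Proof.
suff : cvgn (picard^~ t) by [].
have [t0|/ltW t0] := leP 0 t; last first.
  have -> : picard^~ t = fun=> 0 by apply/funext => n; rewrite picard_le0.
  exact: is_cvg_cst.
apply: nonincreasing_is_cvgn; first by apply/nonincreasing_seqP => n; exact: picard_step.
by exists (- envelope t) => _ [n _ <-]; exact: picard_ge.
Qed.

Lemma solution_bound t : 0 <= t -> `|solution t| <= envelope t.
Proof.
move=> t0; rewrite ler_norml; apply/andP; split.
  by apply: (cvgr_to_ge (@picard_cvg t)); apply: nearW => n; exact: picard_ge.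
by apply: (cvgr_to_le (@picard_cvg t)); apply: nearW => n; exact: picard_le.
Qed.

Lemma tame_solution : tame (fun s => b (solution s)).
Proof.
split.
  have ms : measurable_fun setT solution.
    apply: (@measurable_fun_cvg _ _ R setT (fun n => picard n) solution).
      by move=> n; apply: continuous_measurable_fun; exact: continuous_picard.
    by move=> t _; exact: picard_cvg.
  exact: (measurableT_comp (continuous_measurable_fun cb) ms).
move=> T; exists (b (envelope T)) => s /andP[s0 sT].
have /ler_normlP[h1 h2] := le_trans (solution_bound s0) (envelope_mono s0 sT).
rewrite ler_norml -sign_powerN; apply/andP; split; apply: le_sign_power => //.
by rewrite lerNl.
Qed.

Lemma solution_eq t : solution t = prim (fun s => b (solution s)) t + prim w t.
Proof.
have [t0|/ltW t0] := leP 0 t; last first.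
  rewrite !prim_le0// addr0.
  have c0 : picard^~ t @ \oo --> (0 : R).
    have -> : picard^~ t = fun=> 0 by apply/funext => n; rewrite picard_le0.
    exact: cvg_cst.
  exact: (cvg_unique _ (@picard_cvg t) c0).
have c1 : (fun n => prim (fun s => b (picard n s)) t + prim w t) @ \oo -->
    prim (fun s => b (solution s)) t + prim w t.
  apply: cvgD; last exact: cvg_cst.
  apply: (@prim_cvg R (fun n s => b (picard n s)) (fun s => b (solution s)) t (b (envelope t))).
  - by move=> n; exact: (tame_b (continuous_picard (n := n))).
  - exact: tame_solution.
  - move=> n s /andP[s0 st]; rewrite ler_norml -sign_powerN.
    have et := envelope_mono s0 st.
    apply/andP; split; apply: le_sign_power => //.
      by apply: le_trans (picard_ge n s0); rewrite lerN2.
    by apply: le_trans (picard_le n s0) et.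
  - move=> s _; apply: (@cvg_comp _ _ _ (picard^~ s) b); [exact: picard_cvg|exact: cb].
have c2 : (fun n => picard n.+1 t) @ \oo --> solution t.
  by have := @picard_cvg t; rewrite -cvg_shiftS.
exact: (cvg_unique _ c2 c1).
Qed.

(** A decreasing limit of continuous functions need not be continuous; here the equation exhibits it
    as a sum of primitives. *)
Lemma continuous_solution : continuous solution.
Proof.
rewrite (_ : solution = fun t => prim (fun s => b (solution s)) t + prim w t); last first.
  by apply/funext => t; exact: solution_eq.
exact: (continuousDr (continuous_prim tame_solution) (continuous_prim tw)).
Qed.

End picard.

(** * Growth of the solution near time 0 *)

Section growth.
Context (R : realType) (alpha beta C : R).
Hypotheses (alpha_gt0 : 0 < alpha) (alpha_lt1 : alpha < 1).
Hypotheses (beta_gt0 : 0 < beta) (beta_gt : kappa alpha < 1 + beta) (C_ge0 : 0 <= C).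
Local Notation b := (sign_power alpha).
Local Notation kappa := (kappa alpha).

(* The solution [c] of [c ^ alpha * 2 ^ - kappa = 2 * c]: if [c * s ^ kappa] bounds an iterate
   from below, the drift integrated over the second half of [0, t] already contributes
   [2 * c * t ^ kappa] to the next one, and the excess absorbs the integral of [w]. *)
Definition growth_const : R := 2 `^ (- ((kappa + 1) * kappa)).

(** Solves [C * t ^ (1 + beta) <= growth_const * t ^ kappa], with [C + 1] in place of [C] to avoid
    division by zero; the cap 1 stays in the range where [w] is bounded. *)
Definition growth_time : R :=
  Num.min 1 ((growth_const / (C + 1)) `^ (1 + beta - kappa)^-1).

Let a1 : 0 < 1 - alpha. Proof. by rewrite subr_gt0. Qed.
Let kappa0 : 0 < kappa. Proof. by rewrite invr_gt0. Qed.
Let kappaM : kappa * (1 - alpha) = 1. Proof. by rewrite mulVf// gt_eqF. Qed.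
Let kappaA : kappa * alpha = kappa - 1. Proof. by rewrite -[in RHS]kappaM; ring. Qed.
Let c0 : 0 < growth_const. Proof. exact: powR_gt0. Qed.
Let C1 : 0 < C + 1. Proof. by rewrite ltr_wpDl. Qed.
Let e0 : 0 < 1 + beta - kappa. Proof. by rewrite subr_gt0. Qed.

Lemma growth_constE : growth_const `^ alpha = 2 * 2 `^ kappa * growth_const.
Proof.
have N2 : (2 : R) != 0 by [].
have -> : 2 * 2 `^ kappa = 2 `^ (1 + kappa) :> R by rewrite powRD ?N2 ?implybT// powRr1.
rewrite /growth_const -powRrM -powRD ?N2 ?implybT//; congr (_ `^ _).
have -> : - ((kappa + 1) * kappa) * alpha = - (kappa + 1) * (kappa * alpha) by ring.
by rewrite kappaA; ring.
Qed.

Lemma growth_const_le1 : growth_const <= 1.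
Proof.
rewrite -[leRHS](powRr0 2); apply: ler_powR; first by rewrite ler1n.
by rewrite oppr_le0 mulr_ge0// ltW// ltr_wpDl// ltW.
Qed.

Lemma growth_time_gt0 : 0 < growth_time.
Proof. by rewrite lt_min ltr01 powR_gt0// divr_gt0. Qed.

Lemma growth_time_le1 : growth_time <= 1.
Proof. by rewrite ge_min lexx. Qed.

Lemma growth_time_small t : 0 <= t -> t <= growth_time -> C * t `^ (1 + beta) <= growth_const * t `^ kappa.
Proof.
move=> t0; rewrite le_min => /andP[_ tt].
have -> : 1 + beta = (1 + beta - kappa) + kappa by rewrite subrK.
rewrite powRD; last by rewrite subrK (gt_eqF (ltr_pwDl ltr01 (ltW beta_gt0))).
rewrite mulrA ler_wpM2r ?powR_ge0//.
have h : t `^ (1 + beta - kappa) <= growth_const / (C + 1).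
  have g0 : 0 <= growth_const / (C + 1) by rewrite divr_ge0// ltW.
  have -> : growth_const / (C + 1) = ((growth_const / (C + 1)) `^ (1 + beta - kappa)^-1) `^ (1 + beta - kappa).
    by rewrite -powRrM mulVf ?gt_eqF// powRr1.
  by apply: ge0_ler_powR; rewrite ?nnegrE ?powR_ge0// ltW.
apply: (@le_trans _ _ ((C + 1) * (growth_const / (C + 1)))).
  by apply: ler_pM => //; [exact: powR_ge0|rewrite lerDl].
by rewrite mulrC divfK// gt_eqF.
Qed.

Variable (w : R -> R).
Hypotheses (cw : continuous w) (w_ge : forall s, 0 <= s <= 1 -> - (C * s `^ beta) <= w s).

(** The envelope satisfies the bound because [growth_const <= 1]. In the step, the drift is
    nonnegative on [[0, t / 2]], and on [[t / 2, t]] it is at least its value at the lower bound for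
    time [t / 2]. The bound has to be carried along from the first iterate, since other solutions
    violate it. *)
Lemma picard_growth n t : 0 <= t -> t <= growth_time ->
  growth_const * t `^ kappa <= picard alpha w n t.
Proof.
elim: n t => [|n IH] t t0 tt.
  have h1 : t `^ kappa <= (2 * t) `^ kappa.
    have t2 : t <= 2 * t by lra.
    by apply: (ge0_ler_powR (ltW kappa0)); rewrite ?nnegrE ?mulr_ge0.
  have h2 : 0 <= prim (fun s => `|w s|) t.
    rewrite -(mulr0 t); apply: prim_ge => //.
    by apply: tame_continuous => s; apply: cvg_norm; exact: cw.
  rewrite /= /envelope pos_powerE ?mulr_ge0//.
  have := growth_const_le1; have := powR_ge0 t kappa; nra.
have t1 : t <= 1 := le_trans tt growth_time_le1.
have tm : tame (fun s => b (picard alpha w n s)).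
  by apply: tame_continuous; exact: (continuous_compr (continuous_sign_power alpha_gt0) (continuous_picard alpha_gt0 alpha_lt1 cw (n := n))).
have tw : tame w by exact: tame_continuous.
have t20 : 0 <= t / 2 by rewrite divr_ge0.
have t2t : t / 2 <= t by lra.
have b0 s : 0 <= s <= t -> 0 <= b (picard alpha w n s).
  move=> /andP[s0 st]; have h := IH s s0 (le_trans st tt).
  rewrite sign_power_ge0 ?powR_ge0// (le_trans _ h)// mulr_ge0 ?powR_ge0//.
have h1 : 0 <= prim (fun s => b (picard alpha w n s)) (t / 2).
  rewrite -(mulr0 (t / 2)); apply: prim_ge => // s /andP[s0 st].
  by apply: b0; rewrite s0 (le_trans st).
have h2 : (growth_const * (t / 2) `^ kappa) `^ alpha * (t - t / 2) <=
    prim (fun s => b (picard alpha w n s)) t - prim (fun s => b (picard alpha w n s)) (t / 2).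
  apply: primB_ge => // s /andP[ts st].
  have s0 : 0 <= s by exact: le_trans ts.
  have hs := IH s s0 (le_trans st tt).
  have g0 : 0 <= growth_const * (t / 2) `^ kappa by rewrite mulr_ge0 ?powR_ge0.
  rewrite -(sign_power_ge0 alpha_gt0 g0); apply: le_sign_power => //.
  apply: le_trans hs; rewrite ler_pM2l//.
  by apply: (ge0_ler_powR (ltW kappa0)); rewrite ?nnegrE.
have h3 : - (C * t `^ (1 + beta)) <= prim w t.
  have -> : - (C * t `^ (1 + beta)) = t * (- (C * t `^ beta)).
    rewrite powRD; last by rewrite (gt_eqF (ltr_pwDl ltr01 (ltW beta_gt0))).
    by rewrite powRr1//; ring.
  apply: prim_ge => // s /andP[s0 st]; apply: (le_trans _ (w_ge _)).
    rewrite lerN2 ler_wpM2l//; by apply: (ge0_ler_powR (ltW beta_gt0)); rewrite ?nnegrE// (le_trans s0).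
  by rewrite s0 (le_trans st).
have h4 : (growth_const * (t / 2) `^ kappa) `^ alpha * (t - t / 2) = 2 * (growth_const * t `^ kappa).
  rewrite powRM ?powR_ge0// ?ltW// -powRrM kappaA growth_constE.
  have -> : t - t / 2 = t / 2 by lra.
  (* As [kappa * alpha = kappa - 1], the length [t / 2] of the interval restores the exponent:
     [kappa] is the only power that the drift reproduces. *)
  have h5 : (t / 2) `^ (kappa - 1) * (t / 2) = (t / 2) `^ kappa.
    have [->|tN0] := eqVneq t 0.
      by rewrite mul0r mulr0 powR0// gt_eqF.
    rewrite -[X in _ * X](@powRr1 R (t / 2))// -powRD ?subrK//.
    by rewrite mulf_neq0 ?implybT.
  rewrite -mulrA h5 powRM// -powR_inv1// -powRrM mulN1r powRN.
  field; by rewrite gt_eqF// powR_gt0.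
have := growth_time_small t0 tt; rewrite /=; lra.
Qed.

Lemma solution_growth : 0 < solution alpha w growth_time.
Proof.
have t0 := growth_time_gt0.
apply: (@lt_le_trans _ _ (growth_const * growth_time `^ kappa)).
  by rewrite mulr_gt0// powR_gt0.
apply: (cvgr_to_ge (picard_cvg alpha_gt0 alpha_lt1 cw (t := growth_time))).
by apply: nearW => n; apply: picard_growth => //; exact: ltW.
Qed.

End growth.

(** * Riemann sums and adaptedness *)

Section riemann.
Context (R : realType).

(** Such sums present the integral of a process up to [t] as a limit of combinations of its values
    at times in [[0, t]], so that measurability with respect to the past at [t] passes to the
    integral. *)
Definition right_sum (f : R -> R) (t : R) (k : nat) : R :=
  \sum_(j < k.+1) t / k.+1%:R * f (j.+1%:R * (t / k.+1%:R)).

Lemma right_sum_cvg f t : continuous f -> 0 < t -> right_sum f t @ \oo --> prim f t.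
Proof.
move=> cf t0.
pose h k := t / k.+1%:R.
have h0 k : 0 < h k by rewrite divr_gt0.
(* For [s] in []0, t]] this is the first grid point at or after [s], counted backwards from [t]. The
   sum is then the exact integral of [f (u k s)], and dominated convergence applies. *)
pose u k s := t - (Num.truncn ((t - s) / h k))%:R * h k.
have u_le k s : u k s <= t by rewrite gerBl mulr_ge0// ltW.
have u_itv k s : s <= t -> s <= u k s < s + h k.
  move=> st; have q0 : 0 <= (t - s) / h k by rewrite divr_ge0 ?subr_ge0// ltW.
  have /andP[q1 q2] := truncn_itv q0.
  move: q1 q2; rewrite ler_pdivlMr// ltr_pdivrMr// -natr1 /u; set q := _%:R => q1 q2.
  have E : (q + 1) * h k = q * h k + h k by ring.
  by apply/andP; split; move: q1 q2; rewrite ?E; lra.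
have u_ge0 k s : 0 <= s -> 0 <= u k s.
  move=> s0; have [st|/ltW ts] := leP s t.
    by have /andP[us _] := u_itv k s st; exact: le_trans us.
  have q0 : (t - s) / h k <= 0 by rewrite pmulr_lle0 ?invr_gt0// subr_le0.
  rewrite /u (_ : Num.truncn _ = 0%N) ?mul0r ?subr0 ?ltW//.
  by apply/truncn0Pn; rewrite -ltNge (le_lt_trans q0).
have mu k : measurable_fun setT (u k).
  apply: nondecreasing_measurable => // x y xy; rewrite /u lerD2l lerN2 ler_wpM2r ?(ltW (h0 k))//.
  by rewrite ler_nat le_truncn// ler_wpM2r ?invr_ge0 ?(ltW (h0 k))// lerD2l lerN2.
have [B hB] := (tame_continuous cf).2 t.
have fB k s : 0 <= s -> `|f (u k s)| <= B.
  by move=> s0; apply: hB; rewrite u_ge0//= u_le.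
have tu k : tame (fun s => f (u k s)).
  split; first exact: (measurableT_comp (continuous_measurable_fun cf) (mu k)).
  by move=> T; exists B => s /andP[s0 _]; exact: fB.
have E k : right_sum f t k = prim (fun s => f (u k s)) t.
  have hk : t = k.+1%:R * h k by rewrite mulrC divfK.
  have gen m : (m <= k.+1)%N -> prim (fun s => f (u k s)) (m%:R * h k) =
      \sum_(j < m) h k * f (j.+1%:R * h k).
    elim: m => [|m IH] mk; first by rewrite mul0r prim_le0// big_ord0.
    rewrite big_ord_recr/= -IH ?(ltnW mk)//; apply/eqP; rewrite addrC -subr_eq; apply/eqP.
    have m0 : 0 <= m%:R * h k by rewrite mulr_ge0// ltW.
    have mm : m%:R * h k <= m.+1%:R * h k by rewrite ler_wpM2r ?ler_nat// ltW.
    rewrite primB//.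
    transitivity (\int[lebesgue_measure]_(x in `]m%:R * h k, m.+1%:R * h k]) (fun=> f (m.+1%:R * h k)) x).
      apply: eq_Rintegral => s; rewrite inE/= in_itv/= => /andP[s1 s2]; congr f.
      rewrite /u (_ : Num.truncn _ = (k.+1 - m.+1)%N).
        by rewrite natrB// {1}hk; ring.
      apply: truncn_def; rewrite ler_pdivlMr// ltr_pdivrMr//.
      rewrite subnSK// !natrB ?(ltnW mk)// !mulrBl -hk.
      by rewrite lerD2l lerN2 s2/= ltrD2l ltrN2.
    rewrite Rintegral_cst// [X in fine X](_ : _ = lebesgue_measure (`]m%:R * h k, m.+1%:R * h k]%classic : set R))//.
    rewrite lebesgue_measure_itv/= lte_fin ltr_pM2r// ltr_nat ltnSn/=.
    by rewrite -natr1; ring.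
  by rewrite {2}hk gen.
rewrite (_ : right_sum f t = fun k => prim (fun s => f (u k s)) t); last by apply/funext.
apply: (@prim_cvg R (fun k s => f (u k s)) f t B) => //.
- exact: tame_continuous.
- by move=> k s /andP[s0 _]; exact: fB.
move=> s /andP[s0 st]; apply: (@cvg_comp _ _ _ (u^~ s) f); last exact: cf.
apply/cvgrPdist_le => e e0; exists (Num.truncn (t / e)) => // k /= hk.
have /andP[u1 u2] := u_itv k s st.
rewrite distrC ger0_norm ?subr_ge0//.
have : h k <= e.
  rewrite ler_pdivrMr// mulrC -ler_pdivrMr// ltW// (lt_le_trans (truncnS_gt _))//.
  by rewrite ler_nat.
lra.
Qed.

Section processes.
Context d (T : measurableType d) (alpha : R).
Hypotheses (alpha_gt0 : 0 < alpha) (alpha_lt1 : alpha < 1).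

Lemma measurable_prim (V : R -> T -> R) t : (forall z, continuous (V^~ z)) ->
  (forall s, 0 <= s <= t -> measurable_fun setT (V s)) ->
  measurable_fun setT (fun z => prim (V^~ z) t).
Proof.
move=> cV mV; have [t0|t0] := ltP 0 t; last first.
  by rewrite (_ : (fun _ => _) = cst 0)//; apply/funext => z; rewrite prim_le0.
apply: (@measurable_fun_cvg _ _ R setT (fun k z => right_sum (V^~ z) t k)).
  move=> k; apply: measurable_sum => j; apply: measurable_funM => //; apply: mV.
  by rewrite mulr_ge0 ?divr_ge0 ?(ltW t0)//= mulrCA ger_pMr// ler_pdivrMr// mul1r ler_nat.
by move=> z _; exact: right_sum_cvg.
Qed.

Variables (W : R -> T -> R) (t : R).
Hypotheses (cW : forall z, continuous (W^~ z))
  (mW : forall s, 0 <= s <= t -> measurable_fun setT (W s)).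

Lemma measurable_picard n s : 0 <= s <= t ->
  measurable_fun setT (fun z => picard alpha (W^~ z) n s).
Proof.
elim: n s => [|n IH] s /andP[s0 st] /=.
  apply: measurable_funD => //; apply: measurable_funM => //.
  apply: (measurable_prim (V := fun s z => `|W s z|)).
    by move=> z r; apply: cvg_norm; exact: cW.
  by move=> r /andP[r0 rs]; apply: measurableT_comp => //; apply: mW; rewrite r0 (le_trans rs).
have le_t r : 0 <= r <= s -> 0 <= r <= t by move=> /andP[-> rs]; rewrite (le_trans rs).
apply: measurable_funD.
  apply: (measurable_prim (V := fun s z => sign_power alpha (picard alpha (W^~ z) n s))).
    move=> z; exact: (continuous_compr (continuous_sign_power alpha_gt0)
      (continuous_picard alpha_gt0 alpha_lt1 (cW (z := z)) (n := n))).
  move=> r rs; apply: (measurableT_comp (continuous_measurable_fun (continuous_sign_power alpha_gt0))).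
  exact: IH (le_t r rs).
by apply: measurable_prim => // r rs; exact: mW (le_t r rs).
Qed.

(** Meant for the space equipped with the past sigma-algebra at [t], where it says that the solution
    is adapted; hence the restriction of [mW] to times up to [t]. *)
Lemma measurable_solution : 0 <= t -> measurable_fun setT (fun z => solution alpha (W^~ z) t).
Proof.
move=> t0; apply: (@measurable_fun_cvg _ _ R setT (fun n z => picard alpha (W^~ z) n t)).
  by move=> n; apply: measurable_picard; rewrite t0 lexx.
by move=> z _; exact: (picard_cvg alpha_gt0 alpha_lt1 (cW (z := z)) (t := t)).
Qed.

End processes.

End riemann.

(** * The two weak solutions *)

Section weak_solutions.
Context (R : realType) (alpha beta : R).
Hypotheses (alpha_gt0 : 0 < alpha) (alpha_lt1 : alpha < 1).
Hypotheses (beta_gt0 : 0 < beta) (beta_lt : beta < 1 / 2).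
Local Notation mu := (@source_prob R).
Local Notation b := (sign_power alpha).
Local Notation W := (@brownian R beta).

Definition upper_solution (t : R) (z : source R) : R := solution alpha (W^~ z) t.

Definition lower_solution (t : R) (z : source R) : R :=
  - solution alpha (fun s => - W s z) t.

Let cW z : continuous (W^~ z) := continuous_brownian beta_gt0 beta_lt (z := z).

Let cNW z : continuous (fun s => - W s z).
Proof. by move=> s; apply: cvgN; exact: cW. Qed.

Let measurable_W s t : 0 <= s <= t ->
  measurable_fun setT (W s : g_sigma_algebraType (past_sets beta t) -> R).
Proof.
move=> /andP[s0 st] _ B mB; rewrite setTI.
apply: (filtration_mono (past_filtrationP beta_gt0 beta_lt) s0 st).
exact: brownian_adapted_past.
Qed.

Lemma upper_solution_adapted : adapted (past_filtration beta) upper_solution.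
Proof.
move=> t t0 B mB; rewrite -[_ @^-1` _]setTI.
apply: (@measurable_solution R _ (g_sigma_algebraType (past_sets beta t)) alpha
  alpha_gt0 alpha_lt1 W t cW _ t0 measurableT B mB) => s; exact: measurable_W.
Qed.

Lemma lower_solution_adapted : adapted (past_filtration beta) lower_solution.
Proof.
move=> t t0 B mB; rewrite -[_ @^-1` _]setTI.
apply: (measurable_funN (f := fun z : g_sigma_algebraType (past_sets beta t) =>
  solution alpha (fun s => - W s z) t)) => //.
apply: (@measurable_solution R _ (g_sigma_algebraType (past_sets beta t)) alpha
  alpha_gt0 alpha_lt1 (fun s z => - W s z) t cNW _ t0) => s st.
by apply: measurable_funN; exact: measurable_W.
Qed.

Lemma upper_solution_continuous : continuous_paths upper_solution.
Proof. by move=> z; apply: continuous_subspaceT; exact: continuous_solution. Qed.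

Lemma lower_solution_continuous : continuous_paths lower_solution.
Proof.
move=> z; apply: continuous_subspaceT => t; apply: cvgN.
exact: (continuous_solution alpha_gt0 alpha_lt1 (cNW (z := z)) (x := t)).
Qed.

Lemma upper_solution_eq t z :
  upper_solution t z = prim (fun s => b (upper_solution s z)) t + prim (W^~ z) t.
Proof. exact: solution_eq. Qed.

(** Since the drift is odd, negation carries the equation driven by [-W] to the one driven by
    [W]. *)
Lemma lower_solution_eq t z :
  lower_solution t z = prim (fun s => b (lower_solution s z)) t + prim (W^~ z) t.
Proof.
have cS := continuous_solution alpha_gt0 alpha_lt1 (cNW (z := z)).
rewrite /lower_solution solution_eq// opprD; congr (_ + _).
  rewrite -primN; first by congr (prim _ t); apply/funext => s; rewrite -sign_powerN.
  exact: tame_solution.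
by rewrite primN ?opprK//; apply: tame_continuous; exact: cW.
Qed.

Definition upper_weak_solution : weak_solution b :=
  @WeakSolution R b _ (source R) mu (past_filtration beta) upper_solution W
    (past_filtrationP beta_gt0 beta_lt) upper_solution_adapted
    upper_solution_continuous (brownian_motionP beta_gt0 beta_lt)
    (aeW mu (fun z => etrans (upper_solution_eq 0 z)
       (etrans (f_equal2 +%R (prim_le0 _ (lexx 0)) (prim_le0 _ (lexx 0))) (addr0 0))))
    (aeW mu (fun z t _ => upper_solution_eq t z)).

Definition lower_weak_solution : weak_solution b :=
  @WeakSolution R b _ (source R) mu (past_filtration beta) lower_solution W
    (past_filtrationP beta_gt0 beta_lt) lower_solution_adapted
    lower_solution_continuous (brownian_motionP beta_gt0 beta_lt)
    (aeW mu (fun z => etrans (lower_solution_eq 0 z)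
       (etrans (f_equal2 +%R (prim_le0 _ (lexx 0)) (prim_le0 _ (lexx 0))) (addr0 0))))
    (aeW mu (fun z t _ => lower_solution_eq t z)).

(** Up to time 1 the path consists of its first unit piece, whose source is [lft z]. *)
Lemma brownian_bound K z t : good beta K%:R (lft z) -> 0 <= t <= 1 ->
  `|W t z| <= K%:R * (1 + tail beta) * t `^ beta.
Proof.
move=> gz /andP[t0 t1]; rewrite (@brownianE R beta 1)//= addr0 max_l// min_l//.
by apply: unit_path_bound => //; [exists K|rewrite t0].
Qed.

Hypothesis beta_gt : kappa alpha < 1 + beta.

Lemma laws_differ : ~ same_law upper_weak_solution lower_weak_solution.
Proof.
have e4 : 0 < 1 / 4 :> R by rewrite divr_gt0.
have [K hK] := good_prob beta_lt e4.
pose C := K%:R * (1 + tail beta).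
have C0 : 0 <= C by rewrite mulr_ge0// addr_ge0// ltW// tail_gt0.
pose t0 := growth_time alpha beta C.
have t00 : 0 <= t0 by rewrite ltW// growth_time_gt0.
pose G : set (source R) := lft @^-1` good beta K%:R.
have mgood := measurable_good beta K%:R.
have mG : measurable G := preserves_measurable (lft_preserves R) mgood.
have GC : (mu (~` G) <= (1 / 4)%:E)%E.
  by rewrite (_ : ~` G = lft @^-1` (~` good beta K%:R))// (lft_preserves R).2//; exact: measurableC.
pose A : set (path_space R) := [set x | 0 < x t0].
have mA : measurable A.
  apply: sub_sigma_algebra; exists t0, `]0, +oo[%classic; split => //.
  by apply/seteqP; split => x; rewrite /A /= in_itv/= andbT.
move=> /(_ A mA) E.
pose E1 : set (source R) := [set z | 0 < upper_solution t0 z].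
pose E2 : set (source R) := [set z | 0 < lower_solution t0 z].
have E12 : mu E1 = mu E2 by exact: E.
have mE (X : R -> source R -> R) : adapted (past_filtration beta) X ->
    measurable [set z | 0 < X t0 z].
  move=> aX; have := filtration_measurable (past_filtrationP beta_gt0 beta_lt) t00
    (aX t0 t00 `]0, +oo[%classic (measurable_itv _)).
  by congr measurable; apply/seteqP; split => z /=; rewrite in_itv/= andbT.
have mE1 := mE _ upper_solution_adapted.
have mE2 := mE _ lower_solution_adapted.
(* On [G] the bound on [|W|] makes the solution grow both for [W], as here, and for [-W], which then
   forces the lower solution to be negative at [t0]. *)
have GE1 : setT `<=` E1 `|` ~` G.
  move=> z _; have [gz|] := pselect (G z); [left|by right].
  apply: (solution_growth alpha_gt0 alpha_lt1 beta_gt0 beta_gt C0 (cW (z := z))) => s s01.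
  by rewrite lerNl (le_trans _ (brownian_bound gz s01))// ler_normr lexx orbT.
have GE2 : E2 `<=` ~` G.
  move=> z /= h gz; move: h; apply/negP; rewrite -leNgt oppr_le0 ltW//.
  apply: (solution_growth alpha_gt0 alpha_lt1 beta_gt0 beta_gt C0 (cNW (z := z))) => s s01.
  by rewrite lerN2 (le_trans _ (brownian_bound gz s01))// ler_norm.
have mGC : measurable (~` G) by exact: measurableC.
have h1 : (1 <= mu E1 + mu (~` G))%E.
  rewrite -(@probability_setT _ _ R mu).
  apply: (le_trans _ (measureU2 mu mE1 mGC)); apply: le_measure => //; rewrite inE//.
  exact: measurableU.
have h2 : (mu E1 <= mu (~` G))%E by rewrite E12; apply: le_measure; rewrite ?inE.
(* Equal laws would give [1 <= 1 / 4 + 1 / 4]. *)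
have := le_trans h1 (leeD (le_trans h2 GC) GC).
by rewrite -EFinD lee_fin; lra.
Qed.

End weak_solutions.

Theorem mainTheorem2 (R : realType) (alpha : R)
    (alpha_gt0 : 0 < alpha) (alpha_lt : alpha < 1 / 3) :
  ~ uniqueness_in_law (sign_power alpha) /\
  exists S1 S2 : weak_solution (sign_power alpha), ~ same_law S1 S2.
Proof.
suff ex : exists S1 S2 : weak_solution (sign_power alpha), ~ same_law S1 S2.
  by split => // U; have [S1 [S2]] := ex; apply; exact: U.
have a1 : alpha < 1 by lra.
have k_gt1 : 1 < kappa alpha by rewrite /kappa invf_gt1; lra.
have k_lt : kappa alpha < 3 / 2.
  rewrite /kappa -[ltRHS]invrK ltf_pV2 ?posrE ?invf_div; lra.
(* The midpoint of [kappa - 1] and [1 / 2]: this is where [alpha < 1 / 3] is needed. *)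
pose beta := (kappa alpha - 1 / 2) / 2.
have beta_gt0 : 0 < beta by rewrite /beta; lra.
have beta_lt : beta < 1 / 2 by rewrite /beta; lra.
have beta_gt : kappa alpha < 1 + beta by rewrite /beta; lra.
exists (upper_weak_solution alpha_gt0 a1 beta_gt0 beta_lt).
exists (lower_weak_solution alpha_gt0 a1 beta_gt0 beta_lt).
exact: laws_differ beta_gt.
Qed.
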